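(* Let $\mathcal{E}=\{|\varphi_i\rangle^{AB},p_i\}_{i=1}^m$ be a finite ensemble of pure bipartite states. Then for $Q\geq 0$, \[ E^*(0,Q)=\begin{cases} \max\{S(\mathcal{E}_B)-Q,\,0\} & \text{if } Q\geq \chi(\mathcal{E}_B)/2,\\ +\infty & \text{otherwise.}\end{cases} \]
   Context: Let $\mathcal{E}=\{|\varphi_i\rangle^{AB},p_i\}_{i=1}^m$ be a finite ensemble of pure states on a finite-dimensional Hilbert space $\mathcal H_A\otimes\mathcal H_B$ ($p$ a probability distribution). For $i^n=i_1\dots i_n$ write $p_{i^n}=p_{i_1}\cdots p_{i_n}$ and $|\varphi_{i^n}\rangle=|\varphi_{i_1}\rangle\otimes\cdots\otimes|\varphi_{i_n}\rangle$ on $(\mathcal H_A\otimes\mathcal H_B)^{\otimes n}$. A protocol for $\mathcal{E}^{\otimes n}$ with parameters $(d_C,d_Q,d_E)$ is as follows. Alice (sender) and Bob (receiver) share the maximally entangled state $d_E^{-1/2}\sum_{k=1}^{d_E}|k\rangle|k\rangle$; Bob's half is register $B_2$. Alice is given $i^n$ with probability $p_{i^n}$ and applies a quantum operation $E_{i^n}$ to her half, with output of the form $\sum_{j=1}^{d_C}\rho^{AB_1B_2}_{i^n,j}\otimes q(j|i^n)|j\rangle\langle j|^C$, where $B_1$ is a $d_Q$-dimensional quantum system, $\{|j\rangle\}$ is orthonormal and $q(\cdot|i^n)$ is a probability distribution. Alice sends $B_1$ to Bob over a noiseless quantum channel and the classical value $j$ over a noiseless classical channel; Bob applies a quantum operation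 $D_j$ to $B_1B_2$. Let $\tilde\varphi_{i^n}$ denote the resulting joint Alice–Bob state (on $A^nB^n$), averaged over $j$. The protocol has fidelity $1-\epsilon$ if $\sum_{i^n}p_{i^n}\langle\varphi_{i^n}|\tilde\varphi_{i^n}|\varphi_{i^n}\rangle\geq 1-\epsilon$. A triple of nonnegative reals $(R,Q,E)$ is achievable for $\mathcal{E}$ if for all $\delta,\epsilon>0$ there is $N$ such that for all $n>N$ there is a protocol for $\mathcal{E}^{\otimes n}$ with fidelity $1-\epsilon$ and $\frac1n\log d_C\leq R+\delta$, $\frac1n\log d_Q\leq Q+\delta$, $\frac1n\log d_E\leq E+\delta$ (logs base 2). Define $E^*(R,Q)=\inf\{E:(R,Q,E)\text{ achievable}\}$ (with $\inf\emptyset=+\infty$). $S(\rho)=-\mathrm{Tr}\,\rho\log\rho$ is the von Neumann entropy; $\mathcal{E}_B=\{\varphi_i^B,p_i\}$ is the ensemble of reduced states on $B$, $S(\mathcal{E}_B)=S(\sum_ip_i\varphi_i^B)$, and $\chi(\mathcal{E}_B)=S(\mathcal{E}_B)-\sum_ip_iS(\varphi_i^B)$ is the Holevo quantity. *)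

(* Defs.v *)
From HB Require Import structures.
From mathcomp Require Import all_boot all_order all_algebra.
From mathcomp Require Import complex.
From mathcomp Require Import all_classical all_reals.
From mathcomp Require Import ereal exp.

Set Implicit Arguments.
Unset Strict Implicit.
Unset Printing Implicit Defensive.

Import Order.TTheory GRing.Theory Num.Theory.
Local Open Scope ring_scope.

Section QInfo.
Variable R : realType.
Local Notation C := R[i].

(* Operators between finite-dimensional Hilbert spaces C^T, C^U, where *)
(* the orthonormal bases are indexed by finite types.  An operator     *)
(* from C^T to C^U is its matrix U x T (rows U, columns T).            *)
Definition op (U T : finType) := U -> T -> C.
Definition vec (T : finType) := T -> C.

Definition opmul (U V T : finType) (A : op U V) (B : op V T) : op U T :=
  fun u t => \sum_(v : V) A u v * B v t.

Definition adj (U T : finType) (A : op U T) : op T U :=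
  fun t u => conjc (A u t).

Definition idop (T : finType) : op T T := fun x y => (x == y)%:R.

Definition optrace (T : finType) (A : op T T) : C := \sum_(x : T) A x x.

Definition opadd (U T : finType) (A B : op U T) : op U T := fun u t => A u t + B u t.
Definition opscale (U T : finType) (c : C) (A : op U T) : op U T := fun u t => c * A u t.
Definition opzero (U T : finType) : op U T := fun _ _ => 0.
Definition opsum (I : Type) (U T : finType) (s : seq I) (F : I -> op U T) : op U T :=
  fun u t => \sum_(i <- s) F i u t.

Definition proj (T : finType) (v : vec T) : op T T := fun x y => v x * conjc (v y).

Definition expect (T : finType) (v : vec T) (A : op T T) : C :=
  \sum_(x : T) \sum_(y : T) conjc (v x) * A x y * v y.

Definition unit_vec (T : finType) (v : vec T) : Prop :=
  \sum_(x : T) conjc (v x) * v x = 1.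

Definition hermitian (T : finType) (A : op T T) : Prop := forall x y, A x y = conjc (A y x).

Definition psd (T : finType) (A : op T T) : Prop :=
  hermitian A /\ forall v : vec T, 0 <= expect v A.

Definition density (T : finType) (rho : op T T) : Prop := psd rho /\ optrace rho = 1.

Definition distr (I : finType) (p : I -> R) : Prop :=
  (forall i, 0 <= p i) /\ \sum_(i : I) p i = 1.

Definition kron_id_r (U T V : finType) (K : op U T) : op (U * V)%type (T * V)%type :=
  fun uv tv => K uv.1 tv.1 * (uv.2 == tv.2)%:R.
Definition kron_id_l (V U T : finType) (K : op U T) : op (V * U)%type (V * T)%type :=
  fun vu vt => (vu.1 == vt.1)%:R * K vu.2 vt.2.

(* Quantum operations (CPTP maps) from C^T to C^U, in Kraus form       *)
Definition cptp (U T : finType) (Ks : seq (op U T)) : Prop :=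
  opsum Ks (fun K => opmul (adj K) K) = @idop T.

Definition kraus_apply (U T : finType) (Ks : seq (op U T)) (rho : op T T) : op U U :=
  opsum Ks (fun K => opmul (opmul K rho) (adj K)).

Definition cre (z : C) : R := let: Complex x _ := z in x.

Definition log2 (x : R) : R := ln x / ln 2.

Definition eta (x : R) : R := if 0 < x then - (x * log2 x) else 0.

Definition opmx (T : finType) (A : op T T) : 'M[C]_#|T| :=
  \matrix_(i, j) A (enum_val i) (enum_val j).

(* eigenvalues (with multiplicity) = roots of the characteristic polynomial *)
Definition eigenvalues (T : finType) (A : op T T) : seq C :=
  sval (closed_field_poly_normal (char_poly (opmx A))).

(* von Neumann entropy S(rho) = - Tr rho log rho = sum_lambda eta(lambda) *)
Definition vN_entropy (T : finType) (rho : op T T) : R :=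
  \sum_(z <- eigenvalues rho) eta (cre z).

Definition ptraceA (TA TB : finType) (rho : op (TA * TB)%type (TA * TB)%type) : op TB TB :=
  fun b b' => \sum_(a : TA) rho (a, b) (a, b').

Definition ensB_state (TA TB : finType) (m : nat) (p : 'I_m -> R)
  (phi : 'I_m -> vec (TA * TB)%type) : op TB TB :=
  fun b b' => \sum_(i < m) (p i)%:C%C * ptraceA (proj (phi i)) b b'.

Definition S_EB (TA TB : finType) (m : nat) (p : 'I_m -> R)
  (phi : 'I_m -> vec (TA * TB)%type) : R := vN_entropy (ensB_state p phi).

Definition holevo_B (TA TB : finType) (m : nat) (p : 'I_m -> R)
  (phi : 'I_m -> vec (TA * TB)%type) : R :=
  S_EB p phi - \sum_(i < m) p i * vN_entropy (ptraceA (proj (phi i))).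

Definition seqidx (m n : nat) := {ffun 'I_n -> 'I_m}.
Definition An (TA : finType) (n : nat) := {ffun 'I_n -> TA}.
Definition Bn (TB : finType) (n : nat) := {ffun 'I_n -> TB}.

Definition pn (m n : nat) (p : 'I_m -> R) (ii : seqidx m n) : R :=
  \prod_(k < n) p (ii k).

(* |phi_{i^n}> = |phi_{i_1}> (x) ... (x) |phi_{i_n}>, with (A B)^{(x)n}  *)
(* identified with A^n B^n                                              *)
Definition phin (TA TB : finType) (m n : nat) (phi : 'I_m -> vec (TA * TB)%type)
  (ii : seqidx m n) : vec (An TA n * Bn TB n)%type :=
  fun ab => \prod_(k < n) phi (ii k) (ab.1 k, ab.2 k).

(* maximally entangled state d_E^{-1/2} sum_k |k>|k> (Alice's half first) *)
Definition maxent (dE : nat) : vec ('I_dE * 'I_dE)%type :=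
  fun kk => (kk.1 == kk.2)%:R * ((Num.sqrt (dE%:R : R))^-1)%:C%C.

(* Protocols for E^{(x) n} with parameters (d_C, d_Q, d_E) and         *)
(* fidelity 1 - eps.                                                   *)
(*  - Alice's operation E_{i^n}: Kraus operators from her half 'I_dE   *)
(*    of the entangled state to A^n (x) B_1 (x) C, B_1 = C^{d_Q},      *)
(*    C = C^{d_C} (classical register);                                *)
(*  - its output (E_{i^n} (x) id_{B_2})(Phi) has the form              *)
(*    sum_j rho_{i^n,j}^{A B_1 B_2} (x) q(j|i^n) |j><j|^C;             *)
(*  - Bob's operation D_j : B_1 B_2 -> B^n (independent of i^n);       *)
(*  - final state  sum_j q(j|i^n) (id_{A^n} (x) D_j)(rho_{i^n,j}).     *)
Definition protocol (TA TB : finType) (m : nat) (p : 'I_m -> R)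
  (phi : 'I_m -> vec (TA * TB)%type) (n dC dQ dE : nat) (eps : R) : Prop :=
  (0 < dC)%N /\ (0 < dQ)%N /\ (0 < dE)%N /\
  exists (Enc : seqidx m n -> seq (op ((An TA n * 'I_dQ) * 'I_dC)%type 'I_dE))
         (q : seqidx m n -> 'I_dC -> R)
         (rho : seqidx m n -> 'I_dC ->
                op (An TA n * ('I_dQ * 'I_dE)%type)%type (An TA n * ('I_dQ * 'I_dE)%type)%type)
         (Dec : 'I_dC -> seq (op (Bn TB n) ('I_dQ * 'I_dE)%type)),
    (forall ii, cptp (Enc ii)) /\
    (forall ii, distr (q ii)) /\
    (forall ii j, density (rho ii j)) /\
    (forall ii,
       kraus_apply [seq @kron_id_r _ _ 'I_dE K | K <- Enc ii] (proj (@maxent dE)) =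
       (fun (x y : (((An TA n * 'I_dQ) * 'I_dC) * 'I_dE)%type) =>
          (q ii x.1.2)%:C%C * (x.1.2 == y.1.2)%:R *
          rho ii x.1.2 (x.1.1.1, (x.1.1.2, x.2)) (y.1.1.1, (y.1.1.2, y.2)))) /\
    (forall j, cptp (Dec j)) /\
    1 - eps <=
      \sum_(ii : seqidx m n)
        pn p ii * cre (expect (phin phi ii)
          (opsum (enum 'I_dC) (fun j =>
             opscale (q ii j)%:C%C
               (kraus_apply [seq @kron_id_l (An TA n) _ _ K | K <- Dec j] (rho ii j))))).

Definition achievable (TA TB : finType) (m : nat) (p : 'I_m -> R)
  (phi : 'I_m -> vec (TA * TB)%type) (Rc Qq Ee : R) : Prop :=
  0 <= Rc /\ 0 <= Qq /\ 0 <= Ee /\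
  forall delta eps : R, 0 < delta -> 0 < eps ->
    exists N : nat, forall n : nat, (N < n)%N ->
      exists dC dQ dE : nat,
        protocol p phi n dC dQ dE eps /\
        log2 (dC%:R) / n%:R <= Rc + delta /\
        log2 (dQ%:R) / n%:R <= Qq + delta /\
        log2 (dE%:R) / n%:R <= Ee + delta.

(* E^*(R, Q) = inf { E : (R, Q, E) achievable }, with inf of empty = +oo *)
Definition Estar (TA TB : finType) (m : nat) (p : 'I_m -> R)
  (phi : 'I_m -> vec (TA * TB)%type) (Rc Qq : R) : \bar R :=
  ereal_inf [set (Ee%:E)%E | Ee in [set Ee | achievable p phi Rc Qq Ee]]%classic.

End QInfo.

(* Main.v *)
(* Truncate every phi_{i^n} on Bob's side, first to the conditionally typical
   eigenvectors of its own marginal, then to the typical eigenvectors of the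
   average state.  By Chebyshev's inequality this costs a vanishing average
   error, and the truncated vectors satisfy flat spectral bounds.

   Converse.  The overlap of a truncated vector with the output of a decoder is
   bounded, after averaging over i^n, by counting: d_C d_Q d_E 2^{-n S} from
   the dimension of Bob's register, and d_C d_Q^2 2^{-n chi} because
   the encoded state on B_1 B_2 is at most d_Q^2 times the maximally mixed state.

   Achievability.  Identify the typical subspace with part of C^L, L a field
   with 3^k elements, and apply to B_1 B_2 = L the unitaries with kernel
   chi(a x^2 + t x y + c y^2).  Averaged over a, c and t <> 0 the marginal on
   B_2 is close to maximally mixed in Hilbert-Schmidt norm as soon as
   d_E / d_Q times the purity of the truncated state is small, so some fixed
   choice works on average over i^n, and Alice prepares a purification of
   that marginal from her half of the entangled state by a polar decomposition. *)
Require Import Defs.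
From HB Require Import structures.
From mathcomp Require Import all_boot all_order all_algebra.
From mathcomp Require Import complex.
From mathcomp Require Import all_classical all_reals.
From mathcomp Require Import ereal exp.
From mathcomp Require Import finfield sequences ring lra.

Set Implicit Arguments.
Unset Strict Implicit.
Unset Printing Implicit Defensive.

Import Order.TTheory GRing.Theory Num.Theory.
Local Open Scope ring_scope.

(** * Inner products and orthonormal bases *)

(** All estimates concern overlaps of vectors; of entropy only nonnegativity is used. A bipartite
    vector is a family of vectors on Bob's side indexed by Alice's basis, and a positive operator is
    a sum of rank-one terms. Two truncations occur because the threshold compares two spectra:
    weights near $2^{-nS}$ for the average state and near $2^{-n\bar S}$ for the conditional ones,
    $\bar S$ being the mean of the $S(\varphi_i^B)$, so that $\chi=S-\bar S$. The decoder cannot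
    depend on $i^n$, hence one unitary must serve all words; Gauss phases turn the Haar average into
    a finite sum whose second moments all follow from Parseval. The characteristic must differ from
    2, so that $y-y'\neq 0$ and $y^2-y'^2$ determine $(y,y')$; powers of 3 meet any rates up to a
    bounded factor. With $E=\max(S-Q,0)$ only $Q'=S-E\le Q$ qubits per letter are used:
    $d_Qd_E\approx 2^{nS}$ holds the typical subspace, and $(d_E/d_Q)2^{-n\bar S}\approx
    2^{n(\chi-2Q')}$ becomes small thanks to the slack $\delta$ in the rates. No classical message
    is sent. *)

Section InnerProduct.
Variable C : numClosedFieldType.
Implicit Types T K : finType.

Definition ip T (u v : T -> C) : C := \sum_x (u x)^* * v x.
Definition sqnorm T (v : T -> C) : C := \sum_x `|v x| ^+ 2.

Lemma ipC T (u v : T -> C) : (ip u v)^* = ip v u.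
Proof.
by rewrite /ip rmorph_sum; apply: eq_bigr => x _; rewrite rmorphM /= conjCK mulrC.
Qed.

Lemma ip_norm_sym T (u v : T -> C) : `|ip u v| = `|ip v u|.
Proof. by rewrite -ipC norm_conjC. Qed.

Lemma ip_self T (v : T -> C) : ip v v = sqnorm v.
Proof. by apply: eq_bigr => x _; rewrite mulrC -normCK. Qed.

Lemma nsq_ge0 T (v : T -> C) : 0 <= sqnorm v.
Proof. by apply: sumr_ge0 => x _; rewrite exprn_ge0. Qed.

Lemma ip_sumr T K (P : pred K) (u : T -> C) (c : K -> C) (v : K -> T -> C) :
  ip u (fun x => \sum_(k | P k) c k * v k x) = \sum_(k | P k) c k * ip u (v k).
Proof.
rewrite /ip; under eq_bigr do rewrite mulr_sumr.
rewrite exchange_big; apply: eq_bigr => k _; rewrite mulr_sumr.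
by apply: eq_bigr => x _ /=; ring.
Qed.

Lemma ip_suml T K (P : pred K) (u : T -> C) (c : K -> C) (v : K -> T -> C) :
  ip (fun x => \sum_(k | P k) c k * v k x) u =
  \sum_(k | P k) (c k)^* * ip (v k) u.
Proof.
rewrite -ipC ip_sumr rmorph_sum; apply: eq_bigr => k _.
by rewrite rmorphM /= ipC.
Qed.

Lemma ipB T (u v w : T -> C) : ip u (fun x => v x - w x) = ip u v - ip u w.
Proof. by rewrite /ip -sumrB; apply: eq_bigr => x _ /=; ring. Qed.

Lemma ipBl T (u v w : T -> C) : ip (fun x => v x - w x) u = ip v u - ip w u.
Proof. by rewrite -ipC ipB rmorphB /= !ipC. Qed.

Lemma normCD_sq2 (a b : C) : `|a + b| ^+ 2 <= 2 * `|a| ^+ 2 + 2 * `|b| ^+ 2.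
Proof.
rewrite -subr_ge0; suff -> : 2 * `|a| ^+ 2 + 2 * `|b| ^+ 2 - `|a + b| ^+ 2 =
  `|a - b| ^+ 2 by rewrite exprn_ge0.
by rewrite !normCK rmorphD rmorphB /=; ring.
Qed.

Lemma nsqD_le2 T (u v : T -> C) :
  sqnorm (fun x => u x + v x) <= 2 * sqnorm u + 2 * sqnorm v.
Proof.
rewrite !mulr_sumr -big_split; apply: ler_sum => x _; exact: normCD_sq2.
Qed.

(** Lagrange's identity: twice the difference of the two sides, taken on moduli, is a double sum of
    squares of [|a k| |b l| - |a l| |b k|]. Passing to moduli first makes these differences real. *)
Lemma sum_CS K (P : pred K) (a b : K -> C) :
  `|\sum_(k | P k) a k * b k| ^+ 2 <=
  (\sum_(k | P k) `|a k| ^+ 2) * (\sum_(k | P k) `|b k| ^+ 2).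
Proof.
have h0 (c : K -> C) : 0 <= \sum_(k | P k) `|c k| by apply: sumr_ge0.
apply: (@le_trans _ _ ((\sum_(k | P k) `|a k| * `|b k|) ^+ 2)).
  rewrite lerXn2r ?nnegrE//; first by apply: sumr_ge0 => k _; rewrite mulr_ge0.
  apply: le_trans (ler_norm_sum _ _ _) _.
  by under eq_bigr do rewrite normrM.
rewrite -(ler_pM2l (ltr0n C 2)).
have -> : 2 * (\sum_(k | P k) `|a k| * `|b k|) ^+ 2 =
   \sum_(k | P k) \sum_(l | P l) 2 * (`|a k| * `|b k| * (`|a l| * `|b l|)).
  rewrite expr2 mulr_suml mulr_sumr; apply: eq_bigr => k _.
  by rewrite !mulr_sumr.
have -> : 2 * ((\sum_(k | P k) `|a k| ^+ 2) * (\sum_(k | P k) `|b k| ^+ 2)) =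
   \sum_(k | P k) \sum_(l | P l)
     (`|a k| ^+ 2 * `|b l| ^+ 2 + `|a l| ^+ 2 * `|b k| ^+ 2).
  rewrite mulr_natl mulr2n {2}[_ * _]mulrC !mulr_suml -big_split.
  apply: eq_bigr => k _; rewrite !mulr_sumr -big_split; apply: eq_bigr => l _ /=.
  ring.
apply: ler_sum => k _; apply: ler_sum => l _.
rewrite -subr_ge0; set x := _ - _.
have -> : x = (`|a k| * `|b l| - `|a l| * `|b k|) ^+ 2 by rewrite /x; ring.
by rewrite real_exprn_even_ge0// rpredB// rpredM// normr_real.
Qed.

Lemma sum_CSC K (P : pred K) (a b : K -> C) :
  `|\sum_(k | P k) (a k)^* * b k| ^+ 2 <=
  (\sum_(k | P k) `|a k| ^+ 2) * (\sum_(k | P k) `|b k| ^+ 2).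
Proof.
have <- : \sum_(k | P k) `|(a k)^*| ^+ 2 = \sum_(k | P k) `|a k| ^+ 2.
  by apply: eq_bigr => k _; rewrite norm_conjC.
exact: sum_CS.
Qed.

Lemma sum_sq_le T (P : pred T) (v : T -> C) :
  `|\sum_(x | P x) v x| ^+ 2 <= #|P|%:R * \sum_(x | P x) `|v x| ^+ 2.
Proof.
have := sum_CS P (fun _ => 1) v; under eq_bigr do rewrite mul1r.
by rewrite normr1 expr1n sumr_const.
Qed.

(** Completeness is a separate clause, so no dimension count between [K] and [T] is ever needed. *)
Definition onb T K (e : K -> T -> C) : Prop :=
  (forall k l, ip (e k) (e l) = (k == l)%:R) /\
  (forall x y, \sum_k e k x * (e k y)^* = (x == y)%:R).

Section Onb.
Variables (T K : finType) (e : K -> T -> C).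
Hypothesis eP : onb e.

Lemma onb_expand v x : \sum_k ip (e k) v * e k x = v x.
Proof.
rewrite /ip; under eq_bigr do rewrite mulr_suml.
rewrite exchange_big/=.
transitivity (\sum_y v y * (x == y)%:R).
  apply: eq_bigr => y _; rewrite -eP.2 mulr_sumr.
  by apply: eq_bigr => k _; ring.
by rewrite (bigD1 x)//= eqxx mulr1 big1 ?addr0// => y /negPf yx; rewrite eq_sym yx mulr0.
Qed.

Lemma ip_span (P : pred K) (c d : K -> C) :
  ip (fun x => \sum_(k | P k) c k * e k x)
     (fun x => \sum_(k | P k) d k * e k x) = \sum_(k | P k) (c k)^* * d k.
Proof.
rewrite ip_sumr; apply: eq_bigr => k Pk; rewrite mulrC; congr (_ * _).
rewrite ip_suml (bigD1 k)//= big1 ?addr0 ?eP.1 ?eqxx ?mulr1//.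
by move=> l /andP[_ lk]; rewrite eP.1 (negPf lk) mulr0.
Qed.

Lemma nsq_span (P : pred K) (c : K -> C) :
  sqnorm (fun x => \sum_(k | P k) c k * e k x) = \sum_(k | P k) `|c k| ^+ 2.
Proof.
by rewrite -ip_self ip_span; apply: eq_bigr => k _; rewrite mulrC -normCK.
Qed.

Lemma onb_parseval v : sqnorm v = \sum_k `|ip (e k) v| ^+ 2.
Proof.
rewrite -nsq_span; apply: eq_bigr => x _; by rewrite onb_expand.
Qed.

Lemma onb_parseval_r v : sqnorm v = \sum_k `|ip v (e k)| ^+ 2.
Proof. by rewrite onb_parseval; under eq_bigr do rewrite ip_norm_sym. Qed.

Definition span_proj (P : pred K) (u : T -> C) : T -> C :=
  fun x => \sum_(k | P k) ip (e k) u * e k x.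

Lemma ip_pjr P u v : ip u (span_proj P v) = \sum_(k | P k) ip (e k) v * ip u (e k).
Proof. exact: ip_sumr. Qed.

Lemma ip_pjC P u v : ip (span_proj P u) v = ip u (span_proj P v).
Proof.
rewrite ip_pjr ip_suml; apply: eq_bigr => k _.
by rewrite ipC mulrC.
Qed.

Lemma ip_pj_basis P u k : ip (span_proj P u) (e k) = if P k then ip u (e k) else 0.
Proof.
rewrite ip_pjC ip_pjr; case: ifP => Pk.
  rewrite (bigD1 k)//= big1 ?addr0 ?eP.1 ?eqxx ?mul1r// => l /andP[_ lk].
  by rewrite eP.1 (negPf lk) mul0r.
rewrite big1// => l Pl; rewrite eP.1; case: eqP => [lk|]; last by rewrite mul0r.
by rewrite lk Pk in Pl.
Qed.

Lemma nsq_pj P u : sqnorm (span_proj P u) = \sum_(k | P k) `|ip u (e k)| ^+ 2.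
Proof. by rewrite nsq_span; under eq_bigr do rewrite ip_norm_sym. Qed.

Lemma nsq_pj_le P u : sqnorm (span_proj P u) <= sqnorm u.
Proof.
rewrite nsq_pj onb_parseval_r [leRHS](bigID P)/= lerDl.
by apply: sumr_ge0 => k _; rewrite exprn_ge0.
Qed.

Lemma nsq_sub_pj P u :
  sqnorm (fun x => u x - span_proj P u x) = \sum_(k | ~~ P k) `|ip u (e k)| ^+ 2.
Proof.
rewrite -nsq_pj; apply: eq_bigr => x _; congr (`|_| ^+ 2).
by rewrite -[u x]onb_expand (bigID P)/= addrC addrK.
Qed.

End Onb.
End InnerProduct.

(** * Truncation and the converse bounds *)

Lemma pjB (C : numClosedFieldType) (T K : finType) (e : K -> T -> C) P u v x :
  span_proj e P (fun y => u y - v y) x = span_proj e P u x - span_proj e P v x.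
Proof. by rewrite /span_proj -sumrB; apply: eq_bigr => k _; rewrite ipB mulrBl. Qed.

Lemma eq_nsq (C : numClosedFieldType) (T : finType) (u v : T -> C) :
  u =1 v -> sqnorm u = sqnorm v.
Proof. by move=> uv; apply: eq_bigr => x _; rewrite uv. Qed.

Lemma ip2_CS (C : numClosedFieldType) (A B : finType) (u v : A -> B -> C) :
  `|\sum_a ip (u a) (v a)| ^+ 2 <= (\sum_a sqnorm (u a)) * (\sum_a sqnorm (v a)).
Proof.
by rewrite /sqnorm /ip !pair_bigA /=; exact: sum_CSC.
Qed.

Section Truncation.
Variables (C : numClosedFieldType) (A B I : finType).
Variables (p : I -> C) (phi : I -> A -> B -> C).
Variables (e : B -> B -> C) (r : B -> C) (T : pred B).
Variables (f : I -> B -> B -> C) (s : I -> B -> C) (Ti : I -> pred B).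
Hypothesis p0 : forall i, 0 <= p i.
Hypothesis eP : onb e.
Hypothesis fP : forall i, onb (f i).
Hypothesis s0 : forall i k, 0 <= s i k.
(** This and [quad] are the spectral decompositions of Bob's average and conditional marginals,
    given as quadratic forms: $\sum_a|\langle w,\varphi_a\rangle|^2=\langle
    w|\varphi^B|w\rangle$. *)
Hypothesis avg_quad : forall w, \sum_i p i * \sum_a `|ip w (phi i a)| ^+ 2 =
  \sum_k r k * `|ip w (e k)| ^+ 2.
Hypothesis quad : forall i w, \sum_a `|ip w (phi i a)| ^+ 2 =
  \sum_k s i k * `|ip w (f i k)| ^+ 2.

(** The conditional projector acts first: it commutes with the marginal of its own word, so it can
    only lower that quadratic form, and the eigenvalue bound for the outer projector against the
    average state survives. *)
Definition trunc i a := span_proj e T (span_proj (f i) (Ti i) (phi i a)).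

Lemma trunc_quad i w : \sum_a `|ip w (span_proj (f i) (Ti i) (phi i a))| ^+ 2 =
  \sum_(k | Ti i k) s i k * `|ip w (f i k)| ^+ 2.
Proof.
under eq_bigr do rewrite -ip_pjC; rewrite quad [RHS]big_mkcond.
apply: eq_bigr => k _; rewrite ip_pj_basis//; case: ifP => // _.
by rewrite normr0 expr0n mulr0.
Qed.

Lemma avg_weight k : \sum_i p i * \sum_a `|ip (phi i a) (e k)| ^+ 2 = r k.
Proof.
under eq_bigr do under eq_bigr do rewrite ip_norm_sym.
rewrite avg_quad (bigD1 k)//= big1 ?addr0; last first.
  by move=> l lk; rewrite eP.1 eq_sym (negPf lk) normr0 expr0n mulr0.
by rewrite eP.1 eqxx normr1 expr1n mulr1.
Qed.

Lemma cond_weight i k : \sum_a `|ip (phi i a) (f i k)| ^+ 2 = s i k.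
Proof.
under eq_bigr do rewrite ip_norm_sym.
rewrite quad (bigD1 k)//= big1 ?addr0; last first.
  by move=> l lk; rewrite (fP i).1 eq_sym (negPf lk) normr0 expr0n mulr0.
by rewrite (fP i).1 eqxx normr1 expr1n mulr1.
Qed.

(** With $\Pi_e,\Pi_f$ the two projectors,
    $\varphi-\Pi_e\Pi_f\varphi=(\varphi-\Pi_e\varphi)+\Pi_e(\varphi-\Pi_f\varphi)$ and $\Pi_e$ is a
    contraction. Each projector is thus charged on the untruncated vector, where its loss is a sum
    of discarded eigenvalues. *)
Lemma trunc_error :
  \sum_i p i * \sum_a sqnorm (fun b => phi i a b - trunc i a b) <=
  2 * (\sum_(k | ~~ T k) r k) +
  2 * (\sum_i p i * \sum_(k | ~~ Ti i k) s i k).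
Proof.
have -> : \sum_(k | ~~ T k) r k =
    \sum_i p i * \sum_a sqnorm (fun b => phi i a b - span_proj e T (phi i a) b).
  under eq_bigr do rewrite -avg_weight.
  rewrite exchange_big; apply: eq_bigr => i _.
  rewrite -mulr_sumr exchange_big; congr (_ * _); apply: eq_bigr => a _.
  by rewrite nsq_sub_pj.
rewrite !mulr_sumr -big_split; apply: ler_sum => i _ /=.
rewrite !(mulrCA 2) -mulrDr ler_wpM2l//.
have -> : \sum_(k | ~~ Ti i k) s i k =
    \sum_a sqnorm (fun b => phi i a b - span_proj (f i) (Ti i) (phi i a) b).
  under eq_bigr do rewrite -cond_weight.
  by rewrite exchange_big; apply: eq_bigr => a _; rewrite nsq_sub_pj.
rewrite !mulr_sumr -big_split; apply: ler_sum => a _ /=.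
have -> : sqnorm (fun b => phi i a b - trunc i a b) =
   sqnorm (fun b => (phi i a b - span_proj e T (phi i a) b) +
     span_proj e T (fun b => phi i a b - span_proj (f i) (Ti i) (phi i a) b) b).
  by apply: eq_nsq => b; rewrite pjB /trunc; ring.
apply: le_trans (nsqD_le2 _ _) _.
by rewrite lerD2l ler_wpM2l// nsq_pj_le.
Qed.

Variable rmax : C.
Hypothesis rmax0 : 0 <= rmax.
Hypothesis T_le : forall k, T k -> r k <= rmax.

Lemma avg_pj_le w :
  \sum_i p i * \sum_a `|ip (span_proj e T w) (phi i a)| ^+ 2 <= rmax * sqnorm w.
Proof.
rewrite avg_quad.
have -> : \sum_k r k * `|ip (span_proj e T w) (e k)| ^+ 2 =
    \sum_(k | T k) r k * `|ip w (e k)| ^+ 2.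
  rewrite [RHS]big_mkcond; apply: eq_bigr => k _; rewrite ip_pj_basis//.
  by case: ifP => // _; rewrite normr0 expr0n mulr0.
rewrite (onb_parseval_r eP w) mulr_sumr [leRHS](bigID T)/= -[leLHS]addr0.
apply: lerD; last by apply: sumr_ge0 => k _; rewrite mulr_ge0 ?exprn_ge0.
by apply: ler_sum => k Tk; rewrite ler_wpM2r ?exprn_ge0 ?T_le.
Qed.

Lemma avg_trunc_le w :
  \sum_i p i * \sum_a `|ip w (trunc i a)| ^+ 2 <= rmax * sqnorm w.
Proof.
apply: le_trans (avg_pj_le w); apply: ler_sum => i _; rewrite ler_wpM2l//.
under eq_bigr do rewrite /trunc -ip_pjC.
rewrite trunc_quad quad [leRHS](bigID (Ti i))/= lerDl.
by apply: sumr_ge0 => k _; rewrite mulr_ge0 ?exprn_ge0.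
Qed.

End Truncation.

(** * Kraus operators acting on vectors *)

Section Channels.
Variable C : numClosedFieldType.

Definition op_app (B X : finType) (K : B -> X -> C) (v : X -> C) : B -> C :=
  fun b => \sum_x K b x * v x.

Definition trace_preserving (B X : finType) (Ks : seq (B -> X -> C)) : Prop :=
  forall x y, \sum_(K <- Ks) \sum_b (K b x)^* * K b y = (x == y)%:R.

Lemma ip_app (B X : finType) (K : B -> X -> C) u v :
  ip u (op_app K v) = \sum_x ip u (K ^~ x) * v x.
Proof.
rewrite /ip /op_app; under eq_bigr do rewrite mulr_sumr.
rewrite exchange_big; apply: eq_bigr => x _; rewrite mulr_suml.
by apply: eq_bigr => b _; rewrite mulrA.
Qed.

Lemma app_ip (B X : finType) (K : B -> X -> C) u v :
  ip (op_app K v) u = ip v (fun x => ip (K ^~ x) u).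
Proof.
rewrite -ipC ip_app rmorph_sum /ip; apply: eq_bigr => x _.
by rewrite rmorphM mulrC; congr (_ * _); rewrite -[RHS]ipC.
Qed.

Lemma nsq_app (B X : finType) (K : B -> X -> C) v : sqnorm (op_app K v) =
  \sum_x \sum_y (v x)^* * v y * \sum_b (K b x)^* * K b y.
Proof.
rewrite -ip_self app_ip; apply: eq_bigr => x _.
rewrite ip_app mulr_sumr; apply: eq_bigr => y _.
by rewrite -mulrA; congr (_ * _); rewrite mulrC.
Qed.

Lemma tp_nsq (B X : finType) (Ks : seq (B -> X -> C)) v :
  trace_preserving Ks -> \sum_(K <- Ks) sqnorm (op_app K v) = sqnorm v.
Proof.
move=> KP; under eq_bigr do rewrite nsq_app.
rewrite exchange_big -[RHS]ip_self; apply: eq_bigr => x _.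
rewrite exchange_big (bigD1 x)//= [X in _ + X]big1 ?addr0.
  by rewrite -mulr_sumr KP eqxx mulr1.
by move=> y yx; rewrite -mulr_sumr KP eq_sym (negPf yx) mulr0.
Qed.

Lemma tp_cols (B X : finType) (Ks : seq (B -> X -> C)) :
  trace_preserving Ks -> \sum_(K <- Ks) \sum_x sqnorm (K ^~ x) = #|X|%:R.
Proof.
move=> KP; rewrite exchange_big -sum1_card natr_sum; apply: eq_bigr => x _.
by under eq_bigr do rewrite -ip_self; rewrite KP eqxx.
Qed.

End Channels.

(** * Two counting bounds on the fidelity with truncated targets *)

Section Converse.
Variables (C : numClosedFieldType) (A B I J L X1 X2 : finType).
Local Notation X := (X1 * X2)%type.
Variables (p : I -> C) (phi : I -> A -> B -> C).
Variables (e : B -> B -> C) (r : B -> C) (T : pred B).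
Variables (f : I -> B -> B -> C) (s : I -> B -> C) (Ti : I -> pred B).
Hypothesis p0 : forall i, 0 <= p i.
Hypothesis eP : onb e.
Hypothesis fP : forall i, onb (f i).
Hypothesis s0 : forall i k, 0 <= s i k.
Hypothesis avg_quad : forall w, \sum_i p i * \sum_a `|ip w (phi i a)| ^+ 2 =
  \sum_k r k * `|ip w (e k)| ^+ 2.
Hypothesis quad : forall i w, \sum_a `|ip w (phi i a)| ^+ 2 =
  \sum_k s i k * `|ip w (f i k)| ^+ 2.
Hypothesis phi1 : forall i, \sum_a sqnorm (phi i a) = 1.
Variable rmax : C.
Hypothesis rmax0 : 0 <= rmax.
Hypothesis T_le : forall k, T k -> r k <= rmax.
Variables (Dec : J -> seq (B -> X -> C)) (v : I -> J -> L -> A -> X -> C).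
Hypothesis DecP : forall j, trace_preserving (Dec j).
Hypothesis v1 : forall i, \sum_j \sum_l \sum_a sqnorm (v i j l a) = 1.

(** For fixed [i] and [j] the vectors [v i j l] are a rank-one decomposition, over [l], of $q(j|i)$
    times the encoded state; the sum is then the fidelity of the decoded state with the target
    [u]. *)
Definition kraus_fid (i : I) (u : A -> B -> C) : C :=
  \sum_j \sum_(K <- Dec j) \sum_l `|\sum_a ip (u a) (op_app K (v i j l a))| ^+ 2.

Local Notation trunc := (trunc phi e T f Ti).

Lemma fid_le_nsq i u : kraus_fid i u <= \sum_a sqnorm (u a).
Proof.
rewrite -[leRHS]mulr1 -(v1 i) mulr_sumr; apply: ler_sum => j _.
rewrite exchange_big mulr_sumr; apply: ler_sum => l _ /=.
have -> : \sum_a sqnorm (v i j l a) =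
    \sum_(K <- Dec j) \sum_a sqnorm (op_app K (v i j l a)).
  by rewrite [RHS]exchange_big; apply: eq_bigr => a _; rewrite tp_nsq.
by rewrite mulr_sumr; apply: ler_sum => K _; exact: ip2_CS.
Qed.

Lemma fid_trunc i : kraus_fid i (phi i) <= 2 * kraus_fid i (trunc i) +
  2 * \sum_a sqnorm (fun b => phi i a b - trunc i a b).
Proof.
apply: (@le_trans _ _ (2 * kraus_fid i (trunc i) +
  2 * kraus_fid i (fun a b => phi i a b - trunc i a b))); last first.
  by rewrite lerD2l ler_wpM2l// fid_le_nsq.
rewrite /kraus_fid !mulr_sumr -big_split; apply: ler_sum => j _ /=.
rewrite !mulr_sumr -big_split; apply: ler_sum => K _ /=.
rewrite !mulr_sumr -big_split; apply: ler_sum => l _ /=.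
apply: le_trans (normCD_sq2 _ _).
rewrite -big_split/= le_eqVlt; apply/orP; left; apply/eqP.
by congr (`|_| ^+ 2); apply: eq_bigr => a _; rewrite ipBl addrC subrK.
Qed.

(** Only the norm of the encoded state is used. Cauchy-Schwarz leaves overlaps of the target with
    the columns of the Kraus operators; averaging over [i] gives [rmax] times their squared norms,
    which add up to the dimension of [X] for each [j]. *)
Lemma fid_trunc_dim :
  \sum_i p i * kraus_fid i (trunc i) <= rmax * (#|J| * #|{: X}|)%N%:R.
Proof.
have key i : kraus_fid i (trunc i) <= \sum_j \sum_(K <- Dec j) \sum_x \sum_a
    `|ip (K ^~ x) (trunc i a)| ^+ 2.
  apply: ler_sum => j _; apply: ler_sum => K _.
  apply: (@le_trans _ _ (\sum_l (\sum_x \sum_a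
    `|ip (K ^~ x) (trunc i a)| ^+ 2) * \sum_a sqnorm (v i j l a))).
    apply: ler_sum => l _; under eq_bigr do rewrite ip_app.
    have -> : \sum_x \sum_a `|ip (K ^~ x) (trunc i a)| ^+ 2 =
        \sum_a \sum_x `|ip (trunc i a) (K ^~ x)| ^+ 2.
      rewrite exchange_big; apply: eq_bigr => a _; apply: eq_bigr => x _.
      by rewrite ip_norm_sym.
    by rewrite /sqnorm !pair_bigA /=; exact: sum_CS.
  rewrite -mulr_sumr -[leRHS]mulr1 ler_wpM2l//.
    by do 2!(apply: sumr_ge0 => ? _); rewrite exprn_ge0.
  rewrite -(v1 i) (bigD1 j)//= lerDl.
  by do 3!(apply: sumr_ge0 => ? _); rewrite nsq_ge0.
apply: (@le_trans _ _ (\sum_j \sum_(K <- Dec j) \sum_x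
   \sum_i p i * \sum_a `|ip (K ^~ x) (trunc i a)| ^+ 2)).
  apply: (le_trans (ler_sum _ (fun i _ => ler_wpM2l (p0 i) (key i)))).
  under eq_bigr do rewrite mulr_sumr.
  rewrite exchange_big; apply: ler_sum => j _ /=.
  under eq_bigr do rewrite mulr_sumr.
  rewrite exchange_big; apply: ler_sum => K _ /=.
  under eq_bigr do rewrite mulr_sumr.
  by rewrite exchange_big.
apply: (@le_trans _ _ (\sum_(j : J) rmax * #|{: X}|%:R)); last first.
  by rewrite sumr_const -[leLHS]mulr_natl natrM mulrCA.
apply: ler_sum => j _; rewrite -(tp_cols (DecP j)) mulr_sumr.
apply: ler_sum => K _; rewrite mulr_sumr; apply: ler_sum => x _.
exact: avg_trunc_le.
Qed.

Variable smin : C.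
Hypothesis smin0 : 0 <= smin.
Hypothesis Ti_ge : forall i k, Ti i k -> smin <= s i k.
(** No signalling: summed over all outcomes, Bob's half of the entangled state stays maximally
    mixed. *)
Hypothesis marg : forall i (u : X2 -> C), \sum_j \sum_l \sum_a \sum_x1
  `|ip u (fun x2 => v i j l a (x1, x2))| ^+ 2 = sqnorm u / #|X2|%:R.

(** The operator inequality $\rho^{B_1B_2}\le d_Q\,1\otimes\rho^{B_2}$, with $\rho^{B_2}$ bounded by
    $1/d_E$. A single branch [j] is dominated by the sum over all branches. *)
Lemma marg_le i j (u : X -> C) : \sum_l \sum_a `|ip u (v i j l a)| ^+ 2 <=
  #|X1|%:R / #|X2|%:R * sqnorm u.
Proof.
apply: (@le_trans _ _ (\sum_l \sum_a #|X1|%:R * \sum_x1 \sum_x1'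
   `|ip (fun x2 => u (x1, x2)) (fun x2 => v i j l a (x1', x2))| ^+ 2)).
  apply: ler_sum => l _; apply: ler_sum => a _.
  have -> : ip u (v i j l a) = \sum_x1
      ip (fun x2 => u (x1, x2)) (fun x2 => v i j l a (x1, x2)).
    by rewrite /ip pair_bigA; apply: eq_bigr => -[].
  apply: le_trans (sum_sq_le _ _) _; rewrite ler_wpM2l//.
  (* Nonnegative terms with [x1'] different from [x1] are added, so that the inner sum becomes a
     full trace over the first register. *)
  apply: ler_sum => x1 _; rewrite (bigD1 x1)//= lerDl.
  by apply: sumr_ge0 => ? _; rewrite exprn_ge0.
have -> : sqnorm u = \sum_x1 sqnorm (fun x2 => u (x1, x2)) by rewrite /sqnorm pair_bigA;
  apply: eq_bigr => -[].
under eq_bigr do rewrite -mulr_sumr; rewrite -mulr_sumr -mulrA ler_wpM2l//.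
under eq_bigr do rewrite exchange_big.
rewrite exchange_big mulr_sumr /=; apply: ler_sum => x1 _.
rewrite mulrC -(marg i) (bigD1 j)//= lerDl.
by do 4!(apply: sumr_ge0 => ? _); rewrite exprn_ge0.
Qed.

(** The projectors are moved onto the decoded vector, and [phi] is removed by Cauchy-Schwarz. On the
    conditionally typical part [smin] may be replaced by the eigenvalues [s i k], which rebuilds the
    conditional marginal; its average over [i] is then at most [rmax]. The ratio [rmax / smin] is
    what produces the Holevo quantity. *)
Lemma fid_trunc_dense : (0 < #|X2|)%N ->
  smin * (\sum_i p i * kraus_fid i (trunc i)) <= rmax * (#|J| * #|X1| ^ 2)%N%:R.
Proof.
move=> X2_gt0.
have key i : smin * kraus_fid i (trunc i) <= #|X1|%:R / #|X2|%:R *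
   \sum_j \sum_(K <- Dec j) \sum_x \sum_a
    `|ip (span_proj e T (K ^~ x)) (phi i a)| ^+ 2.
  rewrite !mulr_sumr; apply: ler_sum => j _.
  rewrite !mulr_sumr; apply: ler_sum => K _.
  apply: (@le_trans _ _ (\sum_l \sum_a \sum_k s i k *
      `|ip (fun x => ip (K ^~ x) (span_proj e T (f i k))) (v i j l a)| ^+ 2)).
    rewrite mulr_sumr; apply: ler_sum => l _.
    under eq_bigr do rewrite /trunc !ip_pjC.
    apply: (le_trans (ler_wpM2l smin0 (ip2_CS _ _))).
    rewrite phi1 mul1r mulr_sumr; apply: ler_sum => a _.
    rewrite nsq_pj// mulr_sumr [leRHS](bigID (Ti i))/= -[leLHS]addr0.
    apply: lerD; last by apply: sumr_ge0 => k _; rewrite mulr_ge0 ?exprn_ge0.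
    apply: ler_sum => k Tk; rewrite ip_pjC app_ip ip_norm_sym.
    by rewrite ler_wpM2r ?exprn_ge0 ?Ti_ge.
  rewrite [leLHS](_ : _ = \sum_k s i k * \sum_l \sum_a
      `|ip (fun x => ip (K ^~ x) (span_proj e T (f i k))) (v i j l a)| ^+ 2); last first.
    rewrite exchange_big/=.
    under eq_bigr do rewrite exchange_big/=.
    rewrite exchange_big; apply: eq_bigr => k _; rewrite mulr_sumr exchange_big.
    by apply: eq_bigr => a _; rewrite mulr_sumr.
  (* The spectral form of the conditional marginal identifies the sum over eigenvectors with
     overlaps of [phi] and projected columns, the form in which [avg_pj_le] applies. *)
  have -> : \sum_x \sum_a `|ip (span_proj e T (K ^~ x)) (phi i a)| ^+ 2 =
      \sum_k s i k * sqnorm (fun x => ip (K ^~ x) (span_proj e T (f i k))).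
    under eq_bigr do rewrite quad.
    rewrite exchange_big; apply: eq_bigr => k _; rewrite mulr_sumr.
    by apply: eq_bigr => x _; rewrite ip_pjC.
  rewrite mulr_sumr; apply: ler_sum => k _; rewrite mulrCA ler_wpM2l//.
  exact: marg_le.
have X20 : (#|X2|%:R : C) != 0 by rewrite pnatr_eq0 -lt0n.
apply: (@le_trans _ _ (#|X1|%:R / #|X2|%:R * \sum_j \sum_(K <- Dec j) \sum_x
   \sum_i p i * \sum_a `|ip (span_proj e T (K ^~ x)) (phi i a)| ^+ 2)).
  rewrite mulr_sumr; under eq_bigr do rewrite mulrCA.
  apply: (le_trans (ler_sum _ (fun i _ => ler_wpM2l (p0 i) (key i)))).
  under eq_bigr do rewrite mulrCA.
  rewrite -mulr_sumr ler_wpM2l ?divr_ge0//.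
  under eq_bigr do rewrite mulr_sumr.
  rewrite exchange_big; apply: ler_sum => j _ /=.
  under eq_bigr do rewrite mulr_sumr.
  rewrite exchange_big; apply: ler_sum => K _ /=.
  under eq_bigr do rewrite mulr_sumr.
  by rewrite exchange_big.
apply: (@le_trans _ _ (#|X1|%:R / #|X2|%:R * \sum_(j : J) rmax * #|{: X}|%:R)).
  rewrite ler_wpM2l ?divr_ge0//; apply: ler_sum => j _.
  rewrite -(tp_cols (DecP j)) mulr_sumr.
  apply: ler_sum => K _; rewrite mulr_sumr; apply: ler_sum => x _.
  by apply: avg_pj_le.
rewrite sumr_const -[_ *+ #|J|]mulr_natl card_prod !natrM le_eqVlt.
apply/orP; left; apply/eqP; field; exact: X20.
Qed.

End Converse.

(** * Quadratic Gauss phases over a finite field *)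

Lemma parseval_orth (C : numClosedFieldType) (V I : finType) (P : pred I)
    (E : V -> I -> C) (N : C) (z : I -> C) :
  (forall i j, P i -> P j -> \sum_v E v i * (E v j)^* = N * (i == j)%:R) ->
  \sum_v `|\sum_(i | P i) z i * E v i| ^+ 2 = N * \sum_(i | P i) `|z i| ^+ 2.
Proof.
move=> EP.
transitivity (\sum_v \sum_(i | P i) \sum_(j | P j)
    z i * (z j)^* * (E v i * (E v j)^*)).
  apply: eq_bigr => v _; rewrite normCK rmorph_sum mulr_suml.
  apply: eq_bigr => i _; rewrite mulr_sumr; apply: eq_bigr => j _.
  by rewrite rmorphM /=; ring.
rewrite exchange_big mulr_sumr; apply: eq_bigr => i Pi.
rewrite exchange_big (bigD1 i)//= [X in _ + X]big1 ?addr0.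
  by rewrite -mulr_sumr EP// eqxx mulr1 normCK mulrC.
by move=> j /andP[Pj ji]; rewrite -mulr_sumr EP// eq_sym (negPf ji) !mulr0.
Qed.

Section Characters.
Variables (C : numClosedFieldType) (L : finFieldType) (chi : L -> C).
Hypothesis chiD : forall x y, chi (x + y) = chi x * chi y.
Hypothesis chi_norm : forall x, `|chi x| = 1.
Hypothesis chi_orth : \sum_x chi x = 0.
Local Notation q := (#|L|%:R : C).

Lemma chi_neq0 x : chi x != 0.
Proof. by rewrite -normr_eq0 chi_norm oner_eq0. Qed.

Lemma chi0 : chi 0 = 1.
Proof. by apply: (mulfI (chi_neq0 0)); rewrite -chiD addr0 mulr1. Qed.

Lemma chiN x : chi (- x) = (chi x)^*.
Proof.
apply: (mulfI (chi_neq0 x)).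
by rewrite -chiD subrr chi0 -normCK chi_norm expr1n.
Qed.

Lemma chiB x y : chi (x - y) = chi x * (chi y)^*.
Proof. by rewrite chiD chiN. Qed.

Lemma chi_sum a : \sum_x chi (x * a) = q * (a == 0)%:R.
Proof.
have [->|a0] := eqVneq a 0.
  under eq_bigr do rewrite mulr0 chi0.
  by rewrite sumr_const mulr1.
rewrite mulr0 -[RHS]chi_orth [RHS](reindex (fun x => x * a))//=.
by exists (fun x => x / a) => x _; rewrite ?mulfK ?mulfVK.
Qed.

Lemma parseval1 (I : finType) (P : pred I) (c : I -> L) (z : I -> C) :
  (forall i j, P i -> P j -> c i = c j -> i = j) ->
  \sum_x `|\sum_(i | P i) z i * chi (x * c i)| ^+ 2 =
  q * \sum_(i | P i) `|z i| ^+ 2.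
Proof.
move=> cI; apply: parseval_orth => i j Pi Pj.
under eq_bigr do rewrite -chiB -mulrBr.
rewrite chi_sum subr_eq0; congr (_ * (nat_of_bool _)%:R).
by apply/eqP/eqP => [/cI->|->].
Qed.

Lemma parseval2 (I : finType) (P : pred I) (c d : I -> L) (z : I -> C) :
  (forall i j, P i -> P j -> c i = c j -> d i = d j -> i = j) ->
  \sum_x \sum_y `|\sum_(i | P i) z i * chi (x * c i + y * d i)| ^+ 2 =
  q ^+ 2 * \sum_(i | P i) `|z i| ^+ 2.
Proof.
move=> cI; rewrite pair_bigA /=.
apply: (parseval_orth (E := fun xy i => chi (xy.1 * c i + xy.2 * d i))).
move=> i j Pi Pj.
transitivity (\sum_x \sum_y chi (x * (c i - c j)) * chi (y * (d i - d j))).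
  rewrite pair_bigA; apply: eq_bigr => -[x y] _ /=.
  by rewrite -chiB -chiD; congr chi; ring.
under eq_bigr do rewrite -mulr_sumr chi_sum.
rewrite -mulr_suml chi_sum !subr_eq0 mulrACA -expr2 -natrM mulnb.
congr (_ * (nat_of_bool _)%:R).
by apply/andP/eqP => [[/eqP ci /eqP di]|->]; [apply: cI | rewrite !eqxx].
Qed.

Hypothesis two_neq0 : (2%:R : L) != 0.

(** Dividing the difference of squares by [y - y'] yields [y + y'], and 2 is invertible.
    Off-diagonal pairs therefore carry distinct frequencies in the two-variable Parseval
    identity. *)
Lemma quad_inj (t y y' z z' : L) : t != 0 -> y != y' ->
  t * (y - y') = t * (z - z') -> y ^+ 2 - y' ^+ 2 = z ^+ 2 - z' ^+ 2 ->
  (y, y') = (z, z').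
Proof.
move=> t0 yy' /(mulfI t0) e1; rewrite !subr_sqr -e1 => /mulfI e2.
have {e2} : y + y' = z + z' by apply: e2; rewrite subr_eq0.
move=> e2; have ez : y = z.
  apply: (mulfI two_neq0); have -> : 2%:R * y = (y - y') + (y + y') by ring.
  by rewrite e1 e2; ring.
by congr (_, _) => //; move: e2; rewrite ez => /addrI.
Qed.

Variables (G1 G2 : finZmodType) (k : G1 -> L) (h : G2 -> L).
Hypothesis kB : forall x y, k (x - y) = k x - k y.
Hypothesis hB : forall x y, h (x - y) = h x - h y.
(** The additive group of [L] is the direct sum of the images of [k] and [h]; this is how a field
    element labels a product basis vector of $B_1B_2$. *)
Hypothesis kh_bij : bijective (fun x : G1 * G2 => k x.1 + h x.2).

Lemma k_inj : injective k.
Proof.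
move=> x y kxy; have := bij_inj kh_bij => /(_ (x, 0) (y, 0))/=.
by rewrite kxy => /(_ erefl)[].
Qed.

Lemma h_inj : injective h.
Proof.
move=> x y hxy; have := bij_inj kh_bij => /(_ (0, x) (0, y))/=.
by rewrite hxy => /(_ erefl)[].
Qed.

Lemma kD x y : k (x + y) = k x + k y.
Proof.
have k0 : k 0 = 0 by rewrite -(subrr 0) kB subrr.
by rewrite -[y in LHS]opprK kB -[- y]sub0r kB k0 sub0r opprK.
Qed.

Lemma sum_kh (F : L -> C) : \sum_x1 \sum_x2 F (k x1 + h x2) = \sum_x F x.
Proof.
by rewrite pair_bigA [RHS](reindex (fun x : G1 * G2 => k x.1 + h x.2))//;
  exact: onW_bij.
Qed.

Lemma card_kh : (#|L| = #|G1| * #|G2|)%N.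
Proof. by rewrite -card_prod (bij_eq_card kh_bij). Qed.

Variable rho : L -> L -> C.

Definition offd (yy : L * L) := yy.1 != yy.2.
Local Notation R2 := (\sum_y \sum_y' `|rho y y'| ^+ 2).
Local Notation Roff := (\sum_(yy | offd yy) `|rho yy.1 yy.2| ^+ 2).
Local Notation Rdiag := (\sum_y `|rho y y| ^+ 2).
Local Notation tr := (\sum_y rho y y).

Lemma sum_diag_off (F : L -> L -> C) :
  \sum_y \sum_y' F y y' = \sum_y F y y + \sum_(yy | offd yy) F yy.1 yy.2.
Proof.
rewrite pair_bigA (bigID offd)/= addrC; congr (_ + _).
rewrite [RHS](reindex_onto fst (fun y => (y, y)))//=; last first.
apply: eq_big => [[y y']|[y y']]/=; rewrite /offd/= negbK.
  by apply/eqP/eqP => [->|[]//].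
by move=> /eqP->.
Qed.

Lemma R2E : R2 = Rdiag + Roff.
Proof. exact: sum_diag_off (fun y y' => `|rho y y'| ^+ 2). Qed.

Lemma Roff_ge0 : 0 <= Roff.
Proof. by apply: sumr_ge0 => yy _; rewrite exprn_ge0. Qed.

Lemma Rdiag_ge0 : 0 <= Rdiag.
Proof. by apply: sumr_ge0 => y _; rewrite exprn_ge0. Qed.

(** Entry [(X, X')] of the rotated [rho], without the normalisation [1 / q] and without the phase in
    [a], which depends only on [X] and [X']. *)
Definition kern t c X X' := \sum_y \sum_y'
  rho y y' * chi (t * (X * y - X' * y') + c * (y ^+ 2 - y' ^+ 2)).

Definition off t c X := \sum_(yy | offd yy) rho yy.1 yy.2 *
  chi (X * (t * (yy.1 - yy.2)) + c * (yy.1 ^+ 2 - yy.2 ^+ 2)).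

Lemma kern_diag t c X : kern t c X X = tr + off t c X.
Proof.
rewrite /kern /off sum_diag_off; congr (_ + _); apply: eq_bigr => y _ /=.
  by rewrite !subrr !mulr0 addr0 chi0 mulr1.
by congr (_ * chi _); ring.
Qed.

(** Pairs with [y = y'] all have frequency zero in [X] and [c], so Parseval cannot separate them.
    They are split off as a constant at the price of a factor 2; the remaining pairs are separated
    by [quad_inj]. *)
Lemma kern_off_le t d : t != 0 ->
  \sum_X \sum_c `|kern t c X (X + d)| ^+ 2 <=
  q ^+ 2 * (2 * `|\sum_y rho y y * chi (t * (- d * y))| ^+ 2 + 2 * Roff).
Proof.
move=> t0.
set D := \sum_y rho y y * chi (t * (- d * y)).
pose z (yy : L * L) := rho yy.1 yy.2 * chi (t * (- d * yy.2)).
have kE X c : kern t c X (X + d) = D + \sum_(yy | offd yy) z yy *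
    chi (X * (t * (yy.1 - yy.2)) + c * (yy.1 ^+ 2 - yy.2 ^+ 2)).
  rewrite /kern sum_diag_off; congr (_ + _); apply: eq_bigr => y _ /=.
    by congr (_ * chi _); ring.
  by rewrite /z -mulrA -chiD; congr (_ * chi _); ring.
apply: (@le_trans _ _ (\sum_(X : L) \sum_(c : L) 2 * `|D| ^+ 2 + 2 *
   \sum_X \sum_c `|\sum_(yy | offd yy) z yy *
    chi (X * (t * (yy.1 - yy.2)) + c * (yy.1 ^+ 2 - yy.2 ^+ 2))| ^+ 2)).
  rewrite mulr_sumr -big_split; apply: ler_sum => X _ /=.
  rewrite mulr_sumr -big_split; apply: ler_sum => c _ /=.
  by rewrite kE normCD_sq2.
rewrite parseval2; last first.
  by move=> [y y'] [w w'] yy' _ /=; apply: quad_inj.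
rewrite !sumr_const -mulrnA -[_ *+ _]mulr_natl natrM -expr2 mulrDr lerD2l.
rewrite mulrCA; do 2!rewrite ler_wpM2l ?exprn_ge0//.
by apply: ler_sum => yy _; rewrite /z normrM chi_norm mulr1.
Qed.

(** The constant left by the diagonal of [rho] is a Fourier coefficient in [t] with frequencies
    [- d * y], distinct because [d] is nonzero. Hence the sum over [t] controls it by Parseval. *)
Lemma sum_kern_off_le d : d != 0 ->
  \sum_(t | t != 0) \sum_X \sum_c `|kern t c X (X + d)| ^+ 2 <=
  2 * q ^+ 3 * R2.
Proof.
move=> d0; apply: le_trans (ler_sum _ (fun t t0 => kern_off_le d t0)) _.
rewrite -mulr_sumr big_split /= -!mulr_sumr R2E.
have h1 : \sum_(t | t != 0) `|\sum_y rho y y * chi (t * (- d * y))| ^+ 2 <=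
    q * Rdiag.
  rewrite -(parseval1 (P := predT) (c := fun y => - d * y)); last first.
    by move=> i j _ _; apply: mulfI; rewrite oppr_eq0.
  rewrite [leRHS](bigID (fun t => t != 0))/= lerDl.
  by apply: sumr_ge0 => ? _; rewrite exprn_ge0.
have h2 : \sum_(t : L | t != 0) Roff <= q * Roff.
  rewrite sumr_const -[leLHS]mulr_natl ler_wpM2r ?Roff_ge0// ler_nat.
  exact: max_card.
apply: (@le_trans _ _ (q ^+ 2 * (2 * (q * Rdiag) + 2 * (q * Roff)))).
  by rewrite ler_wpM2l ?exprn_ge0// lerD// ler_wpM2l.
by rewrite le_eqVlt; apply/orP; left; apply/eqP; ring.
Qed.

(** Pairs of distinct [x2], [x2'] are regrouped by their difference [d]. For fixed [d] the point
    [k x1 + h x2] runs over all of [L], and there are at most [#|G2|] differences. *)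
Lemma kern_off_total_le :
  \sum_(t | t != 0) \sum_c \sum_x2 \sum_(x2' | x2' != x2) \sum_x1
    `|kern t c (k x1 + h x2) (k x1 + h x2')| ^+ 2 <=
  #|G2|%:R * (2 * q ^+ 3 * R2).
Proof.
rewrite [leLHS](_ : _ = \sum_(d : G2 | d != 0) \sum_(t | t != 0)
    \sum_X \sum_c `|kern t c X (X + h d)| ^+ 2).
  apply: (@le_trans _ _ (\sum_(d : G2 | d != 0) 2 * q ^+ 3 * R2)).
    apply: ler_sum => d d0; apply: sum_kern_off_le.
    have h0 : h 0 = 0 by rewrite -(subrr 0) hB subrr.
    by rewrite -h0 (inj_eq h_inj).
  rewrite sumr_const -[leLHS]mulr_natl ler_wpM2r//; last first.
    by rewrite ler_nat max_card.
  rewrite !mulr_ge0 ?exprn_ge0//.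
  by do 2!(apply: sumr_ge0 => ? _); rewrite exprn_ge0.
rewrite [RHS]exchange_big; apply: eq_bigr => t _ /=.
under [RHS]eq_bigr do rewrite exchange_big.
rewrite [RHS]exchange_big; apply: eq_bigr => c _ /=.
under [RHS]eq_bigr do rewrite -sum_kh.
under [RHS]eq_bigr do rewrite exchange_big.
rewrite [RHS]exchange_big; apply: eq_bigr => x2 _ /=.
rewrite (reindex (fun d => d + x2)); last first.
  by exists (fun d => d - x2) => d _; rewrite ?addrK ?subrK.
apply: eq_big => [d|d _]; first by rewrite -subr_eq0 addrK.
apply: eq_bigr => x1 _; congr (`|kern _ _ _ _| ^+ 2).
have hD : h (d + x2) = h d + h x2.
  have h0 : h 0 = 0 by rewrite -(subrr 0) hB subrr.
  by rewrite -[x2 in LHS]opprK hB -[- x2]sub0r hB h0 sub0r opprK.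
by rewrite hD; ring.
Qed.

(** The character sum over the subgroup [k G1] left by tracing out the first register. *)
Definition ksum u := \sum_x1 chi (k x1 * u).

Lemma sum_ksum u : u != 0 ->
  \sum_(t | t != 0) `|ksum (t * u)| ^+ 2 <= q * #|G1|%:R.
Proof.
move=> u0.
apply: (@le_trans _ _ (\sum_t `|ksum (t * u)| ^+ 2)).
  rewrite [leRHS](bigID (fun t => t != 0))/= lerDl.
  by apply: sumr_ge0 => ? _; rewrite exprn_ge0.
rewrite [leLHS](_ : _ = \sum_t `|\sum_(x1 : G1) 1 * chi (t * (k x1 * u))| ^+ 2).
  rewrite (parseval1 (P := predT)).
    by under eq_bigr do rewrite normr1 expr1n; rewrite sumr_const.
  by move=> i j _ _ /(mulIf u0)/k_inj.
apply: eq_bigr => t _; congr (`|_| ^+ 2); apply: eq_bigr => x1 _.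
by rewrite mul1r; congr chi; ring.
Qed.

Definition offK t c X := \sum_x1 off t c (X + k x1).

Lemma offKE t c X : offK t c X = \sum_(yy | offd yy)
  (rho yy.1 yy.2 * ksum (t * (yy.1 - yy.2))) *
  chi (X * (t * (yy.1 - yy.2)) + c * (yy.1 ^+ 2 - yy.2 ^+ 2)).
Proof.
rewrite /offK /off exchange_big; apply: eq_bigr => yy _.
rewrite -mulrA /ksum mulr_suml -mulr_sumr; congr (_ * _).
by apply: eq_bigr => x1 _; rewrite -chiD; congr chi; ring.
Qed.

Lemma offK_invariant t c X x1 : offK t c (k x1 + X) = offK t c X.
Proof.
rewrite /offK [RHS](reindex (fun x => x1 + x)); last first.
  by exists (fun x => x - x1) => x _; rewrite addrC ?addKr ?addrNK// addrC addrK.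
by apply: eq_bigr => x _; congr off; rewrite kD; ring.
Qed.

(* offK t c is invariant under the subgroup k G1, so summing it over the
   representatives h x2 gives 1/|G1| of its sum over L, where Parseval applies. *)
Lemma sum_offK_le :
  \sum_(t | t != 0) \sum_c \sum_x2 `|offK t c (h x2)| ^+ 2 <= q ^+ 3 * R2.
Proof.
have G10 : 0 < (#|G1|%:R : C).
  by rewrite ltr0n; apply/card_gt0P; exists 0.
rewrite -(ler_pM2l G10) mulr_sumr.
rewrite [leLHS](_ : _ = \sum_(t | t != 0) q ^+ 2 * \sum_(yy | offd yy)
    `|rho yy.1 yy.2| ^+ 2 * `|ksum (t * (yy.1 - yy.2))| ^+ 2); last first.
  apply: eq_bigr => t t0; rewrite exchange_big.
  transitivity (\sum_X \sum_c `|offK t c X| ^+ 2); last first.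
    under eq_bigr do under eq_bigr do rewrite offKE.
    rewrite parseval2; last first.
      by move=> [y y'] [w w'] yy' _ /=; apply: quad_inj.
    congr (_ * _); apply: eq_bigr => yy _.
    by rewrite normrM exprMn.
  rewrite -sum_kh; under [RHS]eq_bigr do under eq_bigr do
    under eq_bigr do rewrite offK_invariant.
  by rewrite sumr_const -[RHS]mulr_natl.
rewrite -mulr_sumr exchange_big /=.
apply: (@le_trans _ _ (q ^+ 2 * \sum_(yy | offd yy)
    `|rho yy.1 yy.2| ^+ 2 * (q * #|G1|%:R))).
  rewrite ler_wpM2l ?exprn_ge0//; apply: ler_sum => yy yyo.
  by rewrite -mulr_sumr ler_wpM2l ?exprn_ge0// sum_ksum// subr_eq0.
rewrite -mulr_suml R2E.
have -> : #|G1|%:R * (q ^+ 3 * (Rdiag + Roff)) =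
   q ^+ 2 * (Roff * (q * #|G1|%:R)) + #|G1|%:R * (q ^+ 3 * Rdiag) by ring.
by rewrite lerDl !mulr_ge0 ?exprn_ge0 ?Rdiag_ge0.
Qed.

Lemma sum_off t c : t != 0 -> \sum_X off t c X = 0.
Proof.
move=> t0; rewrite exchange_big big1// => yy yyo.
rewrite -mulr_sumr; under eq_bigr do rewrite chiD.
rewrite -mulr_suml chi_sum mulf_eq0 subr_eq0 (negPf t0)/= (negPf yyo).
by rewrite mulr0 mul0r mulr0.
Qed.

(** The fluctuation around the mean [#|G1| * tr] sums to zero over [x2], so the cross terms cancel
    and the squares add exactly. The coefficient 1 of the main term is essential: it is the purity
    of the maximally mixed state, and a factor 2 there would keep the fidelity away from 1. *)
Lemma kern_diag_total_le :
  \sum_(t | t != 0) \sum_c \sum_x2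
    `|\sum_x1 kern t c (k x1 + h x2) (k x1 + h x2)| ^+ 2 <=
  (q - 1) * q * (#|G1|%:R * q * `|tr| ^+ 2) + q ^+ 3 * R2.
Proof.
have sumt (x : C) : \sum_(t : L | t != 0) x = (q - 1) * x.
  have : \sum_(t : L) x = x + \sum_(t : L | t != 0) x by rewrite (bigD1 0).
  by rewrite sumr_const mulrBl mul1r mulr_natl => ->; rewrite addrAC subrr add0r.
apply: (@le_trans _ _ (\sum_(t : L | t != 0) \sum_(c : L)
    #|G1|%:R * q * `|tr| ^+ 2 +
    \sum_(t | t != 0) \sum_c \sum_x2 `|offK t c (h x2)| ^+ 2)); last first.
  by apply: lerD sum_offK_le; rewrite sumt sumr_const -[X in _ * X <= _]mulr_natl !mulrA.
rewrite -big_split; apply: ler_sum => t t0; rewrite -big_split.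
apply: ler_sum => c _ /=.
have DE x2 : \sum_x1 kern t c (k x1 + h x2) (k x1 + h x2) =
    #|G1|%:R * tr + offK t c (h x2).
  under eq_bigr do rewrite kern_diag.
  rewrite big_split /= sumr_const -[_ *+ _]mulr_natl; congr (_ + _).
  by apply: eq_bigr => x1 _; rewrite addrC.
have s0 : \sum_x2 offK t c (h x2) = 0.
  rewrite -[RHS](sum_off c t0) -[RHS]sum_kh [RHS]exchange_big; apply: eq_bigr => x2 _.
  by apply: eq_bigr => x1 _; rewrite addrC.
under eq_bigr do rewrite DE.
set a := _ * tr; pose b x2 := offK t c (h x2).
have -> : \sum_x2 `|a + offK t c (h x2)| ^+ 2 =
   \sum_x2 (`|a| ^+ 2 + `|b x2| ^+ 2 + (a * (b x2)^* + a^* * b x2)).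
  by apply: eq_bigr => x2 _; rewrite !normCK rmorphD /= /b; ring.
rewrite big_split /= [X in _ + X]big_split /= -!mulr_sumr -rmorph_sum s0.
rewrite rmorph0 !mulr0 !addr0 big_split /= lerD2r sumr_const -[leLHS]mulr_natl.
rewrite /a normrM exprMn ger0_norm// card_kh natrM le_eqVlt.
by apply/orP; left; apply/eqP; ring.
Qed.

Definition phase a c t (x y : L) := chi (a * x ^+ 2 + t * (x * y) + c * y ^+ 2).

(* By Parseval in a, the terms with x2 <> x2' contribute no interference
   between different x1. *)
Lemma decoupling :
  \sum_(t | t != 0) \sum_c \sum_a \sum_x2 \sum_x2'
    `|\sum_x1 \sum_y \sum_y' phase a c t (k x1 + h x2) y * rho y y' *
       (phase a c t (k x1 + h x2') y')^*| ^+ 2 <=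
  q ^+ 3 * ((q - 1) * #|G1|%:R * `|tr| ^+ 2) +
  q ^+ 4 * ((1 + 2 * #|G2|%:R) * R2).
Proof.
have -> : q ^+ 3 * ((q - 1) * #|G1|%:R * `|tr| ^+ 2) +
  q ^+ 4 * ((1 + 2 * #|G2|%:R) * R2) =
  q * ((q - 1) * q * (#|G1|%:R * q * `|tr| ^+ 2) + q ^+ 3 * R2) +
  q * (#|G2|%:R * (2 * q ^+ 3 * R2)) by ring.
apply: (le_trans _ (lerD (ler_wpM2l _ kern_diag_total_le)
   (ler_wpM2l _ kern_off_total_le))) => //.
rewrite !mulr_sumr -big_split; apply: ler_sum => t t0 /=.
rewrite !mulr_sumr -big_split; apply: ler_sum => c _ /=.
rewrite exchange_big !mulr_sumr -big_split; apply: ler_sum => x2 _ /=.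
rewrite exchange_big (bigD1 x2)//=.
have kE a x2' x1 : \sum_y \sum_y' phase a c t (k x1 + h x2) y * rho y y' *
       (phase a c t (k x1 + h x2') y')^* =
    kern t c (k x1 + h x2) (k x1 + h x2') *
      chi (a * ((k x1 + h x2) ^+ 2 - (k x1 + h x2') ^+ 2)).
  rewrite /kern mulr_suml; apply: eq_bigr => y _.
  rewrite mulr_suml; apply: eq_bigr => y' _.
  rewrite /phase mulrAC mulrC -chiB -mulrA -chiD; congr (_ * chi _); ring.
apply: lerD.
  under eq_bigr do under eq_bigr do rewrite kE subrr mulr0 chi0 mulr1.
  by rewrite sumr_const -[leLHS]mulr_natl.
rewrite mulr_sumr; apply: ler_sum => x2' x2x.
under eq_bigr do under eq_bigr do rewrite kE.
rewrite (parseval1 (P := predT))// => x1 y1 _ _.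
(* The frequency of [a] factors as [h x2 - h x2'], nonzero, times an affine function of [k x1] with
   slope 2, hence it is injective in [x1]. *)
rewrite !subr_sqr.
have dE (x : G1) : k x + h x2 - (k x + h x2') = h x2 - h x2' by ring.
rewrite !dE => /mulfI; rewrite subr_eq0 (inj_eq h_inj) eq_sym => /(_ x2x) e.
apply: k_inj; apply: (mulfI two_neq0); apply: (addIr (h x2 + h x2')).
by transitivity (k x1 + h x2 + (k x1 + h x2')); [|rewrite e]; ring.
Qed.

End Characters.

Lemma F3_field (d : nat) : (0 < d)%N ->
  exists (L : finFieldType) (f : L -> 'rV['F_3]_d),
    [/\ (2%:R : L) != 0, forall x y, f (x - y) = f x - f y & bijective f].
Proof.
move=> d0; have [L pL cL] := pPrimePowerField (isT : prime 3) d0.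
have [f flin fbij] := pprimeChar_vectAxiom pL.
have dE : logn 3 #|pPrimeCharType pL| = d by rewrite [#|_|]cL pfactorK.
exists L; move: f flin fbij; rewrite dE => f flin fbij; exists f; split => //.
  rewrite -(dvdn_pcharf pL); by [].
move=> x y; have := flin (-1) y x; rewrite !scaleN1r addrC => <-.
by rewrite addrC.
Qed.

Section CubeRoot.
Variable C : numClosedFieldType.

Lemma exists_cube_root : exists w : C, w ^+ 3 = 1 /\ w != 1.
Proof.
(* The constant coefficients -1 encode $w^2=-1-w$; the root 1 would force $3=0$. *)
have [w] := @solve_monicpoly C 2 (fun i => -1) isT.
rewrite !big_ord_recl big_ord0 /= => e; exists w.
rewrite /bump /= !expr0 expr1 in e.
split; first by rewrite exprS e; move: e; rewrite expr2 => e; ring: e.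
apply/eqP => w1; move: e; rewrite w1 !expr1n => e.
have : (3%:R : C) = 0.
  by transitivity (1 - (- 1 * 1 + (- 1 * 1 + 0)) : C); [ring | rewrite -e subrr].
by move/eqP; rewrite pnatr_eq0.
Qed.

End CubeRoot.

Lemma exists_character (C : numClosedFieldType) (L : finZmodType) (d : nat)
    (f : L -> 'rV['F_3]_d.+1) :
  (forall x y, f (x - y) = f x - f y) -> bijective f ->
  exists chi : L -> C, [/\ forall x y, chi (x + y) = chi x * chi y,
    forall x, `|chi x| = 1 & \sum_x chi x = 0].
Proof.
move=> fB [g fK gK]; have [w [w3 w1]] := exists_cube_root C.
have fD x y : f (x + y) = f x + f y.
  have f0 : f 0 = 0 by rewrite -(subrr 0) fB subrr.
  by rewrite -[y in LHS]opprK fB -[- y]sub0r fB f0 sub0r opprK.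
pose chi x := w ^+ (f x 0 0 : 'F_3).
have chiD x y : chi (x + y) = chi x * chi y.
  by rewrite /chi fD mxE -exprD /= (expr_mod _ w3).
exists chi; split => // [x|].
  rewrite normrX.
  have -> : `|w| = 1 by apply/eqP; rewrite -(@pexpr_eq1 _ _ 3)// -normrX w3 normr1.
  by rewrite expr1n.
(* [x0] has first coordinate 1, so [chi x0 = w]. Translation by [x0] multiplies the character sum by
   [w], which differs from 1. *)
pose x0 := g (const_mx 1).
have : chi x0 * \sum_x chi x = \sum_x chi x.
  rewrite mulr_sumr [RHS](reindex (fun x => x0 + x)); last first.
    by exists (fun x => x - x0) => x _; rewrite addrC ?addKr ?addrNK// addrC addrK.
  by apply: eq_bigr => x _; rewrite chiD.
move/eqP; rewrite -subr_eq0 -{2}[\sum_x _]mul1r -mulrBl mulf_eq0 subr_eq0.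
by rewrite {1}/chi gK mxE /= expr1 (negPf w1) => /eqP.
Qed.

(** * Spectral decomposition *)

Lemma char_poly_similar (F : fieldType) (n : nat) (P D : 'M[F]_n) :
  P \in unitmx -> char_poly (invmx P *m D *m P) = char_poly D.
Proof.
move=> Pu; rewrite /char_poly.
have -> : char_poly_mx (invmx P *m D *m P) =
    map_mx polyC (invmx P) *m char_poly_mx D *m map_mx polyC P.
  rewrite /char_poly_mx mulmxBr mulmxBl -!map_mxM; congr (_ - _).
  by rewrite scalar_mxC -mulmxA -map_mxM mulVmx// map_mx1 mulmx1.
rewrite !det_mulmx mulrAC -det_mulmx -map_mxM mulVmx// map_mx1 det1.
by rewrite mul1r.
Qed.

(** The clause on the characteristic polynomial links this decomposition to the entropy, whose
    definition goes through the roots of that polynomial. *)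
Lemma spectral_fun (C : numClosedFieldType) (T : finType) (M : T -> T -> C) :
  (forall x y, M x y = (M y x)^*) ->
  exists (g : T -> T -> C) (lam : T -> C), [/\ onb g,
    forall x y, M x y = \sum_k lam k * (g k x * (g k y)^*) &
    char_poly (\matrix_(i, j) M (enum_val i) (enum_val j) : 'M[C]_#|T|) =
      \prod_k ('X - (lam k)%:P)].
Proof.
move=> Mh; pose A : 'M[C]_#|T| := \matrix_(i, j) M (enum_val i) (enum_val j).
have An : A \is normalmx.
  apply: hermitian_normalmx; rewrite is_hermitianmxE expr0 scale1r.
  by apply/eqP/matrixP => i j; rewrite !mxE.
have /orthomx_spectralP/= := An.
set P := spectralmx A; set D := spectral_diag A => AE.
have Pu : P \is unitarymx := spectral_unitarymx A.
have Pi : invmx P = (P ^t*)%sesqui := invmx_unitary Pu.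
have PPt := unitarymxP Pu.
have PtP : (P ^t* *m P)%sesqui = 1%:M.
  by rewrite -Pi mulVmx// spectral_unit.
exists (fun k x => (P (enum_rank k) (enum_rank x))^*).
exists (fun k => D 0 (enum_rank k)).
have sumE (F : 'I_#|T| -> C) : \sum_(x : T) F (enum_rank x) = \sum_i F i.
  rewrite [RHS](reindex (@enum_rank T))//.
  by apply: onW_bij; exact: enum_rank_bij.
split.
- split=> [k l|x y].
    have := congr1 (fun B : 'M_#|T| => B (enum_rank k) (enum_rank l)) PPt.
    rewrite !mxE (inj_eq enum_rank_inj) => <-; rewrite -sumE.
    by apply: eq_bigr => x _; rewrite !mxE conjCK.
  have := congr1 (fun B : 'M_#|T| => B (enum_rank x) (enum_rank y)) PtP.
  rewrite !mxE (inj_eq enum_rank_inj) => <-; rewrite -sumE.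
  by apply: eq_bigr => k _; rewrite !mxE conjCK.
- move=> x y.
  have := congr1 (fun B : 'M_#|T| => B (enum_rank x) (enum_rank y)) AE.
  rewrite [LHS]mxE !enum_rankK => ->; rewrite Pi mxE -sumE.
  apply: eq_bigr => k _; rewrite mul_mx_diag !mxE conjCK; ring.
- rewrite -/A AE char_poly_similar ?spectral_unit// char_poly_trig.
    rewrite -(big_map (fun k => D 0 (enum_rank k)) predT (fun z => 'X - z%:P)).
    rewrite big_map [RHS](reindex (@enum_val T predT))/=; last first.
      by apply: onW_bij; exact: enum_val_bij.
    by apply: eq_bigr => i _; rewrite mxE eqxx mulr1n enum_valK.
  exact: diag_mx_is_trig.
Qed.

Section PsdSpectrum.
Variables (C : numClosedFieldType) (T : finType) (M : T -> T -> C).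
Variables (g : T -> T -> C) (lam : T -> C).
Hypothesis gP : onb g.
Hypothesis ME : forall x y, M x y = \sum_k lam k * (g k x * (g k y)^*).

Lemma spectral_quad v w : \sum_x \sum_y (v x)^* * M x y * w y =
  \sum_k lam k * (ip v (g k) * ip (g k) w).
Proof.
transitivity (\sum_x \sum_y \sum_k lam k *
    ((v x)^* * g k x * ((g k y)^* * w y))).
  apply: eq_bigr => x _; apply: eq_bigr => y _; rewrite ME mulr_sumr mulr_suml.
  by apply: eq_bigr => k _; ring.
under eq_bigr do rewrite exchange_big.
rewrite exchange_big; apply: eq_bigr => k _ /=.
rewrite /ip mulr_suml mulr_sumr; apply: eq_bigr => x _.
by rewrite !mulr_sumr.
Qed.

Lemma spectral_basis k l : \sum_x \sum_y (g k x)^* * M x y * g l y =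
  lam k * (k == l)%:R.
Proof.
rewrite spectral_quad (bigD1 k)//= [X in _ + X]big1 ?addr0.
  by rewrite !gP.1 eqxx mul1r.
by move=> j jk; rewrite !gP.1 eq_sym (negPf jk) mul0r mulr0.
Qed.

Lemma spectral_ge0 : (forall v, 0 <= \sum_x \sum_y (v x)^* * M x y * v y) ->
  forall k, 0 <= lam k.
Proof. by move=> M0 k; have := M0 (g k); rewrite spectral_basis eqxx mulr1. Qed.

Lemma spectral_tr : \sum_x M x x = \sum_k lam k.
Proof.
under eq_bigr do rewrite ME.
rewrite exchange_big; apply: eq_bigr => k _ /=; rewrite -mulr_sumr.
have := gP.1 k k; rewrite eqxx /ip => e.
by under eq_bigr do rewrite mulrC; rewrite e mulr1.
Qed.

Lemma spectral_sq : \sum_x \sum_y `|M x y| ^+ 2 = \sum_k `|lam k| ^+ 2.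
Proof.
have rowE x : \sum_y `|M x y| ^+ 2 = \sum_k `|lam k| ^+ 2 * `|g k x| ^+ 2.
  transitivity (sqnorm (fun y => \sum_k (lam k * g k x)^* * g k y)).
    apply: eq_bigr => y _; rewrite -norm_conjC ME; congr (`|_| ^+ 2).
    by rewrite rmorph_sum; apply: eq_bigr => k _; rewrite !rmorphM /= conjCK mulrA.
  rewrite (nsq_span gP); apply: eq_bigr => k _.
  by rewrite norm_conjC normrM exprMn.
under eq_bigr do rewrite rowE.
rewrite exchange_big; apply: eq_bigr => k _ /=; rewrite -mulr_sumr.
by have := gP.1 k k; rewrite eqxx ip_self /sqnorm => ->; rewrite mulr1.
Qed.

End PsdSpectrum.

(** * Choosing a decoupling unitary *)

Lemma exists_bij (T T' : finType) : #|T| = #|T'| ->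
  exists f : T -> T', bijective f.
Proof.
move=> eTT; exists (fun x => enum_val (cast_ord eTT (enum_rank x))).
exists (fun y => enum_val (cast_ord (esym eTT) (enum_rank y))) => x.
  by rewrite enum_valK cast_ordK enum_rankK.
by rewrite enum_valK cast_ordKV enum_rankK.
Qed.

Lemma exists_le_avg (C : numDomainType) (S : finType) (P : pred S)
    (F : S -> C) (b : C) :
  (forall s, F s \is Num.real) -> b \is Num.real -> (exists s, P s) ->
  \sum_(s | P s) F s <= \sum_(s | P s) b -> exists2 s, P s & F s <= b.
Proof.
move=> FR bR [s0 Ps0] le_sum.
have [/existsP[s /andP[Ps le_s]]|/existsPn no] := boolP [exists s, P s && (F s <= b)].
  by exists s.
suff : \sum_(s | P s) b < \sum_(s | P s) F s.
  by move=> /lt_le_trans/(_ le_sum); rewrite ltxx.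
have lt_s s : P s -> b < F s.
  move=> Ps; have := no s; rewrite Ps /= => h.
  by rewrite real_ltNge.
rewrite (bigD1 s0)//= [ltRHS](bigD1 s0)//= ltr_leD ?lt_s//.
by apply: ler_sum => s /andP[Ps _]; apply/ltW/lt_s.
Qed.

(** The bound holds for the sum over all parameters with [t] nonzero, hence for one of them; the
    weights [p i] are inside the average because the same [U] must serve every [i]. The exponent
    [d1.+1] makes the field nontrivial, so that [q - 1] is positive. *)
Lemma twirl_exists (C : numClosedFieldType) (X1 X2 I : finType) (d1 d2 : nat)
    (p : I -> C) (rho : I -> X1 * X2 -> X1 * X2 -> C) :
  #|X1| = (3 ^ d1.+1)%N -> #|X2| = (3 ^ d2)%N -> (forall i, 0 <= p i) ->
  exists U : X1 * X2 -> X1 * X2 -> C, onb U /\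
    \sum_i p i * (\sum_x2 \sum_x2' `|\sum_x1 \sum_y \sum_y'
       U y (x1, x2) * rho i y y' * (U y' (x1, x2'))^*| ^+ 2) <=
    \sum_i p i * (`|\sum_y rho i y y| ^+ 2 / #|X2|%:R +
      (1 + 2 * #|X2|%:R) / (#|{: X1 * X2}|%:R - 1) *
        \sum_y \sum_y' `|rho i y y'| ^+ 2).
Proof.
move=> cX1 cX2 p0.
have [L [f [two0 fB [g fK gK]]]] : exists (L : finFieldType)
    (f : L -> 'rV['F_3]_(d1.+1 + d2)),
    [/\ (2%:R : L) != 0, forall x y, f (x - y) = f x - f y & bijective f].
  exact: F3_field.
have [chi [chiD chi_norm chi_orth]] := exists_character C fB (Bijective fK gK).
have gB x y : g (x - y) = g x - g y.
  by apply: (can_inj fK); rewrite fB !gK.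
pose G1 : finZmodType := 'rV['F_3]_d1.+1; pose G2 : finZmodType := 'rV['F_3]_d2.
pose k (v : G1) := g (row_mx v 0); pose h (v : G2) := g (row_mx 0 v).
have kB x y : k (x - y) = k x - k y.
  by rewrite /k -gB opp_row_mx add_row_mx subrr.
have hB x y : h (x - y) = h x - h y.
  by rewrite /h -gB opp_row_mx add_row_mx subrr.
have khE x : k x.1 + h x.2 = g (row_mx x.1 x.2).
  have h0 : h 0 = 0 by rewrite -(subrr 0) hB subrr.
  rewrite -[h _]opprK -[- h _]add0r -h0 -hB sub0r /k /h -gB opp_row_mx add_row_mx.
  by rewrite oppr0 opprK addr0 add0r.
have kh_bij : bijective (fun x : G1 * G2 => k x.1 + h x.2).
  exists (fun z => (lsubmx (f z), rsubmx (f z))) => z; rewrite khE ?gK.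
    by rewrite row_mxKl row_mxKr; case: z.
  by rewrite hsubmxK fK.
have [b1 b1P] : exists b : X1 -> G1, bijective b.
  by apply: exists_bij; rewrite cX1 card_mx mul1n card_Fp.
have [b2 b2P] : exists b : X2 -> G2, bijective b.
  by apply: exists_bij; rewrite cX2 card_mx mul1n card_Fp.
pose l (x : X1 * X2) := k (b1 x.1) + h (b2 x.2).
have l_bij : bijective l.
  case: kh_bij => m mK Km; case: (b1P) => c1 c1K K1; case: (b2P) => c2 c2K K2.
  exists (fun z => (c1 (m z).1, c2 (m z).2)) => z; rewrite /l /=.
    by rewrite (mK (b1 z.1, b2 z.2)) /= c1K c2K; case: z.
  by rewrite K1 K2 Km.
have cL : #|L| = #|{: X1 * X2}| by rewrite (bij_eq_card l_bij).
case: (l_bij) => l' l'K ll'.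
set q : C := #|L|%:R.
have q0 : q != 0 by rewrite pnatr_eq0 -lt0n; apply/card_gt0P; exists 0.
have q_ge0 : 0 <= q by [].
(* The phases quadratic in one variable are diagonal unitaries; what remains is the Fourier matrix
   with frequency scaled by [t], which is unitary as soon as [t] is nonzero. *)
pose U (s : L * L * L) (y x : X1 * X2) :=
  (sqrtC q)^-1 * phase chi s.2 s.1.2 s.1.1 (l x) (l y).
have sq : (sqrtC q)^-1 * ((sqrtC q)^-1)^* = q^-1.
  rewrite -normCK ger0_norm ?invr_ge0 ?sqrtC_ge0// exprVn sqrtCK//.
have U_onb s : s.1.1 != 0 -> onb (U s).
  case: s => -[t c] a /= t0; split => [y y'|x x'].
    transitivity (q^-1 * (chi (c * (l y' ^+ 2 - l y ^+ 2)) *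
        \sum_x chi (x * (t * (l y' - l y))))).
      rewrite (reindex l)/=; last exact: onW_bij.
      rewrite !mulr_sumr; apply: eq_bigr => x _.
      rewrite /U /phase rmorphM /= mulrACA [_^* * (sqrtC q)^-1]mulrC sq.
      rewrite [X in _ * X]mulrC -(chiB chiD)// -chiD.
      by congr (_ * chi _); ring.
    rewrite (chi_sum chiD)// mulf_eq0 (negPf t0) /= subr_eq0 (bij_eq l_bij).
    have [->|yy'] := eqVneq y y'; last by rewrite !mulr0.
    by rewrite subrr mulr0 (chi0 chiD)// mul1r mulr1 mulVf.
  transitivity (q^-1 * (chi (a * (l x ^+ 2 - l x' ^+ 2)) *
        \sum_y chi (y * (t * (l x - l x'))))).
    rewrite (reindex l)/=; last exact: onW_bij.
    rewrite !mulr_sumr; apply: eq_bigr => y _.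
    rewrite /U /phase rmorphM /= mulrACA sq.
    rewrite -(chiB chiD)// -chiD.
    by congr (_ * chi _); ring.
  rewrite (chi_sum chiD)// mulf_eq0 (negPf t0) /= subr_eq0 (bij_eq l_bij).
  have [->|xx'] := eqVneq x x'; last by rewrite !mulr0.
  by rewrite subrr mulr0 (chi0 chiD)// mul1r mulr1 mulVf.
pose purity i s := \sum_x2 \sum_x2' `|\sum_x1 \sum_y \sum_y'
  U s y (x1, x2) * rho i y y' * (U s y' (x1, x2'))^*| ^+ 2.
pose bnd i := `|\sum_y rho i y y| ^+ 2 / #|X2|%:R +
      (1 + 2 * #|X2|%:R) / (q - 1) * \sum_y \sum_y' `|rho i y y'| ^+ 2.
have q1 : 1 < q.
  rewrite ltr1n cL card_prod cX1 cX2 -expnD; apply: (@leq_trans (3 ^ 1)) => //.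
  by rewrite leq_exp2l.
have purity0 i s : 0 <= purity i s.
  by do 2!(apply: sumr_ge0 => ? _); rewrite exprn_ge0.
have bnd0 i : 0 <= bnd i.
  rewrite addr_ge0 ?divr_ge0 ?exprn_ge0// mulr_ge0//.
    by apply: divr_ge0; [rewrite addr_ge0 ?mulr_ge0 | rewrite subr_ge0 ltW].
  by do 2!(apply: sumr_ge0 => ? _); rewrite exprn_ge0.
rewrite -cL -/q.
suff [s s0 le_s] : exists2 s : L * L * L, s.1.1 != 0 &
    \sum_i p i * purity i s <= \sum_i p i * bnd i.
  by exists (U s); split => //; exact: U_onb.
apply: exists_le_avg.
- by move=> s; apply: ger0_real; apply: sumr_ge0 => i _; rewrite mulr_ge0.
- by apply: ger0_real; apply: sumr_ge0 => i _; rewrite mulr_ge0.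
- by exists (1, 0, 0); rewrite /= oner_neq0.
rewrite [leLHS]exchange_big [leRHS]exchange_big; apply: ler_sum => i _ /=.
rewrite -!mulr_sumr ler_wpM2l// {p p0}.
pose rho' y y' := rho i (l' y) (l' y').
have trE : \sum_y rho i y y = \sum_y rho' y y.
  rewrite [RHS](reindex l)/=; last exact: onW_bij.
  by apply: eq_bigr => y _; rewrite /rho' l'K.
have R2E : \sum_y \sum_y' `|rho i y y'| ^+ 2 = \sum_y \sum_y' `|rho' y y'| ^+ 2.
  rewrite [RHS](reindex l)/=; last exact: onW_bij.
  apply: eq_bigr => y _; rewrite [RHS](reindex l)/=; last exact: onW_bij.
  by apply: eq_bigr => y' _; rewrite /rho' !l'K.
have sumS (F : L * L * L -> C) : \sum_(s : L * L * L | s.1.1 != 0) F s =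
    \sum_(t | t != 0) \sum_c \sum_a F (t, c, a).
  rewrite [RHS]pair_big [RHS]pair_big /=.
  by apply: eq_big => [[[t c] a]|[[t c] a] _] //=; rewrite !andbT.
rewrite !sumS.
have := decoupling chiD chi_norm chi_orth two0 kB hB kh_bij rho'.
rewrite -/q -trE -R2E => dec.
have purE t c a : purity i (t, c, a) = q^-1 ^+ 2 * \sum_x2 \sum_x2'
    `|\sum_x1 \sum_y \sum_y' phase chi a c t (k x1 + h x2) y * rho' y y' *
       (phase chi a c t (k x1 + h x2') y')^*| ^+ 2.
  rewrite [in RHS](reindex b2)/=; last exact: onW_bij.
  rewrite mulr_sumr; apply: eq_bigr => x2 _.
  rewrite [in RHS](reindex b2)/=; last exact: onW_bij.
  rewrite mulr_sumr; apply: eq_bigr => x2' _.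
  have -> : q^-1 ^+ 2 = `|q^-1| ^+ 2 by rewrite ger0_norm ?invr_ge0.
  rewrite -exprMn -normrM; congr (`|_| ^+ 2).
  rewrite [in RHS](reindex b1)/=; last exact: onW_bij.
  rewrite mulr_sumr; apply: eq_bigr => x1 _.
  rewrite [in RHS](reindex l)/=; last exact: onW_bij.
  rewrite mulr_sumr; apply: eq_bigr => y _.
  rewrite [in RHS](reindex l)/=; last exact: onW_bij.
  rewrite mulr_sumr; apply: eq_bigr => y' _.
  by rewrite /U /rho' !l'K rmorphM /= /l /= -sq; ring.
apply: (@le_trans _ _ (q^-1 ^+ 2 * \sum_(t | t != 0) \sum_c \sum_a
    \sum_x2 \sum_x2' `|\sum_x1 \sum_y \sum_y'
      phase chi a c t (k x1 + h x2) y * rho' y y' *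
       (phase chi a c t (k x1 + h x2') y')^*| ^+ 2)).
  rewrite !mulr_sumr; apply: ler_sum => t _.
  rewrite !mulr_sumr; apply: ler_sum => c _.
  by rewrite !mulr_sumr; apply: ler_sum => a _; rewrite purE.
apply: (le_trans (ler_wpM2l _ dec)); first by rewrite exprn_ge0 ?invr_ge0.
have sumt (x : C) : \sum_(t : L | t != 0) x = (q - 1) * x.
  have : \sum_(t : L) x = x + \sum_(t : L | t != 0) x by rewrite (bigD1 0).
  by rewrite sumr_const mulrBl mul1r mulr_natl => ->; rewrite addrAC subrr add0r.
have sumL (x : C) : \sum_(t : L) x = q * x.
  by rewrite sumr_const mulr_natl.
rewrite [leRHS](_ : _ = (q - 1) * (q * (q * bnd i))); last first.
  by rewrite -sumt; apply: eq_bigr => t _; rewrite -sumL; apply: eq_bigr => c _.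
rewrite /bnd.
have -> : #|G1|%:R = q / #|X2|%:R :> C.
  rewrite /q (card_kh kh_bij) -(bij_eq_card b2P) natrM mulfK//.
  by rewrite pnatr_eq0 cX2 expn_eq0.
rewrite -(bij_eq_card b2P) le_eqVlt; apply/orP; left; apply/eqP.
have X20 : (#|X2|%:R : C) != 0 by rewrite pnatr_eq0 cX2 expn_eq0.
have q10 : q - 1 != 0 by rewrite subr_eq0 gt_eqF.
by field; rewrite q0 q10 X20.
Qed.

(** * Purification and one-shot coding *)

(** For $s=\sqrt l$ and $r=\sqrt d$ the difference is $(s/r)(rs-1)^2(rs+2)$, with equality at
    $l=1/d$. Summed over eigenvalues, it bounds the fidelity with the maximally mixed state below by
    trace and purity alone, without trace distance. *)
Lemma sqrt_lower_bound (C : numClosedFieldType) (l d : C) : 0 <= l -> 0 < d ->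
  3 * l - d * l ^+ 2 <= 2 * (sqrtC l / sqrtC d).
Proof.
move=> l0 d0; have r0 : 0 < sqrtC d by rewrite sqrtC_gt0.
have s0 : 0 <= sqrtC l by rewrite sqrtC_ge0.
rewrite -{1 2}[l]sqrtCK -{1}[d]sqrtCK -subr_ge0.
move: (sqrtC l) (sqrtC d) r0 s0 => s r r0 s0.
have rn0 : r != 0 by rewrite gt_eqF.
rewrite [leRHS](_ : _ = s / r * ((r * s - 1) ^+ 2 * (r * s + 2))); last by field.
apply: mulr_ge0; first by rewrite divr_ge0 ?(ltW r0).
apply: mulr_ge0; last by rewrite addr_ge0 ?mulr_ge0 ?(ltW r0).
by rewrite real_exprn_even_ge0// rpredB ?rpredM ?rpred1// ger0_real ?(ltW r0).
Qed.

(** The two marginals of a bipartite vector have the same purity. *)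
Lemma gram_sq (C : numClosedFieldType) (A Y : finType) (psi : A -> Y -> C) :
  \sum_y \sum_y' `|\sum_a psi a y * (psi a y')^*| ^+ 2 =
  \sum_a \sum_a' `|ip (psi a) (psi a')| ^+ 2.
Proof.
transitivity (\sum_y \sum_y' \sum_a \sum_a'
   (psi a y * (psi a y')^*) * ((psi a' y)^* * psi a' y')).
  apply: eq_bigr => y _; apply: eq_bigr => y' _.
  rewrite normCK rmorph_sum mulr_suml; apply: eq_bigr => a _.
  rewrite mulr_sumr; apply: eq_bigr => a' _.
  by rewrite rmorphM /= conjCK.
under eq_bigr do rewrite exchange_big.
rewrite exchange_big; apply: eq_bigr => a _ /=.
under eq_bigr do rewrite exchange_big.
rewrite exchange_big; apply: eq_bigr => a' _ /=.
rewrite normCK ipC mulrC /ip mulr_suml; apply: eq_bigr => y _.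
by rewrite mulr_sumr; apply: eq_bigr => y' _; ring.
Qed.

Lemma ip_pj_pj (C : numClosedFieldType) (T K : finType) (e : K -> T -> C)
    (P : pred K) u v : onb e ->
  ip (span_proj e P u) (span_proj e P v) = \sum_(k | P k) (ip (e k) u)^* * ip (e k) v.
Proof.
move=> eP; rewrite ip_suml; apply: eq_bigr => k Pk; congr (_ * _).
by rewrite -ipC -[RHS]ipC; congr (_^*); rewrite ip_pj_basis// Pk.
Qed.

Lemma ip_basis_pj (C : numClosedFieldType) (T K : finType) (e : K -> T -> C)
    (P : pred K) u k : onb e -> P k -> ip (e k) (span_proj e P u) = ip (e k) u.
Proof. by move=> eP Pk; rewrite -[LHS]ipC ip_pj_basis// Pk ipC. Qed.

Lemma ip_pj_span (C : numClosedFieldType) (T K : finType) (e : K -> T -> C)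
    (P : pred K) u v : onb e -> ip (span_proj e P u) (span_proj e P v) =
  \sum_(k | P k) (ip (e k) (span_proj e P u))^* * ip (e k) (span_proj e P v).
Proof.
by move=> eP; rewrite ip_pj_pj//; apply: eq_bigr => k Pk; rewrite !ip_basis_pj.
Qed.

Section Purification.
Variables (C : numClosedFieldType) (A X1 X2 : finType).
Variables (a0 : A) (x0 : X1) (w : A -> X1 * X2 -> C).

Definition marginal x2 x2' := \sum_a \sum_x1 w a (x1, x2) * (w a (x1, x2'))^*.

(* A polar decomposition: W aligns the purification held by Alice with w. *)
Lemma purification : (0 < #|X2|)%N ->
  exists (W : A * X1 -> X2 -> C) (Ws : seq (A * X1 -> X2 -> C)),
    trace_preserving (W :: Ws) /\
    3 * (\sum_x2 marginal x2 x2) -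
      #|X2|%:R * (\sum_x2 \sum_x2' `|marginal x2 x2'| ^+ 2) <=
    2 * ((\sum_a \sum_x (w a x)^* * W (a, x.1) x.2) / sqrtC #|X2|%:R).
Proof.
move=> X2_gt0.
have [] := @spectral_fun C X2 marginal.
  move=> x y; rewrite rmorph_sum; apply: eq_bigr => a _.
  rewrite rmorph_sum; apply: eq_bigr => x1 _.
  by rewrite rmorphM /= conjCK mulrC.
move=> g [lam [gP ME _]].
pose z k (ax : A * X1) := ip (g k) (fun x2 => w ax.1 (ax.2, x2)).
have zz k l : \sum_ax (z k ax)^* * z l ax = lam k * (k == l)%:R.
  transitivity (lam l * (l == k)%:R); last first.
    by rewrite eq_sym; case: eqP => [->|]; rewrite ?mulr0.
  rewrite -(spectral_basis gP ME).
  transitivity (\sum_x2 \sum_x2' \sum_ax (g l x2)^* *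
    (w ax.1 (ax.2, x2) * (w ax.1 (ax.2, x2'))^*) * g k x2').
    transitivity (\sum_ax \sum_x2 \sum_x2' (g l x2)^* *
      (w ax.1 (ax.2, x2) * (w ax.1 (ax.2, x2'))^*) * g k x2'); last first.
      by rewrite exchange_big; apply: eq_bigr => x2 _; rewrite exchange_big.
    apply: eq_bigr => ax _; rewrite /z ipC mulrC /ip mulr_suml.
    apply: eq_bigr => x2 _; rewrite mulr_sumr.
    by apply: eq_bigr => x2' _; ring.
  apply: eq_bigr => x2 _; apply: eq_bigr => x2' _.
  rewrite -mulr_suml -mulr_sumr; congr (_ * _ * _).
  by rewrite /marginal pair_bigA.
have lam0 k : 0 <= lam k.
  have := zz k k; rewrite eqxx mulr1 => <-.
  by apply: sumr_ge0 => ax _; rewrite mulrC -normCK exprn_ge0.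
(* A pseudo-inverse square root: where [lam k] vanishes, [hs k] is 0 by the convention for inverses,
   and [W] is a partial isometry supported on the range of [marginal]. *)
pose hs k := (sqrtC (lam k))^-1.
have hs_lam k : hs k * lam k = sqrtC (lam k).
  rewrite /hs -{2}[lam k]sqrtCK; have [->|s0] := eqVneq (sqrtC (lam k)) 0.
    by rewrite expr0n mulr0.
  by rewrite expr2 mulKf.
have hs_real k : (hs k)^* = hs k.
  by apply: CrealP; rewrite ger0_real ?invr_ge0 ?sqrtC_ge0.
pose W ax x2 := \sum_k hs k * z k ax * g k x2.
(* The kernel of [marginal] is sent to the fixed vector [(a0, x0)], only to complete [W] to a
   trace-preserving family. *)
pose R k (ax : A * X1) x2 := ((lam k == 0) && (ax == (a0, x0)))%:R * g k x2.
exists W, [seq R k | k <- enum X2]; split.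
  move=> x y; rewrite big_cons big_map big_enum /=.
  have -> : \sum_ax (W ax x)^* * W ax y =
      \sum_k (lam k != 0)%:R * ((g k x)^* * g k y).
    transitivity (\sum_k \sum_l (hs k * hs l) * ((g k x)^* * g l y) *
       \sum_ax (z k ax)^* * z l ax).
      transitivity (\sum_ax \sum_k \sum_l (hs k * hs l) *
          ((g k x)^* * g l y) * ((z k ax)^* * z l ax)); last first.
        rewrite exchange_big; apply: eq_bigr => k _; rewrite exchange_big.
        by apply: eq_bigr => l _; rewrite mulr_sumr.
      apply: eq_bigr => ax _; rewrite rmorph_sum mulr_suml.
      apply: eq_bigr => k _; rewrite mulr_sumr; apply: eq_bigr => l _.
      by rewrite !rmorphM /= hs_real; ring.
    apply: eq_bigr => k _; rewrite (bigD1 k)//= [X in _ + X]big1 ?addr0.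
      rewrite zz eqxx mulr1.
      transitivity (hs k * (hs k * lam k) * ((g k x)^* * g k y)); first by ring.
      congr (_ * _); rewrite hs_lam /hs.
      have [l0|l0] := eqVneq (lam k) 0; first by rewrite l0 sqrtC0 mulr0.
      by rewrite mulVf ?sqrtC_eq0.
    by move=> l lk; rewrite zz eq_sym (negPf lk) !mulr0.
  rewrite -big_split /= eq_sym -gP.2; apply: eq_bigr => k _.
  rewrite (bigD1 (a0, x0))//= [X in _ + (_ + X)]big1 ?addr0; last first.
    by move=> ax ax0; rewrite /R (negPf ax0) andbF !mul0r mulr0.
  rewrite /R eqxx andbT; case: (lam k == 0); rewrite /= ?mul0r ?mul1r ?add0r.
    by rewrite mulrC.
  by rewrite mulr0 addr0 mulrC.
have ovE : \sum_a \sum_x (w a x)^* * W (a, x.1) x.2 = \sum_k sqrtC (lam k).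
  transitivity (\sum_k hs k * \sum_ax (z k ax)^* * z k ax).
    transitivity (\sum_ax \sum_k hs k * ((z k ax)^* * z k ax)); last first.
      by rewrite exchange_big; apply: eq_bigr => k _; rewrite mulr_sumr.
    rewrite [RHS](_ : _ = \sum_a \sum_x1 \sum_k
        hs k * ((z k (a, x1))^* * z k (a, x1))); last by rewrite [RHS]pair_bigA;
      apply: eq_bigr => -[].
    apply: eq_bigr => a _.
    rewrite [LHS](_ : _ = \sum_x1 \sum_x2 (w a (x1, x2))^* * W (a, x1) x2);
      last by rewrite [RHS]pair_bigA; apply: eq_bigr => -[].
    apply: eq_bigr => x1 _; rewrite /W.
    under eq_bigr do rewrite mulr_sumr.
    rewrite exchange_big; apply: eq_bigr => k _ /=.
    have -> : (z k (a, x1))^* = \sum_x2 (w a (x1, x2))^* * g k x2.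
      by rewrite /z ipC.
    rewrite mulr_suml [RHS]mulr_sumr; apply: eq_bigr => x2 _; ring.
  by apply: eq_bigr => k _; rewrite zz eqxx mulr1 hs_lam.
rewrite ovE (spectral_tr gP ME) (spectral_sq gP ME).
rewrite mulr_suml !mulr_sumr -sumrB; apply: ler_sum => k _.
by rewrite ger0_norm// sqrt_lower_bound ?ltr0n.
Qed.

End Purification.

Lemma exists_inj_in (T X : finType) (P : pred T) : (#|P| <= #|X|)%N ->
  (0 < #|X|)%N ->
  exists f : T -> X, forall k l, P k -> P l -> f k = f l -> k = l.
Proof.
move=> PX /card_gt0P[x0 _]; exists (fun k => nth x0 (enum X) (index k (enum P))).
move=> k l Pk Pl /eqP.
have szX : size (enum X) = #|X| by rewrite -cardE.
have lt_index j : P j -> (index j (enum P) < size (enum X))%N.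
  move=> Pj; rewrite szX; apply: leq_trans PX.
  by rewrite cardE index_mem mem_enum.
rewrite nth_uniq ?enum_uniq ?lt_index// => /eqP e.
by rewrite -(nth_index k (_ : k \in enum P)) ?e ?nth_index ?mem_enum.
Qed.

(** The difference equals $n|x-y/n|^2+|y|^2$. The free weight [n] avoids square roots of the
    truncation error. *)
Lemma sub_sq_lower (C : numClosedFieldType) (n x y : C) : 0 < n ->
  (1 - n) * `|x| ^+ 2 - n^-1 * `|y| ^+ 2 <= `|x - y| ^+ 2.
Proof.
move=> n0; have nn0 : n != 0 by rewrite gt_eqF.
have nJ : n^* = n by apply: CrealP; rewrite ger0_real// ltW.
rewrite -subr_ge0 [leRHS](_ : _ = n * `|x - y / n| ^+ 2 + `|y| ^+ 2).
  by rewrite addr_ge0 ?mulr_ge0 ?exprn_ge0// ltW.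
rewrite !normCK !rmorphB rmorphM fmorphV /= nJ.
by field.
Qed.

Lemma nsq_sub_lower (C : numClosedFieldType) (A B : finType) (n : C)
    (u v : A -> B -> C) : 0 < n ->
  (1 - n) * (\sum_a sqnorm (u a)) - n^-1 * (\sum_a sqnorm (v a)) <=
  \sum_a sqnorm (fun b => u a b - v a b).
Proof.
move=> n0; rewrite !mulr_sumr -sumrB; apply: ler_sum => a _.
rewrite /sqnorm !mulr_sumr -sumrB; apply: ler_sum => b _; exact: sub_sq_lower.
Qed.

(** The difference equals $|c+z-1|^2+n|1+z/n|^2$. It is linear in [c], so lower bounds on [c] can be
    averaged over [i] directly. *)
Lemma norm_add_lower (C : numClosedFieldType) (n c z : C) : 0 < n -> c \is Num.real ->
  2 * c - 1 - n - n^-1 * `|z| ^+ 2 <= `|c + z| ^+ 2.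
Proof.
move=> n0 c0; have nn0 : n != 0 by rewrite gt_eqF.
have nJ : n^* = n by apply: CrealP; rewrite ger0_real// ltW.
have cJ : c^* = c by exact: CrealP.
rewrite -subr_ge0 [leRHS](_ : _ = `|c + z - 1| ^+ 2 + n * `|1 + z / n| ^+ 2).
  by rewrite addr_ge0 ?mulr_ge0 ?exprn_ge0// ltW.
rewrite !normCK !rmorphB !rmorphD rmorphM fmorphV !rmorph1 /= nJ cJ.
by field.
Qed.

(** * One-shot achievability *)

Section Direct.
Variables (C : numClosedFieldType) (A B I X1 X2 : finType) (d1 d2 : nat).
Local Notation X := (X1 * X2)%type.
Variables (p : I -> C) (phi : I -> A -> B -> C).
Variables (e : B -> B -> C) (r : B -> C) (T : pred B).
Variables (f : I -> B -> B -> C) (s : I -> B -> C) (Ti : I -> pred B).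
Hypothesis p0 : forall i, 0 <= p i.
Hypothesis p1 : \sum_i p i = 1.
Hypothesis eP : onb e.
Hypothesis fP : forall i, onb (f i).
Hypothesis quad : forall i w, \sum_a `|ip w (phi i a)| ^+ 2 =
  \sum_k s i k * `|ip w (f i k)| ^+ 2.
Hypothesis phi1 : forall i, \sum_a sqnorm (phi i a) = 1.
Variable smax : C.
Hypothesis smax0 : 0 <= smax.
Hypothesis Ti_le : forall i k, Ti i k -> s i k <= smax.
Hypothesis cX1 : #|X1| = (3 ^ d1.+1)%N.
Hypothesis cX2 : #|X2| = (3 ^ d2)%N.
Hypothesis T_card : (#|T| <= #|X1| * #|X2|)%N.

Local Notation trunc := (trunc phi e T f Ti).
Local Notation q := (#|{: X}|%:R : C).

Lemma trunc_nsq_le i : \sum_a sqnorm (trunc i a) <= 1.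
Proof.
rewrite -(phi1 i); apply: ler_sum => a _.
by apply: le_trans (nsq_pj_le eP _ _) _; exact: nsq_pj_le.
Qed.

Lemma trunc_purity_le i :
  \sum_a \sum_a' `|ip (trunc i a) (trunc i a')| ^+ 2 <= smax.
Proof.
apply: (@le_trans _ _ (\sum_a smax * sqnorm (trunc i a))); last first.
  by rewrite -mulr_sumr -[leRHS]mulr1 ler_wpM2l// trunc_nsq_le.
apply: ler_sum => a _; set u := trunc i a.
under eq_bigr do rewrite /trunc -ip_pjC.
rewrite (trunc_quad Ti fP quad).
apply: (@le_trans _ _ (smax * sqnorm (span_proj e T u))); last first.
  by rewrite ler_wpM2l// nsq_pj_le.
rewrite (onb_parseval_r (fP i) (span_proj e T u)) mulr_sumr [leRHS](bigID (Ti i))/=.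
rewrite -[leLHS]addr0; apply: lerD.
  by apply: ler_sum => k Tk; rewrite ler_wpM2r ?exprn_ge0 ?Ti_le.
by apply: sumr_ge0 => k _; rewrite mulr_ge0 ?exprn_ge0.
Qed.

Let err := \sum_i p i * \sum_a sqnorm (fun b => phi i a b - trunc i a b).
(** The excess over the maximally mixed purity, multiplied by [#|X2|]; it is of the order of [smax]
    times the ratio of $d_E$ to $d_Q$. *)
Let gap := #|X2|%:R * (1 + 2 * #|X2|%:R) / (q - 1) * smax.

(** Per word the fidelity is at least $3N-|X_2|\,\mathrm{pur}-1-n-\mathrm{del}/n$. The purity term
    costs on average at most $N$ plus [gap], and $N\ge 1-n-\mathrm{del}/n$; the two factors 3 are
    $1+2$. The coding does not depend on [n], which is tuned afterwards. *)
Lemma direct (a0 : A) (b0 : B) :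
  exists (Dec : seq (B -> X -> C)) (Enc : I -> seq (A * X1 -> X2 -> C)),
  [/\ trace_preserving Dec, forall i, trace_preserving (Enc i) &
  forall n : C, 0 < n -> 1 - 3 * n - 3 * (n^-1 * err) - gap <=
   \sum_i p i * \sum_(K <- Dec) \sum_(W <- Enc i) `|\sum_a ip (phi i a)
     (op_app K (fun x => (sqrtC #|X2|%:R)^-1 * W (a, x.1) x.2))| ^+ 2].
Proof.
have X2_gt0 : (0 < #|X2|)%N by rewrite cX2 expn_gt0.
have X1_gt0 : (0 < #|X1|)%N by rewrite cX1 expn_gt0.
have [x0 _] : exists x0 : X1, x0 \in X1 by exact/card_gt0P.
(* Labels of typical eigenvectors are embedded into the basis of $B_1B_2$; [T_card] says that they
   fit. *)
have [io io_inj] : exists io : B -> X, forall k l, T k -> T l -> io k = io l -> k = l.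
  by apply: exists_inj_in; rewrite card_prod ?muln_gt0 ?X1_gt0.
pose psi i a y := \sum_(k | T k) ip (e k) (trunc i a) * (y == io k)%:R.
pose rho i y y' := \sum_a psi i a y * (psi i a y')^*.
have [U [UP le_pur]] := twirl_exists rho cX1 cX2 p0.
have psi_sum i a (F : X -> C) : \sum_y psi i a y * F y =
    \sum_(k | T k) ip (e k) (trunc i a) * F (io k).
  under eq_bigr do rewrite mulr_suml.
  rewrite exchange_big; apply: eq_bigr => k _.
  rewrite (bigD1 (io k))//= eqxx mulr1 big1 ?addr0// => y yk.
  by rewrite (negPf yk) mulr0 mul0r.
have psi_io i a k : T k -> psi i a (io k) = ip (e k) (trunc i a).
  move=> Tk; rewrite /psi (bigD1 k)//= eqxx mulr1 big1 ?addr0//.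
  move=> l /andP[Tl lk]; case: eqP => [/(io_inj _ _ Tk Tl) kl|]; last by rewrite mulr0.
  by rewrite kl eqxx in lk.
have ip_psi i a a' : ip (psi i a) (psi i a') = ip (trunc i a) (trunc i a').
  rewrite -ipC /ip; under eq_bigr do rewrite mulrC.
  rewrite psi_sum rmorph_sum.
  rewrite [RHS]ip_pj_span//; apply: eq_bigr => k Tk.
  by rewrite rmorphM /= conjCK psi_io.
pose w i a x := \sum_(k | T k) ip (e k) (trunc i a) * U (io k) x.
have wE i a x : w i a x = \sum_y psi i a y * U y x by rewrite psi_sum.
have margE i x2 x2' : marginal (w i) x2 x2' = \sum_x1 \sum_y \sum_y'
    U y (x1, x2) * rho i y y' * (U y' (x1, x2'))^*.
  rewrite /marginal exchange_big; apply: eq_bigr => x1 _.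
  transitivity (\sum_a \sum_y \sum_y' U y (x1, x2) *
     (psi i a y * (psi i a y')^*) * (U y' (x1, x2'))^*).
    apply: eq_bigr => a _; rewrite !wE rmorph_sum mulr_suml.
    apply: eq_bigr => y _; rewrite mulr_sumr; apply: eq_bigr => y' _.
    by rewrite rmorphM /=; ring.
  rewrite exchange_big; apply: eq_bigr => y _ /=.
  rewrite exchange_big; apply: eq_bigr => y' _ /=.
  by rewrite -mulr_suml -mulr_sumr.
have nsq_psi i a : sqnorm (psi i a) = sqnorm (trunc i a) by rewrite -!ip_self ip_psi.
have trM i : \sum_x2 marginal (w i) x2 x2 = \sum_a sqnorm (trunc i a).
  rewrite exchange_big; apply: eq_bigr => a _ /=.
  rewrite -nsq_psi -[RHS](nsq_span UP) exchange_big pair_bigA /=.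
  by apply: eq_bigr => -[x1 x2] _ /=; rewrite -normCK wE.
have R2E i : \sum_y \sum_y' `|rho i y y'| ^+ 2 <= smax.
  rewrite gram_sq; under eq_bigr do under eq_bigr do rewrite ip_psi.
  exact: trunc_purity_le.
have trR i : \sum_y rho i y y = \sum_a sqnorm (trunc i a).
  rewrite exchange_big; apply: eq_bigr => a _ /=; rewrite -nsq_psi.
  by apply: eq_bigr => y _; rewrite -normCK.
have [Enc EncP] : exists Enc : I -> (A * X1 -> X2 -> C) * seq (A * X1 -> X2 -> C),
  forall i, trace_preserving ((Enc i).1 :: (Enc i).2) /\
    3 * (\sum_x2 marginal (w i) x2 x2) -
      #|X2|%:R * (\sum_x2 \sum_x2' `|marginal (w i) x2 x2'| ^+ 2) <=
    2 * ((\sum_a \sum_x (w i a x)^* * (Enc i).1 (a, x.1) x.2) / sqrtC #|X2|%:R).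
  have h i : exists E : (A * X1 -> X2 -> C) * seq (A * X1 -> X2 -> C),
    trace_preserving (E.1 :: E.2) /\ 3 * (\sum_x2 marginal (w i) x2 x2) -
      #|X2|%:R * (\sum_x2 \sum_x2' `|marginal (w i) x2 x2'| ^+ 2) <=
    2 * ((\sum_a \sum_x (w i a x)^* * E.1 (a, x.1) x.2) / sqrtC #|X2|%:R).
    by have [W [Ws WP]] := purification a0 x0 (w i) X2_gt0; exists (W, Ws).
  exact: (fin_all_exists h).
(* [V0] undoes the rotation and the embedding; the operators [V y] send the complementary basis
   vectors to [b0] and only restore trace preservation. *)
pose V0 b x := \sum_(k | T k) (U (io k) x)^* * e k b.
pose V y b x := (b == b0)%:R * (U y x)^*.
pose im := [set io k | k in T].
pose Vs := [seq V y | y <- enum (~: im)].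
have DecP : trace_preserving (V0 :: Vs).
  move=> x x'; rewrite big_cons big_map big_enum /=.
  have -> : \sum_b (V0 b x)^* * V0 b x' = \sum_(y in im) U y x * (U y x')^*.
    rewrite big_imset /=; last by move=> k l; exact: io_inj.
    rewrite [LHS](ip_span eP); apply: eq_bigr => k _.
    by rewrite conjCK.
  rewrite -UP.2 [RHS](bigID (mem im))/=; congr (_ + _).
  apply: eq_big => [y|y _]; first by rewrite inE.
  rewrite (bigD1 b0)//= big1 ?addr0 => [|b bb0].
    by rewrite /V eqxx !mul1r conjCK.
  by rewrite /V (negPf bb0) !mul0r mulr0.
exists (V0 :: Vs), (fun i => (Enc i).1 :: (Enc i).2); split => // [i|n n0].
  by case: (EncP i).
pose N i := \sum_a sqnorm (trunc i a).
pose del i := \sum_a sqnorm (fun b => phi i a b - trunc i a b).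
pose pur i := \sum_x2 \sum_x2' `|marginal (w i) x2 x2'| ^+ 2.
have N0 i : 0 <= N i by apply: sumr_ge0 => a _; exact: nsq_ge0.
have nV0 : 0 <= n^-1 by rewrite invr_ge0 ltW.
have F_ge i : 3 * N i - #|X2|%:R * pur i - 1 - n - n^-1 * del i <=
    \sum_(K <- V0 :: Vs) \sum_(W <- (Enc i).1 :: (Enc i).2) `|\sum_a ip (phi i a)
     (op_app K (fun x => (sqrtC #|X2|%:R)^-1 * W (a, x.1) x.2))| ^+ 2.
  have [tpE] := EncP i; set W := (Enc i).1; rewrite trM -/(N i) -/(pur i).
  pose y a (x : X) := (sqrtC #|X2|%:R)^-1 * W (a, x.1) x.2.
  set c := _ / _ => le_c.
  (* Only the pair of the main decoding and the main encoding operator is kept; all other terms are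
     nonnegative. *)
  apply: (@le_trans _ _ (`|\sum_a ip (phi i a) (op_app V0 (y a))| ^+ 2)); last first.
    rewrite big_cons big_cons -addrA lerDl addr_ge0//.
      by apply: sumr_ge0 => ? _; rewrite exprn_ge0.
    by do 2!(apply: sumr_ge0 => ? _); rewrite exprn_ge0.
  have y1 : \sum_a sqnorm (y a) <= 1.
    have -> : \sum_a sqnorm (y a) =
        \sum_x2 #|X2|%:R^-1 * \sum_ax `|W ax x2| ^+ 2.
      transitivity (\sum_a \sum_x1 \sum_x2 #|X2|%:R^-1 * `|W (a, x1) x2| ^+ 2).
        apply: eq_bigr => a _; rewrite [RHS]pair_bigA; apply: eq_bigr => -[x1 x2] _.
        rewrite /y normrM exprMn ger0_norm ?invr_ge0 ?sqrtC_ge0//.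
        by rewrite exprVn sqrtCK.
      rewrite pair_bigA exchange_big; apply: eq_bigr => x2 _.
      by rewrite mulr_sumr; apply: eq_bigr => -[].
    apply: (@le_trans _ _ (\sum_(x2 : X2) #|X2|%:R^-1)); last first.
      by rewrite sumr_const -[leLHS]mulr_natl divff// pnatr_eq0 -lt0n.
    apply: ler_sum => x2 _; rewrite -[leRHS]mulr1 ler_wpM2l ?invr_ge0//.
    have := tpE x2 x2; rewrite big_cons eqxx mulr1n => <-.
    rewrite [leLHS](_ : _ = \sum_ax (W ax x2)^* * W ax x2); last first.
      by apply: eq_bigr => ax _; rewrite mulrC -normCK.
    rewrite lerDl; do 2!(apply: sumr_ge0 => ? _).
    by rewrite mulrC -normCK exprn_ge0.
  pose z := \sum_a ip (fun b => phi i a b - trunc i a b) (op_app V0 (y a)).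
  have -> : \sum_a ip (phi i a) (op_app V0 (y a)) = c + z.
    transitivity (\sum_a ip (trunc i a) (op_app V0 (y a)) + z).
      by rewrite -big_split; apply: eq_bigr => a _ /=; rewrite ipBl addrC subrK.
    congr (_ + _); rewrite /c mulr_suml; apply: eq_bigr => a _.
    transitivity (ip (w i a) (y a)).
      rewrite [RHS]ip_suml.
      transitivity (ip (trunc i a)
          (fun b => \sum_(k | T k) ip (U (io k)) (y a) * e k b)).
        apply: eq_bigr => b _; congr (_ * _); rewrite /op_app /V0.
        under eq_bigr do rewrite mulr_suml.
        rewrite exchange_big; apply: eq_bigr => k _ /=.
        by rewrite /ip mulr_suml; apply: eq_bigr => x _; ring.
      by rewrite ip_sumr; apply: eq_bigr => k _; rewrite ipC mulrC.
    by rewrite /ip mulr_suml; apply: eq_bigr => x _; rewrite /y; ring.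
  have z_le : `|z| ^+ 2 <= del i.
    apply: le_trans (ip2_CS _ _) _; rewrite -[leRHS]mulr1 ler_wpM2l//.
      by apply: sumr_ge0 => a _; exact: nsq_ge0.
    apply: le_trans y1; apply: ler_sum => a _.
    rewrite -(tp_nsq (y a) DecP) big_cons lerDl.
    by apply: sumr_ge0 => ? _; exact: nsq_ge0.
  have cR : c \is Num.real.
    have pur0 : 0 <= pur i by do 2!(apply: sumr_ge0 => ? _); rewrite exprn_ge0.
    have : 2 * c \is Num.real.
      by rewrite -(ler_real le_c) rpredB// rpredM// ger0_real.
    by move=> c2; rewrite -[c](mulKf (_ : 2 != 0)) ?pnatr_eq0// rpredM ?rpredV ?realn.
  apply: le_trans (norm_add_lower z n0 cR).
  by rewrite !lerD ?lerN2 ?ler_wpM2l.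
have le_gap : #|X2|%:R * (\sum_i p i * pur i) <= \sum_i p i * N i + gap.
  have X20 : (#|X2|%:R : C) != 0 by rewrite pnatr_eq0 -lt0n.
  have -> : \sum_i p i * pur i = \sum_i p i * (\sum_x2 \sum_x2'
      `|\sum_x1 \sum_y \sum_y' U y (x1, x2) * rho i y y' *
         (U y' (x1, x2'))^*| ^+ 2).
    apply: eq_bigr => i _; congr (_ * _); apply: eq_bigr => x2 _.
    by apply: eq_bigr => x2' _; rewrite margE.
  apply: (le_trans (ler_wpM2l (ler0n _ _) le_pur)).
  rewrite [gap](_ : _ = \sum_i p i * gap); last by rewrite -mulr_suml p1 mul1r.
  rewrite mulr_sumr -big_split; apply: ler_sum => i _ /=.
  rewrite mulrCA -mulrDr ler_wpM2l// mulrDr lerD//.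
    rewrite mulrCA divff// mulr1 trR ger0_norm ?N0// expr2 -[leRHS]mulr1.
    by rewrite ler_wpM2l ?N0 ?trunc_nsq_le.
  rewrite /gap !mulrA ler_wpM2l//.
  apply: divr_ge0; first by rewrite mulr_ge0 ?addr_ge0 ?mulr_ge0.
  by rewrite subr_ge0 ler1n card_prod muln_gt0 X1_gt0.
apply: (@le_trans _ _ (\sum_i p i * (3 * N i - #|X2|%:R * pur i - 1 - n - n^-1 * del i))); last first.
  by apply: ler_sum => i _; rewrite ler_wpM2l.
apply: (@le_trans _ _ (\sum_i p i * (2 * N i - 1 - n - n^-1 * del i) - gap)).
  rewrite lerB//.
  have -> : 1 - 3 * n - 3 * (n^-1 * err) =
      \sum_i p i * (1 - 3 * n - 3 * (n^-1 * del i)).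
    transitivity ((1 - 3 * n) * (\sum_i p i) - 3 * (n^-1 * err)).
      by rewrite p1 mulr1.
    by rewrite /err !mulr_sumr -sumrB; apply: eq_bigr => i _; rewrite /del; ring.
  apply: ler_sum => i _; rewrite ler_wpM2l//.
  rewrite -subr_ge0 [leRHS](_ : _ = 2 * (N i - ((1 - n) * 1 - n^-1 * del i))).
    rewrite mulr_ge0// subr_ge0.
    have -> : N i = \sum_a sqnorm (fun b => phi i a b - (phi i a b - trunc i a b)).
      by apply: eq_bigr => a _; apply: eq_nsq => b; ring.
    have := nsq_sub_lower (phi i) (fun a b => phi i a b - trunc i a b) n0.
    by rewrite phi1.
  by ring.
rewrite -subr_ge0 [leRHS](_ : _ =
    \sum_i p i * N i + gap - #|X2|%:R * \sum_i p i * pur i) ?subr_ge0//.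
rewrite opprB addrCA addrC -sumrB [RHS]addrAC; congr (_ + _).
rewrite mulr_sumr -sumrB; apply: eq_bigr => i _; ring.
Qed.
End Direct.

(** * Typicality *)

Section Products.
Variables (C : numClosedFieldType) (n : nat).

Lemma prod_eq_ffun (T : finType) (f g : {ffun 'I_n -> T}) :
  \prod_k (f k == g k)%:R = (f == g)%:R :> C.
Proof.
have [->|fg] := eqVneq f g; first by rewrite big1// => k _; rewrite eqxx.
have [k fgk] : exists k, f k != g k.
  apply/existsP; apply: contraNT fg; rewrite negb_exists => /forallP h.
  by apply/eqP/ffunP => k; apply/eqP; have := h k; rewrite negbK.
by rewrite (bigD1 k)//= (negPf fgk) mul0r.
Qed.

Lemma prod_onb (T K : finType) (e : 'I_n -> K -> T -> C) :
  (forall k, onb (e k)) ->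
  onb (fun (f : {ffun 'I_n -> K}) (b : {ffun 'I_n -> T}) =>
    \prod_k e k (f k) (b k)).
Proof.
move=> eP; split=> [f g|b c].
  rewrite -prod_eq_ffun; under [RHS]eq_bigr => k _ do rewrite -(eP k).1.
  rewrite bigA_distr_bigA; apply: eq_bigr => b _.
  by rewrite rmorph_prod -big_split.
rewrite -prod_eq_ffun; under [RHS]eq_bigr => k _ do rewrite -(eP k).2.
rewrite bigA_distr_bigA; apply: eq_bigr => f _.
by rewrite rmorph_prod -big_split.
Qed.

Lemma quad_of_kernel (L K B : finType) (u : L -> B -> C) (c : L -> C)
    (e : K -> B -> C) (r : K -> C) :
  (forall b b', \sum_l c l * (u l b * (u l b')^*) =
    \sum_k r k * (e k b * (e k b')^*)) ->
  forall w, \sum_l c l * `|ip w (u l)| ^+ 2 = \sum_k r k * `|ip w (e k)| ^+ 2.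
Proof.
move=> kerE w.
have expand (L' : finType) (c' : L' -> C) (u' : L' -> B -> C) :
    \sum_l c' l * `|ip w (u' l)| ^+ 2 =
    \sum_b \sum_b' ((w b)^* * w b') * \sum_l c' l * (u' l b * (u' l b')^*).
  transitivity (\sum_b \sum_b' \sum_l ((w b)^* * w b') *
      (c' l * (u' l b * (u' l b')^*))); last first.
    by apply: eq_bigr => b _; apply: eq_bigr => b' _; rewrite mulr_sumr.
  under [RHS]eq_bigr do rewrite exchange_big.
  rewrite [RHS]exchange_big; apply: eq_bigr => l _ /=.
  rewrite normCK ipC /ip mulr_suml mulr_sumr; apply: eq_bigr => b _.
  by rewrite !mulr_sumr; apply: eq_bigr => b' _; ring.
by rewrite !expand; apply: eq_bigr => b _; apply: eq_bigr => b' _; rewrite kerE.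
Qed.

Lemma prod_kernel (L K B : finType) (u : 'I_n -> L -> B -> C)
    (c : 'I_n -> L -> C) (e : 'I_n -> K -> B -> C) (r : 'I_n -> K -> C) :
  (forall k b b', \sum_l c k l * (u k l b * (u k l b')^*) =
    \sum_j r k j * (e k j b * (e k j b')^*)) ->
  forall b b' : {ffun 'I_n -> B},
    \sum_(l : {ffun 'I_n -> L}) (\prod_k c k (l k)) *
      ((\prod_k u k (l k) (b k)) * (\prod_k u k (l k) (b' k))^*) =
    \sum_(j : {ffun 'I_n -> K}) (\prod_k r k (j k)) *
      ((\prod_k e k (j k) (b k)) * (\prod_k e k (j k) (b' k))^*).
Proof.
move=> kerE b b'.
have expand (L' : finType) (c' : 'I_n -> L' -> C) (u' : 'I_n -> L' -> B -> C) :
    \sum_(l : {ffun 'I_n -> L'}) (\prod_k c' k (l k)) *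
      ((\prod_k u' k (l k) (b k)) * (\prod_k u' k (l k) (b' k))^*) =
    \prod_k \sum_l c' k l * (u' k l (b k) * (u' k l (b' k))^*).
  rewrite bigA_distr_bigA; apply: eq_bigr => l _.
  by rewrite rmorph_prod -!big_split.
by rewrite !expand; apply: eq_bigr => k _; rewrite kerE.
Qed.

End Products.

Section WeakLaw.
Variables (R : realType) (J : finType) (P : J -> R) (n : nat).
Hypothesis P0 : forall j, 0 <= P j.
Hypothesis P1 : \sum_j P j = 1.

Lemma prod_moment (F : 'I_n -> J -> R) :
  \sum_(w : {ffun 'I_n -> J}) (\prod_k P (w k)) * \prod_k F k (w k) =
  \prod_k \sum_j P j * F k j.
Proof.
by rewrite bigA_distr_bigA; apply: eq_bigr => w _; rewrite -big_split.
Qed.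

Lemma prod_mass : \sum_(w : {ffun 'I_n -> J}) \prod_k P (w k) = 1.
Proof.
rewrite -(bigA_distr_bigA (fun _ : 'I_n => P)) big1// => k _; exact: P1.
Qed.

Variable Y : J -> R.
Hypothesis Y_mean : \sum_j P j * Y j = 0.
Local Notation V := (\sum_j P j * Y j ^+ 2).

(** Independence and mean zero kill the mixed terms. Writing [Y (w k) * Y (w l)] as a product over
    all positions lets the sum over words factor. *)
Lemma sum_moment2 :
  \sum_(w : {ffun 'I_n -> J}) (\prod_k P (w k)) * (\sum_k Y (w k)) ^+ 2 =
  n%:R * V.
Proof.
transitivity (\sum_k \sum_l \sum_(w : {ffun 'I_n -> J})
    (\prod_m P (w m)) * \prod_(m < n) ((if m == k then Y (w m) else 1) *
       (if m == l then Y (w m) else 1))).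
  rewrite [RHS](eq_bigr (fun k => \sum_(w : {ffun 'I_n -> J}) \sum_l
     (\prod_m P (w m)) * (Y (w k) * Y (w l)))); last first.
    move=> k _; rewrite exchange_big; apply: eq_bigr => l _.
    apply: eq_bigr => w _; rewrite big_split /=.
    by rewrite -!big_mkcond !big_pred1_eq.
  rewrite [RHS]exchange_big; apply: eq_bigr => w _.
  rewrite expr2 mulr_suml mulr_sumr; apply: eq_bigr => k _.
  by rewrite !mulr_sumr.
have E k l : \sum_(w : {ffun 'I_n -> J})
    (\prod_m P (w m)) * \prod_(m < n) ((if m == k then Y (w m) else 1) *
       (if m == l then Y (w m) else 1)) = (k == l)%:R * V.
  rewrite (prod_moment (fun m j => (if m == k then Y j else 1) *
       (if m == l then Y j else 1))).
  have [<-|kl] := eqVneq k l.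
    rewrite mul1r (bigD1 k)//= [X in _ * X]big1 ?mulr1 ?eqxx//.
    by move=> m mk; rewrite (negPf mk) mulr1; under eq_bigr do rewrite mulr1.
  rewrite mul0r (bigD1 k)//= eqxx (negPf kl).
  by under eq_bigr do rewrite mulr1; rewrite Y_mean mul0r.
rewrite (eq_bigr (fun k => V)).
  by rewrite sumr_const card_ord mulr_natl.
move=> k _; rewrite (bigD1 k)//= E eqxx mul1r [X in _ + X]big1 ?addr0// => l lk.
by rewrite E eq_sym (negPf lk) mul0r.
Qed.

Lemma weak_law (t : R) : 0 < t -> (0 < n)%N ->
  \sum_(w : {ffun 'I_n -> J} | n%:R * t < `|\sum_k Y (w k)|) \prod_k P (w k)
  <= V / t ^+ 2 / n%:R.
Proof.
move=> t0 n0; have n0' : 0 < n%:R :> R by rewrite ltr0n.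
have nt0 : 0 < (n%:R * t) ^+ 2 by rewrite exprn_gt0// mulr_gt0.
rewrite -(ler_pM2l nt0).
have -> : (n%:R * t) ^+ 2 * (V / t ^+ 2 / n%:R) = n%:R * V.
  by field; rewrite !gt_eqF.
rewrite -sum_moment2 [leRHS](bigID (fun w : {ffun 'I_n -> J} =>
  n%:R * t < `|\sum_k Y (w k)|))/= -[leLHS]addr0.
have pr0 (w : {ffun 'I_n -> J}) : 0 <= \prod_k P (w k).
  by apply: prodr_ge0 => k _.
apply: lerD; last by apply: sumr_ge0 => w _; rewrite mulr_ge0// sqr_ge0.
rewrite mulr_sumr; apply: ler_sum => w lt_w; rewrite mulrC ler_wpM2l//.
rewrite -[leRHS]real_normK ?num_real// lerXn2r ?nnegrE ?mulr_ge0 ?(ltW t0)//.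
exact: ltW.
Qed.

End WeakLaw.

Section Typicality.
Variables (R : realType) (J : finType) (n : nat) (mu t : R).
Hypothesis n_gt0 : (0 < n)%N.
Hypothesis t_gt0 : 0 < t.

(** Stated for a sequence of likelihoods, so that it serves both the average and the conditional
    spectrum; entropies are in nats. Positivity is required because [ln] carries no information at
    0. *)
Definition typical (lik : 'I_n -> R) : bool :=
  [forall k, 0 < lik k] && (`|\sum_k (- ln (lik k) - mu)| <= n%:R * t).

Lemma typical_bounds lik : typical lik ->
  expR (- (n%:R * (mu + t))) <= \prod_k lik k <= expR (- (n%:R * (mu - t))).
Proof.
case/andP => /forallP lik0; rewrite ler_norml.
have -> : \sum_k (- ln (lik k) - mu) = - ln (\prod_k lik k) - n%:R * mu.
  rewrite sumrB sumr_const card_ord mulr_natl; congr (_ - _).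
  have : forall s : seq 'I_n, \sum_(k <- s) - ln (lik k) = - ln (\prod_(k <- s) lik k).
    elim=> [|k s IH]; first by rewrite !big_nil ln1 oppr0.
    rewrite !big_cons IH lnM ?posrE ?opprD//.
    by apply: prodr_gt0 => j _.
  by apply.
have pr0 : 0 < \prod_k lik k by apply: prodr_gt0 => k _.
move=> /andP[h1 h2]; rewrite -[\prod_k lik k]lnK ?posrE// !ler_expR.
by apply/andP; split; lra.
Qed.

(** The law [P] and the likelihood [lik] may differ: for conditional typicality the letter is a
    pair, [P] is its joint law and [lik] the conditional weight. Words containing a zero likelihood
    have probability zero, so only Chebyshev deviations count. *)
Lemma atypical_mass (P lik : J -> R) :
  (forall j, 0 <= P j) -> \sum_j P j = 1 ->
  (forall j, P j != 0 -> 0 < lik j) ->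
  \sum_j P j * - ln (lik j) = mu ->
  \sum_(w : {ffun 'I_n -> J} | ~~ typical (lik \o w)) \prod_k P (w k) <=
  (\sum_j P j * (- ln (lik j) - mu) ^+ 2) / t ^+ 2 / n%:R.
Proof.
move=> P0 P1 PL muE; apply: le_trans (weak_law P0 P1 _ t_gt0 n_gt0); last first.
  under eq_bigr do rewrite mulrBr.
  by rewrite sumrB muE -mulr_suml P1 mul1r subrr.
rewrite big_mkcond [leRHS]big_mkcond; apply: ler_sum => w _.
have pr0 : 0 <= \prod_k P (w k) by apply: prodr_ge0 => k _.
rewrite /typical negb_and -ltNge; case: ltP => [_|_].
  by rewrite orbT.
rewrite orbF; case: ifP => // /forallPn[k].
rewrite -leNgt => lik0.
have Pk : P (w k) = 0.
  by apply/eqP/negPn/negP => /PL; rewrite ltNge lik0.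
by rewrite (bigD1 k)//= Pk mul0r.
Qed.

End Typicality.

(** * Complex scalars and the entropy of a positive operator *)

Section Complex.
Variable R : realType.
Local Notation C := R[i].

Lemma conjcE (z : C) : conjc z = (z^*)%R.
Proof. by []. Qed.

Lemma creE (z : C) : cre z = complex.Re z. Proof. by case: z. Qed.

Lemma cre_sum (I : Type) (s : seq I) (P : pred I) (F : I -> C) :
  cre (\sum_(i <- s | P i) F i) = \sum_(i <- s | P i) cre (F i).
Proof.
elim/big_rec2: _ => //= i x y _ <-; by case: (F i) => a b; case: y.
Qed.

Lemma creZ (x : R) (z : C) : cre (x%:C%C * z) = x * cre z.
Proof. by case: z => a b /=; rewrite mul0r subr0. Qed.

Lemma cre_le (z w : C) : z <= w -> cre z <= cre w.
Proof. by rewrite lecE !creE => /andP[]. Qed.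

Lemma creK (z : C) : 0 <= z -> (cre z)%:C%C = z.
Proof. by move=> z0; rewrite creE RRe_real// ger0_real. Qed.

Lemma cre_ge0 (z : C) : 0 <= z -> 0 <= cre z.
Proof. exact: (@cre_le 0 z). Qed.

Lemma real_complexM (x y : R) : (x * y)%:C%C = x%:C%C * y%:C%C :> C.
Proof. exact: (rmorphM (real_complex R)). Qed.

Lemma real_complex_nat (k : nat) : (k%:R : R)%:C%C = k%:R :> C.
Proof. exact: (rmorph_nat (real_complex R)). Qed.

Lemma real_complexD (x y : R) : (x + y)%:C%C = x%:C%C + y%:C%C :> C.
Proof. exact: (rmorphD (real_complex R)). Qed.

Lemma real_complexB (x y : R) : (x - y)%:C%C = x%:C%C - y%:C%C :> C.
Proof. exact: (rmorphB (real_complex R)). Qed.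

Lemma real_complexV (x : R) : (x^-1)%:C%C = x%:C%C^-1 :> C.
Proof. exact: (fmorphV (real_complex R)). Qed.

Lemma eta_ln (x : R) : 0 <= x -> Defs.eta x * ln 2 = x * - ln x.
Proof.
have ln2 : ln 2 != 0 :> R by rewrite gt_eqF// ln_gt0// ltr1n.
rewrite /Defs.eta le_eqVlt => /orP[/eqP<-|x0]; first by rewrite ?ltxx !mul0r.
by rewrite x0 /log2; field.
Qed.

(** Both the roots chosen in the definition and the spectral weights split the same characteristic
    polynomial, so they agree up to order. *)
Lemma vN_spectral (T : finType) (A : op R T T) : psd A ->
  exists (g : T -> T -> C) (r : T -> R), [/\ onb g, forall k, 0 <= r k,
    forall x y, A x y = \sum_k (r k)%:C%C * (g k x * (g k y)^*) &
    vN_entropy A = \sum_k Defs.eta (r k)].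
Proof.
move=> [Ah A0]; have [g [lam [gP AE cpE]]] := @spectral_fun C T A Ah.
have lam0 k : 0 <= lam k.
  apply: (spectral_ge0 gP AE) => v; have := A0 v; rewrite /expect.
  by under eq_bigr do under eq_bigr do rewrite conjcE.
exists g, (fun k => cre (lam k)); split => // [k|x y|].
- exact: cre_ge0.
- by rewrite AE; apply: eq_bigr => k _; rewrite creK.
rewrite /vN_entropy /eigenvalues; case: closed_field_poly_normal => s /= sE.
have : perm_eq s [seq lam k | k <- enum T].
  apply: prod_XsubC_eq; rewrite big_map big_enum /= -cpE.
  move: sE; rewrite (monicP (char_poly_monic _)) scale1r => <-; congr char_poly.
move=> /(perm_big _) ->; by rewrite big_map big_enum.
Qed.

End Complex.

(** * Product states and their typical subspaces *)

Section NLetter.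
Variables (R : realType) (TA TB : finType) (m : nat) (p : 'I_m -> R).
Variable phi : 'I_m -> vec R (TA * TB)%type.
Hypothesis hp : distr p.
Hypothesis hphi : forall i, unit_vec (phi i).
Local Notation C := R[i].
Variables (e : TB -> TB -> C) (r : TB -> R).
Variables (f : 'I_m -> TB -> TB -> C) (s : 'I_m -> TB -> R).
Hypothesis eP : onb e.
Hypothesis r0 : forall k, 0 <= r k.
Hypothesis rE : forall x y, ensB_state p phi x y =
  \sum_k (r k)%:C%C * (e k x * (e k y)^*).
Hypothesis fP : forall i, onb (f i).
Hypothesis s0 : forall i k, 0 <= s i k.
Hypothesis sE : forall i x y, ptraceA (Defs.proj (phi i)) x y =
  \sum_k (s i k)%:C%C * (f i k x * (f i k y)^*).
Variables (n : nat) (t : R).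
Hypothesis n_gt0 : (0 < n)%N.
Hypothesis t_gt0 : 0 < t.
Let mu := \sum_k r k * - ln (r k).
Let nu := \sum_i p i * \sum_k s i k * - ln (s i k).

Definition phiN (ii : seqidx m n) (a : An TA n) (b : Bn TB n) : C :=
  phin phi ii (a, b).
Definition basN (k : Bn TB n) (b : Bn TB n) : C := \prod_j e (k j) (b j).
Definition wtN (k : Bn TB n) : C := (\prod_j r (k j))%:C%C.
Definition cbasN (ii : seqidx m n) (k b : Bn TB n) : C :=
  \prod_j f (ii j) (k j) (b j).
Definition cwtN (ii : seqidx m n) (k : Bn TB n) : C :=
  (\prod_j s (ii j) (k j))%:C%C.
Definition prN (ii : seqidx m n) : C := (pn p ii)%:C%C.
Definition typN (k : Bn TB n) : bool := typical mu t (fun j => r (k j)).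
Definition ctypN (ii : seqidx m n) (k : Bn TB n) : bool :=
  typical nu t (fun j => s (ii j) (k j)).

Lemma prN_ge0 ii : 0 <= prN ii.
Proof. by rewrite lecR; apply: prodr_ge0 => k _; case: hp. Qed.

Lemma pn_sum : \sum_(ii : seqidx m n) pn p ii = 1.
Proof. by case: hp => p0 p1; exact: prod_mass. Qed.

Lemma prN_sum : \sum_ii prN ii = 1.
Proof. by rewrite -rmorph_sum pn_sum. Qed.

Lemma basN_onb : onb basN.
Proof. exact: (prod_onb (fun=> eP)). Qed.

Lemma cbasN_onb ii : onb (cbasN ii).
Proof. exact: (prod_onb (fun k => fP (ii k))). Qed.

Lemma cwtN_ge0 ii k : 0 <= cwtN ii k.
Proof. by rewrite lecR; apply: prodr_ge0 => j _; exact: s0. Qed.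

Lemma cond_kernel i b b' : \sum_a 1 * (phi i (a, b) * (phi i (a, b'))^*) =
  \sum_k (s i k)%:C%C * (f i k b * (f i k b')^*).
Proof.
by rewrite -sE; apply: eq_bigr => a _; rewrite mul1r.
Qed.

Lemma cond_kernelN ii b b' :
  \sum_a (phiN ii a b * (phiN ii a b')^*) =
  \sum_k cwtN ii k * (cbasN ii k b * (cbasN ii k b')^*).
Proof.
have := prod_kernel (fun k => cond_kernel (ii k)) b b'.
rewrite /= => h; transitivity (\sum_(l : {ffun 'I_n -> TA}) (\prod_(k < n) 1) *
  ((\prod_k phi (ii k) (l k, b k)) * (\prod_k phi (ii k) (l k, b' k))^*)).
  by apply: eq_bigr => a _; rewrite big1_eq mul1r.
by rewrite h; apply: eq_bigr => k _; congr (_ * _); rewrite /cwtN rmorph_prod.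
Qed.

Lemma quadN ii w : \sum_a `|ip w (phiN ii a)| ^+ 2 =
  \sum_k cwtN ii k * `|ip w (cbasN ii k)| ^+ 2.
Proof.
rewrite -(@quad_of_kernel C _ _ _ (phiN ii) (fun=> 1)).
  by under [RHS]eq_bigr do rewrite mul1r.
by move=> b b'; rewrite -cond_kernelN; under eq_bigr do rewrite mul1r.
Qed.

Lemma avg_quadN w : \sum_ii prN ii * \sum_a `|ip w (phiN ii a)| ^+ 2 =
  \sum_k wtN k * `|ip w (basN k)| ^+ 2.
Proof.
pose u (l : seqidx m n * An TA n) := phiN l.1 l.2.
transitivity (\sum_l prN l.1 * `|ip w (u l)| ^+ 2).
  rewrite [RHS](eq_bigr (fun l => prN l.1 * `|ip w (phiN l.1 l.2)| ^+ 2))//.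
  rewrite -(pair_bigA _ (fun ii a => prN ii * `|ip w (phiN ii a)| ^+ 2)).
  by apply: eq_bigr => ii _; rewrite mulr_sumr.
apply: quad_of_kernel => b b'.
rewrite -(pair_bigA _ (fun ii a => prN ii * (phiN ii a b * (phiN ii a b')^*))).
rewrite /=; under eq_bigr do rewrite -mulr_sumr.
transitivity (\sum_ii prN ii * \prod_k ptraceA (Defs.proj (phi (ii k))) (b k) (b' k)).
  apply: eq_bigr => ii _; congr (_ * _); rewrite cond_kernelN.
  rewrite (eq_bigr (fun k => \sum_j (s (ii k) j)%:C%C *
    (f (ii k) j (b k) * (f (ii k) j (b' k))^*)))//.
  rewrite bigA_distr_bigA; apply: eq_bigr => k _.
  by rewrite /cwtN rmorph_prod /cbasN rmorph_prod -!big_split.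
transitivity (\prod_k ensB_state p phi (b k) (b' k)).
  rewrite /ensB_state bigA_distr_bigA; apply: eq_bigr => ii _.
  by rewrite /prN /pn rmorph_prod -big_split.
rewrite (eq_bigr (fun k => \sum_j (r j)%:C%C * (e j (b k) * (e j (b' k))^*)))//.
rewrite bigA_distr_bigA; apply: eq_bigr => k _.
by rewrite /wtN rmorph_prod /basN rmorph_prod -!big_split.
Qed.

Lemma unit_vec1 i : \sum_a \sum_b `|phi i (a, b)| ^+ 2 = 1 :> C.
Proof.
rewrite -(hphi i) pair_bigA; apply: eq_bigr => -[a b] _ /=.
by rewrite normCK mulrC.
Qed.

Lemma phiN1 ii : \sum_a sqnorm (phiN ii a) = 1.
Proof.
rewrite /sqnorm pair_bigA /=.
transitivity (\prod_(k < n) \sum_a \sum_b `|phi (ii k) (a, b)| ^+ 2); last first.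
  by rewrite big1// => k _; rewrite unit_vec1.
rewrite bigA_distr_bigA -(pair_bigA _ (fun a b => `|phiN ii a b| ^+ 2)).
apply: eq_bigr => a _; rewrite bigA_distr_bigA; apply: eq_bigr => b _.
by rewrite /phiN /phin normr_prod prodrXl.
Qed.

Lemma tr_cond i : \sum_b ptraceA (Defs.proj (phi i)) b b = 1.
Proof.
by rewrite exchange_big -(unit_vec1 i); apply: eq_bigr => a _;
  apply: eq_bigr => b _; rewrite normCK.
Qed.

Lemma s_sum i : \sum_k s i k = 1.
Proof.
have := tr_cond i; rewrite (spectral_tr (fP i) (sE i)) -rmorph_sum.
by move=> /(congr1 (@cre R)).
Qed.

Lemma r_sum : \sum_k r k = 1.
Proof.
have : \sum_b ensB_state p phi b b = 1.
  rewrite exchange_big /=; under eq_bigr do rewrite -mulr_sumr tr_cond mulr1.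
  by rewrite -rmorph_sum; case: hp => _ ->.
rewrite (spectral_tr eP rE) -rmorph_sum.
by move=> /(congr1 (@cre R)).
Qed.

Lemma wtN_le k : typN k -> wtN k <= (expR (- (n%:R * (mu - t))))%:C%C.
Proof. by move=> /typical_bounds/andP[_ h]; rewrite lecR. Qed.

Lemma cwtN_le ii k : ctypN ii k -> cwtN ii k <= (expR (- (n%:R * (nu - t))))%:C%C.
Proof. by move=> /typical_bounds/andP[_ h]; rewrite lecR. Qed.

Lemma cwtN_ge ii k : ctypN ii k -> (expR (- (n%:R * (nu + t))))%:C%C <= cwtN ii k.
Proof. by move=> /typical_bounds/andP[h _]; rewrite lecR. Qed.

Lemma typN_card : (#|typN|%:R : R) <= expR (n%:R * (mu + t)).
Proof.
have : \sum_(k | typN k) expR (- (n%:R * (mu + t))) <= 1.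
  have sum1 : \sum_(k : Bn TB n) \prod_j r (k j) = 1 by exact: prod_mass r_sum.
  rewrite -[leRHS]sum1 [leRHS](bigID typN)/= -[leLHS]addr0; apply: lerD.
    by apply: ler_sum => k Tk; have /andP[] := typical_bounds Tk.
  by apply: sumr_ge0 => k _; apply: prodr_ge0 => j _; exact: r0.
by rewrite sumr_const -[leLHS]mulr_natl expRN ler_pdivrMr ?expR_gt0// mul1r.
Qed.

(** The two Chebyshev constants, for the average and the conditional spectrum; neither depends on
    [n]. *)
Definition varN := (\sum_k r k * (- ln (r k) - mu) ^+ 2) / t ^+ 2 +
  (\sum_(j : 'I_m * TB) p j.1 * s j.1 j.2 * (- ln (s j.1 j.2) - nu) ^+ 2) / t ^+ 2.

Lemma atypN : \sum_(k | ~~ typN k) wtN k +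
  \sum_ii prN ii * (\sum_(k | ~~ ctypN ii k) cwtN ii k) <= (varN / n%:R)%:C%C.
Proof.
rewrite /varN mulrDl rmorphD /=; apply: lerD.
  rewrite -rmorph_sum lecR.
  apply: (atypical_mass n_gt0 t_gt0 r0 r_sum _ (lik := r)) => // k.
  by rewrite lt0r r0 andbT.
have -> : \sum_ii prN ii * (\sum_(k | ~~ ctypN ii k) cwtN ii k) =
  (\sum_ii \sum_(k | ~~ ctypN ii k)
     \prod_j (p (ii j) * s (ii j) (k j)))%:C%C.
  rewrite rmorph_sum; apply: eq_bigr => ii _; rewrite rmorph_sum mulr_sumr.
  by apply: eq_bigr => k _; rewrite big_split rmorphM.
rewrite lecR.
pose P (j : 'I_m * TB) := p j.1 * s j.1 j.2.
pose lik (j : 'I_m * TB) := s j.1 j.2.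
have [p0 p1] := hp.
have := @atypical_mass R _ n nu t n_gt0 t_gt0 P lik.
have P0 j : 0 <= P j by rewrite mulr_ge0.
have Psum : \sum_j P j = 1.
  rewrite -(pair_bigA _ (fun i k => p i * s i k))/= -p1.
  by apply: eq_bigr => i _; rewrite -mulr_sumr s_sum mulr1.
have Plik j : P j != 0 -> 0 < lik j.
  by rewrite mulf_eq0 negb_or lt0r s0 andbT => /andP[].
have Pnu : \sum_j P j * - ln (lik j) = nu.
  rewrite /nu -(pair_bigA _ (fun i k => p i * s i k * - ln (s i k)))/=.
  apply: eq_bigr => i _; rewrite mulr_sumr; apply: eq_bigr => k _.
  by rewrite mulrA.
move=> /(_ P0 Psum Plik Pnu); apply: le_trans.
rewrite le_eqVlt; apply/orP; left; apply/eqP.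
rewrite pair_big_dep /=.
(* A word of indices together with a word of eigenvector labels is one word of independent pairs, to
   which the weak law applies. *)
pose pr (ik : seqidx m n * Bn TB n) : {ffun 'I_n -> 'I_m * TB} :=
  [ffun j => (ik.1 j, ik.2 j)].
rewrite [RHS](reindex pr)/=.
  apply: eq_big => [[ii k]|[ii k] _] /=.
    congr (~~ _); rewrite /ctypN; congr typical; apply/funext => j.
    by rewrite /lik /= ffunE.
  by apply: eq_bigr => j _; rewrite ffunE.
exists (fun w => ([ffun j => (w j).1], [ffun j => (w j).2])) => [[ii k]|w] _.
  by congr (_, _); apply/ffunP => j; rewrite !ffunE.
by apply/ffunP => j; rewrite !ffunE; case: (w j).
Qed.

End NLetter.

(** * Kraus operators and protocols *)

Section Kraus.
Variable R : realType.
Local Notation C := R[i].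

Lemma cptp_tp (U T : finType) (Ks : seq (op R U T)) : cptp Ks -> trace_preserving Ks.
Proof. by move=> h x y; have := congr1 (fun A => A x y) h. Qed.

Lemma tp_cptp (U T : finType) (Ks : seq (op R U T)) : trace_preserving Ks -> cptp Ks.
Proof. by move=> h; apply/funext => x; apply/funext => y; exact: h. Qed.

Definition gram (T : finType) (gs : seq (T -> C)) : op R T T :=
  fun x y => \sum_(g <- gs) g x * (g y)^*.

Lemma kraus_gram (U T : finType) (Ks : seq (op R U T)) (gs : seq (T -> C)) x y :
  kraus_apply Ks (gram gs) x y =
  \sum_(K <- Ks) \sum_(g <- gs) op_app K g x * (op_app K g y)^*.
Proof.
apply: eq_bigr => K _; rewrite /opmul /gram.
transitivity (\sum_t' \sum_(g <- gs) op_app K g x * (K y t' * g t')^*).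
  apply: eq_bigr => t' _; rewrite mulr_suml.
  rewrite (eq_bigr (fun t => \sum_(g <- gs) K x t * g t * (K y t' * g t')^*)).
    by rewrite exchange_big; apply: eq_bigr => g _; rewrite -mulr_suml.
  move=> t _; rewrite mulr_sumr mulr_suml; apply: eq_bigr => g _.
  by rewrite rmorphM /adj conjcE; ring.
rewrite exchange_big; apply: eq_bigr => g _.
by rewrite -mulr_sumr [in RHS]/op_app rmorph_sum.
Qed.

Lemma expect_gram (T : finType) (w : T -> C) (gs : seq (T -> C)) :
  expect w (gram gs) = \sum_(g <- gs) `|ip w g| ^+ 2.
Proof.
rewrite /expect /gram.
transitivity (\sum_x \sum_(g <- gs) \sum_y (w x)^* * g x * ((g y)^* * w y)).
  apply: eq_bigr => x _; rewrite exchange_big; apply: eq_bigr => y _ /=.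
  by rewrite mulr_sumr mulr_suml; apply: eq_bigr => g _; rewrite conjcE; ring.
rewrite exchange_big; apply: eq_bigr => g _.
rewrite normCK ipC /ip mulr_suml; apply: eq_bigr => x _.
by rewrite mulr_sumr.
Qed.

Lemma expect_kraus (U T : finType) (w : U -> C) (Ks : seq (op R U T))
    (gs : seq (T -> C)) : expect w (kraus_apply Ks (gram gs)) =
  \sum_(K <- Ks) \sum_(g <- gs) `|ip w (op_app K g)| ^+ 2.
Proof.
have -> : kraus_apply Ks (gram gs) = gram [seq op_app K g | K <- Ks, g <- gs].
  apply/funext => x; apply/funext => y.
  by rewrite kraus_gram /gram big_allpairs_dep.
by rewrite expect_gram big_allpairs_dep.
Qed.

Lemma app_kron_l (V U T : finType) (K : op R U T) (g : V * T -> C) a b :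
  op_app (kron_id_l K) g (a, b) = op_app K (fun x => g (a, x)) b.
Proof.
rewrite /op_app /kron_id_l /=.
transitivity (\sum_a' \sum_x (a == a')%:R * K b x * g (a', x)).
  by rewrite pair_bigA; apply: eq_bigr => -[].
rewrite (bigD1 a)//= [X in _ + X]big1 ?addr0.
  by apply: eq_bigr => x _; rewrite eqxx mul1r.
by move=> a' aa; rewrite big1// => x _; rewrite eq_sym (negPf aa) !mul0r.
Qed.

Lemma ip_kron_l (V U T : finType) (K : op R U T) (g : V * T -> C)
    (w : V * U -> C) : ip w (op_app (kron_id_l K) g) =
  \sum_a ip (fun b => w (a, b)) (op_app K (fun x => g (a, x))).
Proof.
rewrite /ip pair_bigA; apply: eq_bigr => -[a b] _ /=; by rewrite app_kron_l.
Qed.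

(** An operator applied to half of the maximally entangled vector leaves its own matrix entries as
    amplitudes; encoders can therefore be handled as vectors. *)
Lemma app_maxent (U : finType) (dE : nat) (K : op R U 'I_dE) u x :
  op_app (kron_id_r K) (@maxent R dE) (u, x) = (sqrtC dE%:R)^-1 * K u x.
Proof.
have -> : (sqrtC dE%:R)^-1 = ((Num.sqrt (dE%:R : R))^-1)%:C%C :> C.
  rewrite fmorphV; congr (_^-1); apply/eqP.
  rewrite -(@eqrXn2 _ 2)// ?sqrtC_ge0 ?lecR ?sqrtr_ge0//.
  by rewrite sqrtCK -rmorphXn sqr_sqrtr// rmorph_nat.
rewrite /op_app /kron_id_r /maxent /=.
transitivity (\sum_x1 \sum_x2 K u x1 * (x == x2)%:R *
    ((x1 == x2)%:R * ((Num.sqrt (dE%:R : R))^-1)%:C%C)).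
  by rewrite pair_bigA; apply: eq_bigr => -[].
rewrite (bigD1 x)//= [X in _ + X]big1 ?addr0; last first.
  move=> x1 x1x; rewrite big1// => x2 _; have [<-|] := eqVneq x x2.
    by rewrite (negPf x1x) mul0r mulr0.
  by rewrite mulr0 mul0r.
rewrite (bigD1 x)//= [X in _ + X]big1 ?addr0; last first.
  by move=> x2 x2x; rewrite eq_sym (negPf x2x) mulr0 mul0r.
by rewrite eqxx mul1r mulr1 mulrC.
Qed.

Lemma proj_gram (T : finType) (v : T -> C) : Defs.proj v = gram [:: v].
Proof. by apply/funext => x; apply/funext => y; rewrite /gram big_seq1. Qed.

Lemma kraus_maxent (U : finType) (dE : nat) (Ks : seq (op R U 'I_dE)) u x u' x' :
  kraus_apply [seq @kron_id_r _ _ _ 'I_dE K | K <- Ks]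
    (Defs.proj (@maxent R dE)) (u, x) (u', x') =
  dE%:R^-1 * \sum_(K <- Ks) K u x * (K u' x')^*.
Proof.
rewrite proj_gram kraus_gram big_map mulr_sumr; apply: eq_bigr => K _.
rewrite big_seq1 !app_maxent rmorphM /= mulrACA; congr (_ * _).
rewrite -normCK ger0_norm ?invr_ge0 ?sqrtC_ge0// exprVn sqrtCK//.
Qed.

End Kraus.

(** * Translation between protocols and families of vectors *)

Section Protocol.
Variables (R : realType) (TA TB : finType) (m : nat) (p : 'I_m -> R).
Variable phi : 'I_m -> vec R (TA * TB)%type.
Variables (n : nat).
Local Notation C := R[i].
Local Notation A := (An TA n).
Local Notation B := (Bn TB n).

Lemma psd_gram (T : finType) (M : op R T T) : psd M ->
  exists g : T -> T -> C, forall x y, M x y = \sum_k g k x * (g k y)^*.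
Proof.
move=> /vN_spectral[g [r [_ r0 ME _]]].
exists (fun k x => sqrtC (r k)%:C%C * g k x) => x y; rewrite ME.
apply: eq_bigr => k _; rewrite rmorphM /= mulrACA; congr (_ * _).
by rewrite -normCK ger0_norm ?sqrtC_ge0 ?lecR// sqrtCK.
Qed.

Lemma expect_sum (T J : finType) (w : T -> C) (c : J -> C) (M : J -> op R T T) :
  expect w (opsum (enum J) (fun j => opscale (c j) (M j))) =
  \sum_j c j * expect w (M j).
Proof.
rewrite /expect /opsum /opscale.
transitivity (\sum_x \sum_j \sum_y c j * ((w x)^* * M j x y * w y)).
  apply: eq_bigr => x _; rewrite exchange_big; apply: eq_bigr => y _ /=.
  rewrite big_enum /= mulr_sumr mulr_suml; apply: eq_bigr => j _.
  by rewrite conjcE; ring.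
rewrite exchange_big; apply: eq_bigr => j _ /=.
by rewrite mulr_sumr; apply: eq_bigr => x _; rewrite mulr_sumr.
Qed.

Lemma quad_gram (T L : finType) (u : T -> C) (g : L -> T -> C) :
  \sum_l `|ip u (g l)| ^+ 2 =
  \sum_x \sum_y (u x)^* * u y * \sum_l g l x * (g l y)^*.
Proof.
transitivity (\sum_x \sum_y \sum_l (u x)^* * g l x * ((g l y)^* * u y)).
  under [RHS]eq_bigr do rewrite exchange_big.
  rewrite [RHS]exchange_big; apply: eq_bigr => l _ /=.
  rewrite normCK ipC /ip mulr_suml; apply: eq_bigr => x _.
  by rewrite mulr_sumr.
apply: eq_bigr => x _; apply: eq_bigr => y _; rewrite mulr_sumr.
by apply: eq_bigr => l _; ring.
Qed.

Lemma protocol_fid (dC dQ dE : nat) (eps : R) :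
  protocol p phi n dC dQ dE eps ->
  exists (Dec : 'I_dC -> seq (B -> 'I_dQ * 'I_dE -> C))
    (v : seqidx m n -> 'I_dC -> A * ('I_dQ * 'I_dE) -> A -> 'I_dQ * 'I_dE -> C),
  [/\ forall j, trace_preserving (Dec j),
    forall i, \sum_j \sum_l \sum_a sqnorm (v i j l a) = 1,
    forall i (u : 'I_dE -> C), \sum_j \sum_l \sum_a \sum_x1
      `|ip u (fun x2 => v i j l a (x1, x2))| ^+ 2 = sqnorm u / #|'I_dE|%:R &
    1 - eps <= cre (\sum_ii prN p ii * kraus_fid Dec v ii (phiN phi ii))].
Proof.
move=> [_ [_ [_ [Enc [q [rho [Dec [EncP [qP [rhoP [rhoE [DecP le_F]]]]]]]]]]]].
have [g gE] : exists g : seqidx m n * 'I_dC ->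
    A * ('I_dQ * 'I_dE) -> A * ('I_dQ * 'I_dE) -> C,
    forall ij x y, rho ij.1 ij.2 x y = \sum_l g ij l x * (g ij l y)^*.
  have h (ij : seqidx m n * 'I_dC) :
      exists h : A * ('I_dQ * 'I_dE) -> A * ('I_dQ * 'I_dE) -> C,
      forall x y, rho ij.1 ij.2 x y = \sum_l h l x * (h l y)^*.
    by have [rho_psd _] := rhoP ij.1 ij.2; exact: psd_gram rho_psd.
  exact: (fin_all_exists h).
(* The probability of the message [j] is absorbed into the vectors as a square root. *)
pose v i j l a x := sqrtC (q i j)%:C%C * g (i, j) l (a, x).
have qE i j : sqrtC (q i j)%:C%C * (sqrtC (q i j)%:C%C)^* = (q i j)%:C%C.
  by rewrite -normCK ger0_norm ?sqrtCK// sqrtC_ge0 lecR; case: (qP i).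
have vE i j x y : \sum_l v i j l x.1 x.2 * (v i j l y.1 y.2)^* =
    (q i j)%:C%C * rho i j x y.
  rewrite (gE (i, j)) mulr_sumr; apply: eq_bigr => l _.
  by rewrite /v rmorphM /= mulrACA qE; case: x; case: y.
exists Dec, v; split.
- by move=> j; apply: cptp_tp.
- move=> i; transitivity (\sum_j (q i j)%:C%C * optrace (rho i j)).
    apply: eq_bigr => j _; rewrite /optrace mulr_sumr.
    under [RHS]eq_bigr do rewrite -vE.
    rewrite [RHS]exchange_big; apply: eq_bigr => l _ /=.
    rewrite /sqnorm pair_bigA /=; apply: eq_bigr => x _; by rewrite normCK.
  transitivity (\sum_j (q i j)%:C%C : C).
    by apply: eq_bigr => j _; case: (rhoP i j) => _ ->; rewrite mulr1.
  by rewrite -rmorph_sum; case: (qP i) => _ ->.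
- move=> i u.
  transitivity (\sum_x2 \sum_x2' (u x2)^* * u x2' *
      \sum_j \sum_l \sum_a \sum_x1 v i j l a (x1, x2) * (v i j l a (x1, x2'))^*).
    rewrite !pair_bigA /= (quad_gram u (fun z x2 =>
      v i z.1.1.1 z.1.1.2 z.1.2 (z.2, x2))) pair_bigA.
    by apply: eq_bigr => x2 _; rewrite !pair_bigA.
  (* Only the diagonal blocks in [j] enter, and there the prescribed output form turns back into
     Kraus operators; their completeness leaves the maximally mixed marginal. *)
  have margE x2 x2' : \sum_j \sum_l \sum_a \sum_x1
      v i j l a (x1, x2) * (v i j l a (x1, x2'))^* =
      dE%:R^-1 * (x2 == x2')%:R.
    rewrite eq_sym -(cptp_tp (EncP i)).
    transitivity (\sum_(u : (A * 'I_dQ) * 'I_dC) dE%:R^-1 *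
       \sum_(K <- Enc i) K u x2 * (K u x2')^*).
      rewrite [RHS](eq_bigr (fun u => dE%:R^-1 *
         \sum_(K <- Enc i) K (u.1, u.2) x2 * (K (u.1, u.2) x2')^*)); last by case.
      rewrite -(pair_bigA _ (fun ax j => dE%:R^-1 *
         \sum_(K <- Enc i) K (ax, j) x2 * (K (ax, j) x2')^*)) [RHS]exchange_big.
      apply: eq_bigr => j _ /=.
      rewrite [RHS](eq_bigr (fun ax => dE%:R^-1 *
         \sum_(K <- Enc i) K (ax.1, ax.2, j) x2 * (K (ax.1, ax.2, j) x2')^*));
        last by case.
      rewrite -(pair_bigA _ (fun a x1 => dE%:R^-1 *
         \sum_(K <- Enc i) K (a, x1, j) x2 * (K (a, x1, j) x2')^*)) [LHS]exchange_big.
      apply: eq_bigr => a _; rewrite [LHS]exchange_big; apply: eq_bigr => x1 _ /=.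
      rewrite -kraus_maxent rhoE /= eqxx mulr1.
      exact: (vE i j (a, (x1, x2)) (a, (x1, x2'))).
    rewrite -mulr_sumr exchange_big; congr (_ * _); apply: eq_bigr => K _.
    by apply: eq_bigr => z _; rewrite mulrC.
  rewrite card_ord mulrC /sqnorm mulr_sumr; apply: eq_bigr => x2 _.
  rewrite (bigD1 x2)//= [X in _ + X]big1 ?addr0.
    by rewrite margE eqxx mulr1 normCK; ring.
  by move=> y yx; rewrite margE eq_sym (negPf yx) !mulr0.
apply: le_trans le_F _; rewrite cre_sum le_eqVlt; apply/orP; left; apply/eqP.
apply: eq_bigr => ii _; rewrite creZ; congr (_ * cre _).
rewrite expect_sum /kraus_fid; apply: eq_bigr => j _.
have -> : rho ii j = gram [seq g (ii, j) l | l <- enum {: A * ('I_dQ * 'I_dE)}].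
  apply/funext => x; apply/funext => y.
  by rewrite (gE (ii, j)) /gram big_map big_enum.
rewrite expect_kraus big_map mulr_sumr; apply: eq_bigr => K _.
rewrite big_map big_enum mulr_sumr; apply: eq_bigr => l _ /=.
rewrite ip_kron_l -qE -normCK -exprMn -normrM; congr (`|_| ^+ 2).
rewrite mulr_sumr; apply: eq_bigr => a _; rewrite !ip_app mulr_sumr.
by apply: eq_bigr => x _; rewrite /v; ring.
Qed.

Lemma fid_protocol (dQ dE : nat) (eps : R)
    (Dec : seq (B -> 'I_dQ * 'I_dE -> C))
    (Enc : seqidx m n -> seq (A * 'I_dQ -> 'I_dE -> C)) :
  (0 < dQ)%N -> (0 < dE)%N -> trace_preserving Dec -> (forall ii, trace_preserving (Enc ii)) ->
  1 - eps <= cre (\sum_ii prN p ii * \sum_(K <- Dec) \sum_(W <- Enc ii)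
    `|\sum_a ip (phiN phi ii a)
       (op_app K (fun x => (sqrtC #|'I_dE|%:R)^-1 * W (a, x.1) x.2))| ^+ 2) ->
  protocol p phi n 1 dQ dE eps.
Proof.
move=> dQ0 dE0 DecP EncP le_F; split; first by [].
split; first by []; split; first by [].
have dEn0 : dE%:R != 0 :> C by rewrite pnatr_eq0 -lt0n.
pose lift (W : A * 'I_dQ -> 'I_dE -> C) : op R ((A * 'I_dQ) * 'I_1)%type 'I_dE :=
  fun u x => W u.1 x.
pose out (W : A * 'I_dQ -> 'I_dE -> C) (s : A * ('I_dQ * 'I_dE)) : C :=
  (sqrtC dE%:R)^-1 * W (s.1, s.2.1) s.2.2.
have outE W s s' : out W s * (out W s')^* =
    dE%:R^-1 * (W (s.1, s.2.1) s.2.2 * (W (s'.1, s'.2.1) s'.2.2)^*).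
  rewrite /out rmorphM /= mulrACA; congr (_ * _).
  by rewrite -normCK ger0_norm ?invr_ge0 ?sqrtC_ge0// exprVn sqrtCK.
exists (fun ii => [seq lift W | W <- Enc ii]), (fun _ _ => 1).
exists (fun ii _ => gram [seq out W | W <- Enc ii]), (fun _ => Dec).
split; [|split; [|split; [|split; [|split]]]].
- move=> ii; apply: tp_cptp => x y; rewrite -(EncP ii) big_map.
  apply: eq_bigr => W _.
  rewrite (eq_bigr (fun u => (W u.1 x)^* * W u.1 y))//.
  rewrite -(pair_bigA _ (fun ax (_ : 'I_1) => (W ax x)^* * W ax y))/=.
  by apply: eq_bigr => ax _; rewrite big_ord1.
- by move=> ii; split => //; rewrite big_ord1.
- move=> ii _; split; first split.
  + move=> x y; rewrite /gram conjcE rmorph_sum; apply: eq_bigr => g _.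
    by rewrite rmorphM /= conjCK mulrC.
  + move=> w; rewrite expect_gram; apply: sumr_ge0 => g _.
    by rewrite exprn_ge0.
  + rewrite /optrace /gram; under eq_bigr do rewrite big_map.
    transitivity (\sum_a \sum_x1 \sum_x2 dE%:R^-1 * \sum_(W <- Enc ii)
        (W (a, x1) x2)^* * W (a, x1) x2).
      transitivity (\sum_a \sum_(x : 'I_dQ * 'I_dE) dE%:R^-1 * \sum_(W <- Enc ii)
        (W (a, x.1) x.2)^* * W (a, x.1) x.2).
        rewrite pair_bigA; apply: eq_bigr => s _; rewrite mulr_sumr.
        by apply: eq_bigr => W _; rewrite outE [X in _ * X]mulrC.
      apply: eq_bigr => a _.
      by rewrite (pair_bigA _ (fun x1 x2 => dE%:R^-1 * \sum_(W <- Enc ii)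
        (W (a, x1) x2)^* * W (a, x1) x2)).
    transitivity (\sum_(x2 < dE) (dE%:R^-1 : C)).
      rewrite pair_bigA exchange_big; apply: eq_bigr => x2 _ /=.
      rewrite -mulr_sumr -[RHS]mulr1; congr (_ * _).
      have := EncP ii x2 x2; rewrite eqxx mulr1n => <-.
      rewrite exchange_big; apply: eq_bigr => W _ /=.
      by apply: eq_bigr => -[].
    by rewrite sumr_const card_ord -[LHS]mulr_natl divff.
- move=> ii; apply/funext => -[[[a x1] j] x2]; apply/funext => -[[[a' y1] j'] y2].
  rewrite kraus_maxent /= (ord1 j) (ord1 j') eqxx mulr1 mul1r /gram !big_map.
  by rewrite mulr_sumr; apply: eq_bigr => W _; rewrite outE.
- by move=> _; exact: tp_cptp.
apply: le_trans le_F _; rewrite cre_sum le_eqVlt; apply/orP; left; apply/eqP.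
apply: eq_bigr => ii _; rewrite creZ; congr (_ * cre _).
rewrite expect_sum big_ord1 mul1r expect_kraus big_map.
apply: eq_bigr => K _; rewrite big_map; apply: eq_bigr => W _.
by rewrite ip_kron_l card_ord.
Qed.

End Protocol.

(** * Asymptotics *)

Section Bounds.
Variables (R : realType) (TA TB : finType) (m : nat) (p : 'I_m -> R).
Variable phi : 'I_m -> vec R (TA * TB)%type.
Hypothesis hp : distr p.
Hypothesis hphi : forall i, unit_vec (phi i).
Local Notation C := R[i].
Variables (e : TB -> TB -> C) (r : TB -> R).
Variables (f : 'I_m -> TB -> TB -> C) (s : 'I_m -> TB -> R).
Hypothesis eP : onb e.
Hypothesis r0 : forall k, 0 <= r k.
Hypothesis rE : forall x y, ensB_state p phi x y =
  \sum_k (r k)%:C%C * (e k x * (e k y)^*).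
Hypothesis fP : forall i, onb (f i).
Hypothesis s0 : forall i k, 0 <= s i k.
Hypothesis sE : forall i x y, ptraceA (Defs.proj (phi i)) x y =
  \sum_k (s i k)%:C%C * (f i k x * (f i k y)^*).
Let mu := \sum_k r k * - ln (r k).
Let nu := \sum_i p i * \sum_k s i k * - ln (s i k).

Section Block.
Variables (n : nat) (t : R).
Hypothesis n_gt0 : (0 < n)%N.
Hypothesis t_gt0 : 0 < t.
Local Notation V := (varN p r s t).
Local Notation phn := (@phiN R TA TB m phi n).
Local Notation en := (@basN R TB e n).
Local Notation fn := (@cbasN R TB m f n).
Local Notation T := (@typN R TB r n t).
Local Notation Ti := (@ctypN R TB m p s n t).
Local Notation truncated := (trunc phn en T fn Ti).

Lemma trunc_errorN : \sum_(ii : seqidx m n) prN p ii *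
    \sum_a sqnorm (fun b => phn ii a b - truncated ii a b) <=
  (2 * (V / n%:R))%:C%C.
Proof.
apply: le_trans (trunc_error T Ti (prN_ge0 hp (n := n)) (basN_onb eP n)
  (cbasN_onb fP (n := n)) (avg_quadN rE sE (n := n)) (quadN sE (n := n))) _.
rewrite -mulrDr rmorphM /= rmorph_nat ler_wpM2l//.
exact: (atypN hp hphi eP r0 rE fP s0 sE n_gt0 t_gt0).
Qed.

Section ConverseBlock.
Variables (dC dQ dE : nat) (eps : R).
Hypothesis prot : protocol p phi n dC dQ dE eps.

(** The passage to truncated targets costs a factor 2 and twice the truncation error, itself at most
    [2 * V / n]; hence the constants 2 and 4. *)
Lemma fid_avg_le (b : R)
    (Dec : 'I_dC -> seq (Bn TB n -> 'I_dQ * 'I_dE -> C))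
    (v : seqidx m n -> 'I_dC -> An TA n * ('I_dQ * 'I_dE) -> An TA n ->
      'I_dQ * 'I_dE -> C) :
  (forall j, trace_preserving (Dec j)) ->
  (forall i, \sum_j \sum_l \sum_a sqnorm (v i j l a) = 1) ->
  \sum_ii prN p ii * kraus_fid Dec v ii (truncated ii) <= b%:C%C ->
  cre (\sum_ii prN p ii * kraus_fid Dec v ii (phn ii)) <= 2 * b + 4 * V / n%:R.
Proof.
move=> DecP v1 le_b; apply: (@cre_le _ _ (2 * b + 4 * V / n%:R)%:C%C).
apply: (@le_trans _ _ (2 * (\sum_ii prN p ii * kraus_fid Dec v ii (truncated ii)) +
  2 * (\sum_ii prN p ii *
    \sum_a sqnorm (fun b => phn ii a b - truncated ii a b)))).
  rewrite !mulr_sumr -big_split; apply: ler_sum => ii _ /=.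
  rewrite !(mulrCA 2) -mulrDr ler_wpM2l ?(prN_ge0 hp)//.
  exact: fid_trunc.
have -> : (2 * b + 4 * V / n%:R)%:C%C = 2 * b%:C%C + 2 * (2 * (V / n%:R))%:C%C :> C.
  rewrite -(real_complex_nat R 2) -!real_complexM -(rmorphD (real_complex R)).
  by congr (_%:C%C); rewrite /=; ring.
by rewrite lerD// ler_wpM2l// trunc_errorN.
Qed.

Lemma converse_dim : 1 - eps <=
  2 * (expR (- (n%:R * (mu - t))) * (dC * (dQ * dE))%N%:R) + 4 * V / n%:R.
Proof.
have [Dec [v [DecP v1 marg le_F]]] := protocol_fid prot.
apply: le_trans le_F _; apply: fid_avg_le => //.
have exp0 : 0 <= (expR (- (n%:R * (mu - t))))%:C%C :> C by rewrite lecR expR_ge0.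
apply: le_trans (fid_trunc_dim Ti (prN_ge0 hp (n := n)) (basN_onb eP n)
  (cbasN_onb fP (n := n)) (cwtN_ge0 s0 (n := n)) (avg_quadN rE sE (n := n))
  (quadN sE (n := n)) exp0 (@wtN_le _ _ r n t) DecP v1) _.
by rewrite real_complexM real_complex_nat card_prod !card_ord.
Qed.

Lemma converse_dense : 1 - eps <=
  2 * (expR (- (n%:R * (mu - t))) * expR (n%:R * (nu + t)) *
    (dC * dQ ^ 2)%N%:R) + 4 * V / n%:R.
Proof.
have dE0 : (0 < #|'I_dE|)%N by case: prot => _ [_ [dE0 _]]; rewrite card_ord.
have [Dec [v [DecP v1 marg le_F]]] := protocol_fid prot.
apply: le_trans le_F _; apply: fid_avg_le => //.
have exp0 : 0 <= (expR (- (n%:R * (mu - t))))%:C%C :> C by rewrite lecR expR_ge0.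
have exp1 : 0 < (expR (- (n%:R * (nu + t))))%:C%C :> C by rewrite ltcR expR_gt0.
have := fid_trunc_dense (prN_ge0 hp (n := n)) (basN_onb eP n)
  (cbasN_onb fP (n := n)) (cwtN_ge0 s0 (n := n)) (avg_quadN rE sE (n := n))
  (quadN sE (n := n)) (phiN1 hphi (n := n)) exp0
  (@wtN_le _ _ r n t) DecP (ltW exp1) (@cwtN_ge _ _ _ p s n t) marg dE0.
rewrite mulrC -ler_pdivlMr// => /le_trans; apply.
rewrite -real_complex_nat -(fmorphV (real_complex R)) -!real_complexM lecR.
by rewrite !card_ord -expRN opprK mulrAC.
Qed.
End ConverseBlock.

(** The 6 is the factor 3 of the one-shot bound times the 2 in the truncation error; [ab] only
    supplies default basis vectors. *)
Lemma direct_protocol (ab : TA * TB) (d1 d2 : nat) (h eps : R) : 0 < h ->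
  expR (n%:R * (mu + t)) <= (3 ^ d1.+1 * 3 ^ d2)%N%:R ->
  3 * h + 6 * (h^-1 * (V / n%:R)) +
    (3 ^ d2)%N%:R * (1 + 2 * (3 ^ d2)%N%:R) / ((3 ^ d1.+1 * 3 ^ d2)%N%:R - 1) *
    expR (- (n%:R * (nu - t))) <= eps ->
  protocol p phi n 1 (3 ^ d1.+1) (3 ^ d2) eps.
Proof.
move=> h0 T_le le_eps.
have exp0 : 0 <= (expR (- (n%:R * (nu - t))))%:C%C :> C by rewrite lecR expR_ge0.
have T_card : (#|T| <= #|'I_(3 ^ d1.+1)| * #|'I_(3 ^ d2)|)%N.
  rewrite !card_ord -(ler_nat R); apply: le_trans T_le.
  exact: (typN_card hp hphi eP r0 rE n t).
have [Dec [Enc [DecP EncP le_F]]] := direct (prN_ge0 hp (n := n))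
  (prN_sum hp n) (basN_onb eP n) (cbasN_onb fP (n := n)) (quadN sE (n := n))
  (phiN1 hphi (n := n)) exp0 (@cwtN_le _ _ _ p s n t) (card_ord _) (card_ord _)
  T_card [ffun=> ab.1] [ffun=> ab.2].
apply: (fid_protocol _ _ DecP EncP); rewrite ?expn_gt0//.
have hC0 : 0 < h%:C%C :> C by rewrite ltcR.
apply: (@cre_le _ (1 - eps)%:C%C); apply: le_trans (le_F _ hC0).
rewrite card_prod !card_ord.
set err := \sum_i _.
have err_le : err <= (2 * (V / n%:R))%:C%C by exact: trunc_errorN.
apply: (@le_trans _ _ (1 - 3 * h%:C%C - 3 * (h%:C%C^-1 * (2 * (V / n%:R))%:C%C) -
   (3 ^ d2)%N%:R * (1 + 2 * (3 ^ d2)%N%:R) / ((3 ^ d1.+1 * 3 ^ d2)%N%:R - 1) *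
    (expR (- (n%:R * (nu - t))))%:C%C)); last first.
  by rewrite lerB// lerB// ler_wpM2l// ler_wpM2l// invr_ge0 ltW.
apply: (@le_trans _ _ (1 - 3 * h - 3 * (h^-1 * (2 * (V / n%:R))) -
   (3 ^ d2)%N%:R * (1 + 2 * (3 ^ d2)%N%:R) / ((3 ^ d1.+1 * 3 ^ d2)%N%:R - 1) *
    expR (- (n%:R * (nu - t))))%:C%C).
  rewrite lecR; apply: le_trans (_ : 1 - (3 * h + 6 * (h^-1 * (V / n%:R)) +
    (3 ^ d2)%N%:R * (1 + 2 * (3 ^ d2)%N%:R) / ((3 ^ d1.+1 * 3 ^ d2)%N%:R - 1) *
    expR (- (n%:R * (nu - t)))) <= _); first by rewrite lerB.
  by rewrite le_eqVlt; apply/orP; left; apply/eqP; ring.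
by rewrite !(real_complexB, real_complexD, real_complexM, real_complexV,
  real_complex_nat).
Qed.

End Block.
End Bounds.

(** * Exponential and rounding estimates *)

Section Rates.
Variable R : realType.

Lemma ln2_gt0 : 0 < ln 2 :> R.
Proof. by rewrite ln_gt0// ltr1n. Qed.

Lemma log2_rate (d n : nat) (x : R) : (0 < d)%N -> (0 < n)%N ->
  (log2 d%:R / n%:R <= x) = (d%:R <= expR (n%:R * (x * ln 2))).
Proof.
move=> d0 n0; have n0' : 0 < n%:R :> R by rewrite ltr0n.
rewrite -[d%:R in RHS]lnK ?posrE ?ltr0n// ler_expR /log2.
by rewrite ler_pdivrMr// ler_pdivrMr ?ln2_gt0// mulrAC mulrC mulrA.
Qed.

Lemma expRN_le (x : R) : 0 < x -> expR (- x) <= x^-1.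
Proof.
move=> x0; rewrite expRN lef_pV2 ?posrE ?expR_gt0//.
by apply: le_trans (expR_ge1Dx x); rewrite lerDr.
Qed.

Lemma large_nat (x : R) : exists N : nat, forall n, (N < n)%N -> x < n%:R.
Proof.
exists (Num.bound `|x|) => n ltn.
apply: le_lt_trans (ler_norm x) _.
by apply: lt_trans (archi_boundP (normr_ge0 x)) _; rewrite ltr_nat.
Qed.

Lemma exp_decay (c K b : R) : 0 < c -> 0 < b -> exists N : nat, forall n,
  (N < n)%N -> 2 * expR (- (n%:R * c)) + K / n%:R < b.
Proof.
move=> c0 b0; have [N NP] := large_nat ((2 / c + K) / b).
exists N => n ltn; have n0 : 0 < n%:R :> R by rewrite ltr0n; apply: leq_ltn_trans ltn.
have := NP n ltn; rewrite ltr_pdivrMr// => lt_n.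
have le_e : expR (- (n%:R * c)) <= (n%:R * c)^-1 by rewrite expRN_le ?mulr_gt0.
apply: (@le_lt_trans _ _ ((2 / c + K) / n%:R)).
  rewrite [leRHS]mulrDl lerD2r; apply: le_trans (ler_wpM2l _ le_e) _ => //.
  by rewrite invfM; lra.
by rewrite ltr_pdivrMr// [ltRHS]mulrC.
Qed.

End Rates.

(** The first exponent is rounded up and the second down, each within one factor 3. The successor
    keeps the quantum register of dimension at least 3. *)
Lemma ternary_sizes (R : realType) (A B l : R) : 0 <= A -> 0 <= B ->
  l = ln 3 -> exists d1 d2 : nat,
  [/\ A <= d1.+1%:R * l, d1.+1%:R * l <= A + l, d2%:R * l <= B &
      B <= d2%:R * l + l].
Proof.
move=> A0 B0 lE; have l0 : 0 < l by rewrite lE ln_gt0// ltr1n.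
exists (Num.truncn (A / l)), (Num.truncn (B / l)).
have /andP[h1 h2] := truncn_itv (divr_ge0 A0 (ltW l0)).
have /andP[h3 h4] := truncn_itv (divr_ge0 B0 (ltW l0)).
move: h1 h2 h3 h4; rewrite !ler_pdivlMr// !ltr_pdivrMr// => h1 h2 h3 h4.
split => //; first exact: ltW.
  by rewrite -natr1 mulrDl mul1r lerD2r.
by move: h4; rewrite -natr1 mulrDl mul1r => /ltW.
Qed.

Lemma expn3E (R : realType) (d : nat) : (3 ^ d)%N%:R = expR (d%:R * ln 3) :> R.
Proof. by rewrite expRM_natl lnK ?posrE ?ltr0n// natrX. Qed.

(** From [1 + 2 * Y <= 3 * Y] and $XY-1\ge\frac23XY$ the prefactor is at most $\frac92\,Y/X$. *)
Lemma gap_le (R : realType) (X Y z w : R) : 3 <= X -> 1 <= Y -> 0 <= z ->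
  Y * z <= X * w -> Y * (1 + 2 * Y) / (X * Y - 1) * z <= 9 / 2 * w.
Proof.
move=> X3 Y1 z0 le_w; have XY : 3 <= X * Y by nra.
have XY1 : 0 < X * Y - 1 by lra.
have w0 : 0 <= w by nra.
rewrite mulrAC ler_pdivrMr//.
have h1 : Y * (1 + 2 * Y) * z <= 3 * Y * (X * w).
  apply: (@le_trans _ _ (3 * Y * (Y * z))); last by rewrite ler_wpM2l//; lra.
  rewrite -subr_ge0; have -> : 3 * Y * (Y * z) - Y * (1 + 2 * Y) * z =
    Y * z * (Y - 1) by ring.
  by rewrite !mulr_ge0//; lra.
apply: le_trans h1 _.
have -> : 3 * Y * (X * w) = 3 * (X * Y) * w by ring.
have -> : 9 / 2 * w * (X * Y - 1) = 9 / 2 * (X * Y - 1) * w by ring.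
by rewrite ler_wpM2r//; lra.
Qed.

(** * Achievable rates and their converses *)

Section Rate.
Variables (R : realType) (TA TB : finType) (m : nat) (p : 'I_m -> R).
Variable phi : 'I_m -> vec R (TA * TB)%type.
Hypothesis hp : distr p.
Hypothesis hphi : forall i, unit_vec (phi i).
Local Notation C := R[i].

Lemma psd_cond i : psd (ptraceA (Defs.proj (phi i))).
Proof.
split=> [x y|w].
  rewrite /ptraceA conjcE rmorph_sum; apply: eq_bigr => a _.
  by rewrite /Defs.proj !conjcE rmorphM /= conjCK mulrC.
have -> : ptraceA (Defs.proj (phi i)) =
    gram [seq (fun b => phi i (a, b)) | a <- enum TA].
  by apply/funext => x; apply/funext => y; rewrite /gram big_map big_enum.
by rewrite expect_gram sumr_ge0// => g _; rewrite exprn_ge0.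
Qed.

Lemma psd_ens : psd (ensB_state p phi).
Proof.
have [p0 _] := hp; split=> [x y|w].
  rewrite /ensB_state conjcE rmorph_sum; apply: eq_bigr => i _.
  rewrite rmorphM /=; congr (_ * _); last by case: (psd_cond i).
  by rewrite -conjcE conjc_real.
have -> : ensB_state p phi = opsum (enum 'I_m) (fun i =>
    opscale (p i)%:C%C (ptraceA (Defs.proj (phi i)))).
  apply/funext => x; apply/funext => y.
  by rewrite /opsum /opscale big_enum.
rewrite expect_sum; apply: sumr_ge0 => i _.
by rewrite mulr_ge0 ?lecR//; case: (psd_cond i).
Qed.

Lemma entropy_ge0 (T : finType) (A : op R T T) :
  psd A -> optrace A = 1 -> 0 <= vN_entropy A.
Proof.
move=> /vN_spectral[g [r [gP r0 AE ->]]]; rewrite /optrace (spectral_tr gP AE).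
rewrite -rmorph_sum => /(congr1 (@cre R)) /= r1.
apply: sumr_ge0 => k _; rewrite -(pmulr_lge0 _ (ln2_gt0 R)) eta_ln//.
rewrite mulr_ge0// oppr_ge0 ln_le0//.
by rewrite -r1 (bigD1 k)//= lerDl sumr_ge0.
Qed.

Let S := S_EB p phi.
Let Sbar := \sum_(i < m) p i * vN_entropy (ptraceA (Defs.proj (phi i))).

Lemma spectral_data : exists (e : TB -> TB -> C) (r : TB -> R)
    (f : 'I_m -> TB -> TB -> C) (s : 'I_m -> TB -> R),
  [/\ [/\ onb e, forall k, 0 <= r k & forall x y, ensB_state p phi x y =
        \sum_k (r k)%:C%C * (e k x * (e k y)^*)],
      [/\ forall i, onb (f i), forall i k, 0 <= s i k &
        forall i x y, ptraceA (Defs.proj (phi i)) x y =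
        \sum_k (s i k)%:C%C * (f i k x * (f i k y)^*)],
      \sum_k r k * - ln (r k) = S * ln 2 &
      \sum_i p i * \sum_k s i k * - ln (s i k) = Sbar * ln 2].
Proof.
have [e [r [eP r0 rE SE]]] := vN_spectral psd_ens.
have h i : exists fs : (TB -> TB -> C) * (TB -> R), [/\ onb fs.1,
    forall k, 0 <= fs.2 k,
    forall x y, ptraceA (Defs.proj (phi i)) x y =
      \sum_k (fs.2 k)%:C%C * (fs.1 k x * (fs.1 k y)^*) &
    vN_entropy (ptraceA (Defs.proj (phi i))) = \sum_k Defs.eta (fs.2 k)].
  by have [f [s fsP]] := vN_spectral (psd_cond i); exists (f, s).
have [fs fsP] := fin_all_exists h.
exists e, r, (fun i => (fs i).1), (fun i => (fs i).2); split.
- by [].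
- by split => i *; case: (fsP i).
- by rewrite /S /S_EB SE mulr_suml; apply: eq_bigr => k _; rewrite eta_ln.
- rewrite /Sbar mulr_suml; apply: eq_bigr => i _; rewrite -mulrA.
  case: (fsP i) => _ s0 _ ->; congr (_ * _); rewrite mulr_suml.
  by apply: eq_bigr => k _; rewrite eta_ln.
Qed.

Lemma S_ge0 : 0 <= S.
Proof.
have [e [r [f [s [[eP r0 rE] [fP s0 sE] _ _]]]]] := spectral_data.
apply: (entropy_ge0 psd_ens).
by rewrite /optrace (spectral_tr eP rE) -rmorph_sum (r_sum hp hphi eP rE).
Qed.

Lemma Sbar_ge0 : 0 <= Sbar.
Proof.
have [p0 _] := hp; apply: sumr_ge0 => i _; rewrite mulr_ge0//.
apply: (entropy_ge0 (psd_cond i)); exact: tr_cond.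
Qed.

Lemma achievable_dim (Q E : R) : achievable p phi 0 Q E -> S <= Q + E.
Proof.
move=> [_ [_ [_ ach]]]; rewrite leNgt; apply/negP => ltS.
have [e [r [f [s [[eP r0 rE] [fP s0 sE] muE nuE]]]]] := spectral_data.
have L0 := ln2_gt0 R; set L := ln 2 in L0 muE nuE.
pose g := S - Q - E; have g0 : 0 < g by rewrite /g; lra.
(* Of the gap [g], one half goes to the three rate slacks and one sixth to typicality; the exponent
   [g * L / 3] remains, against a fidelity of 3/4. *)
have d0 : 0 < g / 6 by lra.
have t0 : 0 < g * L / 6 by rewrite divr_gt0 ?mulr_gt0.
have c0 : 0 < g * L / 3 by rewrite divr_gt0 ?mulr_gt0.
have [N NP] := ach (g / 6) 4^-1 d0 ltac:(lra).
have [N' N'P] := exp_decay (4 * varN p r s (g * L / 6)) c0 (ltac:(lra) : 0 < 3 / 4 :> R).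
pose n := (maxn N N').+1.
have n0 : (0 < n)%N by [].
have [dC [dQ [dE [prot [rC [rQ rE']]]]]] := NP n (leq_maxl _ _).
have := N'P n (leq_maxr _ _).
have [dC0 [dQ0 [dE0 _]]] := prot.
move: rC rQ rE'; rewrite !log2_rate// -/L => rC rQ rE'.
have := converse_dim hp hphi eP r0 rE fP s0 sE n0 t0 prot; rewrite muE.
set V4 := 4 * _ / _; set X := (dC * _)%N%:R => le1 lt1.
suff : expR (- (n%:R * (S * L - g * L / 6))) * X <= expR (- (n%:R * (g * L / 3))).
  by move: le1 lt1; lra.
rewrite /X !natrM.
apply: (@le_trans _ _ (expR (- (n%:R * (S * L - g * L / 6))) *
  (expR (n%:R * ((0 + g / 6) * L)) * (expR (n%:R * ((Q + g / 6) * L)) *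
   expR (n%:R * ((E + g / 6) * L)))))).
  by rewrite ler_wpM2l ?expR_ge0// !ler_pM ?mulr_ge0.
rewrite -!expRD ler_expR le_eqVlt; apply/orP; left; apply/eqP.
by rewrite /g; field.
Qed.

Lemma achievable_dense (Q E : R) : achievable p phi 0 Q E ->
  (S - Sbar) / 2 <= Q.
Proof.
move=> [_ [_ [_ ach]]]; rewrite leNgt; apply/negP => ltS.
have [e [r [f [s [[eP r0 rE] [fP s0 sE] muE nuE]]]]] := spectral_data.
have L0 := ln2_gt0 R; set L := ln 2 in L0 muE nuE.
pose g := S - Sbar - 2 * Q; have g0 : 0 < g by rewrite /g; lra.
(* One third of [g] pays for $d_C$ and twice for $d_Q$, another third for both typicality slacks;
   one third remains as decay. *)
have d0 : 0 < g / 9 by lra.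
have t0 : 0 < g * L / 6 by rewrite divr_gt0 ?mulr_gt0.
have c0 : 0 < g * L / 3 by rewrite divr_gt0 ?mulr_gt0.
have [N NP] := ach (g / 9) 4^-1 d0 ltac:(lra).
have [N' N'P] := exp_decay (4 * varN p r s (g * L / 6)) c0 (ltac:(lra) : 0 < 3 / 4 :> R).
pose n := (maxn N N').+1.
have n0 : (0 < n)%N by [].
have [dC [dQ [dE [prot [rC [rQ _]]]]]] := NP n (leq_maxl _ _).
have := N'P n (leq_maxr _ _).
have [dC0 [dQ0 [dE0 _]]] := prot.
move: rC rQ; rewrite !log2_rate// -/L => rC rQ.
have := converse_dense hp hphi eP r0 rE fP s0 sE n0 t0 prot; rewrite muE nuE.
set V4 := 4 * _ / _; set X := (dC * _)%N%:R => le1 lt1.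
suff : expR (- (n%:R * (S * L - g * L / 6))) * expR (n%:R * (Sbar * L + g * L / 6))
    * X <= expR (- (n%:R * (g * L / 3))).
  by move: le1 lt1; lra.
rewrite /X natrM natrX expr2.
apply: (@le_trans _ _ (expR (- (n%:R * (S * L - g * L / 6))) *
  expR (n%:R * (Sbar * L + g * L / 6)) *
  (expR (n%:R * ((0 + g / 9) * L)) * (expR (n%:R * ((Q + g / 9) * L)) *
   expR (n%:R * ((Q + g / 9) * L)))))).
  by rewrite ler_wpM2l ?mulr_ge0 ?expR_ge0// !ler_pM ?mulr_ge0.
rewrite -!expRD ler_expR le_eqVlt; apply/orP; left; apply/eqP.
by rewrite /g; field.
Qed.

Lemma achievable_direct (Q : R) : 0 <= Q -> (S - Sbar) / 2 <= Q ->
  achievable p phi 0 Q (Num.max (S - Q) 0).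
Proof.
move=> Q0 leQ; set E := Num.max _ _.
have E0 : 0 <= E by rewrite le_max lexx orbT.
split => //; split => //; split => // delta eps delta0 eps0.
have [e [r [f [s [[eP r0 rE] [fP s0 sE] muE nuE]]]]] := spectral_data.
have L0 := ln2_gt0 R; set L := ln 2 in L0 muE nuE.
have l0 : 0 < ln 3 :> R by rewrite ln_gt0// ltr1n.
have Sge0 := S_ge0; have Sbarge0 := Sbar_ge0.
pose Q' := S - E.
have [Q'0 Q'Q Q'chi] : [/\ 0 <= Q', Q' <= Q & S - Sbar <= 2 * Q'].
  rewrite /Q' /E; have [h|h] := leP (S - Q) 0; split; lra.
have dL : 0 < delta * L by rewrite mulr_gt0.
pose t := delta * L / 8; have t0 : 0 < t by rewrite divr_gt0.
(* The error is split into thirds: [3 * h], the Chebyshev term and the decoupling gap. The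
   thresholds [N2] and [N3] settle the last two, and [N1] absorbs the rounding by a factor 3. *)
pose V := varN p r s t; pose h := eps / 9; have h0 : 0 < h by rewrite divr_gt0.
have [N1 N1P] := large_nat (ln 3 / (delta * L / 2)).
have [N2 N2P] := large_nat (6 * (h^-1 * V) / (eps / 3)).
have [N3 N3P] := large_nat (18 / (delta * L) / (eps / 3)).
exists (maxn N1 (maxn N2 N3)) => n; rewrite !gtn_max => /and3P[/N1P c1 /N2P c2 /N3P c3].
have n_gt0 : (0 < n)%N.
  rewrite -(ltr_nat R); apply: le_lt_trans c1; rewrite divr_ge0 ?ltW//.
  by rewrite divr_gt0.
have n0 : 0 < n%:R :> R by rewrite ltr0n.
rewrite ltr_pdivrMr ?divr_gt0// in c1.
rewrite ltr_pdivrMr ?divr_gt0// in c2.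
rewrite ltr_pdivrMr ?divr_gt0// in c3.
(* The weights sum to 1, so some index exists, and a unit vector cannot live on an empty basis. *)
have [ab _] : exists ab : TA * TB, ab \in {: TA * TB}.
  apply/existsP; rewrite -[[exists _, _]]negbK; apply/negP => /existsPn no.
  have [_ p1] := hp; have : \sum_(i < m) p i != 0 by rewrite p1 oner_neq0.
  rewrite big1 ?eqxx// => i _; have := hphi i; rewrite /unit_vec big1.
    by move/eqP; rewrite eq_sym oner_eq0.
  by move=> x _; have := no x.
(* The quantum register takes more slack than the entangled one: the sum must beat the typicality
   slack despite rounding, while the difference must make the gap decay at rate [delta * L / 4]. *)
have [] := @ternary_sizes R (n%:R * (Q' * L + delta * L / 2))
  (n%:R * (E * L + delta * L / 8)) (ln 3).
- by rewrite mulr_ge0 ?addr_ge0 ?divr_ge0 ?(ltW dL) ?mulr_ge0 ?(ltW L0).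
- by rewrite mulr_ge0 ?addr_ge0 ?divr_ge0 ?(ltW dL) ?mulr_ge0 ?(ltW L0).
- by [].
move=> d1 [d2 [A1 A2 B1 B2]].
set u := d1.+1%:R * ln 3 in A1 A2; set v := d2%:R * ln 3 in B1 B2.
have SQE : Q' * L + E * L = S * L by rewrite /Q'; ring.
exists 1%N, (3 ^ d1.+1)%N, (3 ^ d2)%N; split; last first.
  rewrite {1}/log2 ln1 !mul0r add0r; split; first exact: ltW.
  rewrite !log2_rate ?expn_gt0// !expn3E !ler_expR -/u -/v -/L; split.
    apply: le_trans A2 _; have : n%:R * (Q' * L) <= n%:R * (Q * L).
      by rewrite ler_pM2l// ler_pM2r.
    move: c1; nra.
  apply: le_trans B1 _; rewrite ler_pM2l//; nra.
apply: (direct_protocol hp hphi eP r0 rE fP s0 sE n_gt0 t0 ab h0).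
  rewrite muE -/L natrM !expn3E -expRD ler_expR -/u -/v /t -SQE.
  nra.
rewrite nuE -/L -/V natrM !expn3E -/u -/v.
set G := _ * expR _.
have le1 : 3 * h = eps / 3 by rewrite /h; field.
have le2 : 6 * (h^-1 * (V / n%:R)) <= eps / 3.
  rewrite [leLHS](_ : _ = 6 * (h^-1 * V) / n%:R); last by ring.
  by rewrite ler_pdivrMr// [leRHS]mulrC ltW.
suff le3 : G <= eps / 3 by rewrite le1; lra.
apply: (@le_trans _ _ (9 / 2 * (n%:R * (delta * L / 4))^-1)); last first.
  rewrite [leLHS](_ : _ = 18 / (delta * L) / n%:R).
    by rewrite ler_pdivrMr// [leRHS]mulrC ltW.
  by field; rewrite !gt_eqF.
rewrite {}/G; apply: gap_le.
- rewrite /u -expn3E; by rewrite ler_nat expnS leq_pmulr// expn_gt0.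
- by rewrite /v -expn3E ler1n expn_gt0.
- exact: expR_ge0.
apply: (@le_trans _ _ (expR u * expR (- (n%:R * (delta * L / 4))))); last first.
  by rewrite ler_wpM2l ?expR_ge0// expRN_le// mulr_gt0// divr_gt0.
rewrite -!expRD ler_expR /t.
have : n%:R * (S * L - Sbar * L) <= n%:R * (2 * (Q' * L)).
  by rewrite ler_pM2l// -mulrBl mulrA ler_pM2r.
rewrite -SQE; nra.
Qed.

End Rate.

Theorem theorem3 (R : realType) (TA TB : finType) (m : nat) (p : 'I_m -> R)
  (phi : 'I_m -> vec R (TA * TB)%type)
  (hp : distr p) (hphi : forall i, unit_vec (phi i)) (Q : R) (hQ : 0 <= Q) :
  Estar p phi 0 Q =
  (if holevo_B p phi / 2 <= Q then ((Num.max (S_EB p phi - Q) 0)%:E)%E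
   else (+oo)%E).
Proof.
rewrite /Estar; case: ifPn => [leQ|ltQ].
  apply/eqP; rewrite eq_le; apply/andP; split.
    (* The infimum is attained, since achievability already allows a slack [delta] in every rate. *)
    by apply: ereal_inf_lbound; exists (Num.max (S_EB p phi - Q) 0) => //;
      exact: achievable_direct.
  apply: le_ereal_inf_tmp => _ [E ach <-]; rewrite lee_fin ge_max.
  have := achievable_dim hp hphi ach; have [_ [_ [E0 _]]] := ach.
  by rewrite E0 andbT => ?; lra.
rewrite (_ : [set _ | _ in _] = set0)%classic ?ereal_inf0//.
apply/eqP/negPn; rewrite -/(is_true _); apply/negP => /set0P[_ [E ach _]].
by move: ltQ; rewrite (achievable_dense hp hphi ach).
Qed.
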